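(* Let $n\geq 3$ and fix $\rho\in[0,1)$. The function $\alpha\longmapsto C(\rho\boldsymbol{e}_1,\boldsymbol{\ell}_\alpha)$ attains its maximum on $[0,\pi/2]$ at $\alpha=0$.
   Context: $\mathbb{B}^n$ is the open unit ball of $\mathbb{R}^n$, $\mathbb{S}^{n-1}$ its boundary. For $x\in\mathbb{B}^n$ and $\boldsymbol{\ell}\in\mathbb{S}^{n-1}$, $C(x,\boldsymbol{\ell})$ is the smallest number such that $|\langle\nabla u(x),\boldsymbol{\ell}\rangle|\leq C(x,\boldsymbol{\ell})\sup_{y\in\mathbb{B}^n}|u(y)|$ for all bounded harmonic functions $u$ on $\mathbb{B}^n$. $\boldsymbol{e}_1,\boldsymbol{e}_2$ are the first two standard basis vectors of $\mathbb{R}^n$ and $\boldsymbol{\ell}_\alpha:=\boldsymbol{e}_1\cos\alpha+\boldsymbol{e}_2\sin\alpha$. *)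

(* Defs.v *)
From HB Require Import structures.
From mathcomp Require Import all_boot all_order all_algebra.
From mathcomp Require Import all_classical all_reals all_analysis.
Set Implicit Arguments. Unset Strict Implicit. Unset Printing Implicit Defensive.
Import Order.TTheory GRing.Theory Num.Theory.
Import numFieldNormedType.Exports.
Local Open Scope classical_set_scope.
Local Open Scope ring_scope.

(* Points of R^n are row vectors 'rV[R]_n. The canonical norm of 'rV in
   MathComp-Analysis is the sup norm, so the Euclidean structure (inner
   product, unit ball) is defined explicitly here. *)

(* k-th standard basis vector (0-based: e_1 is stdbasis n 0). *)
Definition stdbasis (R : realType) (n k : nat) : 'rV[R]_n :=
  \row_(j < n) ((j : nat) == k)%:R.

Definition dotR (R : realType) (n : nat) (u v : 'rV[R]_n) : R :=
  \sum_(i < n) u ord0 i * v ord0 i.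

Definition unit_ballE (R : realType) (n : nat) : set 'rV[R]_n :=
  [set x | dotR x x < 1].

Definition grad (R : realType) (n : nat) (u : 'rV[R]_n -> R) (x : 'rV[R]_n)
  : 'rV[R]_n := \row_(i < n) 'D_(stdbasis R n i) u x.

Definition harmonic_on (R : realType) (n : nat) (D : set 'rV[R]_n)
  (u : 'rV[R]_n -> R) : Prop :=
  [/\ forall x, D x -> differentiable u x,
      forall (i : 'I_n) x, D x -> differentiable ('D_(stdbasis R n i) u) x,
      forall (i j : 'I_n) x, D x ->
        {for x, continuous ('D_(stdbasis R n j) ('D_(stdbasis R n i) u))}
    & forall x, D x ->
        \sum_(i < n) 'D_(stdbasis R n i) ('D_(stdbasis R n i) u) x = 0].

Definition bounded_on (R : realType) (n : nat) (D : set 'rV[R]_n)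
  (u : 'rV[R]_n -> R) : Prop :=
  exists M : R, forall y, D y -> `|u y| <= M.

Definition C_opt (R : realType) (n : nat) (x l : 'rV[R]_n) : R :=
  inf [set c : R | forall u : 'rV[R]_n -> R,
         harmonic_on (@unit_ballE R n) u -> bounded_on (@unit_ballE R n) u ->
         `|dotR (grad u x) l| <= c * sup [set `|u y| | y in @unit_ballE R n]].

Definition ell (R : realType) (n : nat) (a : R) : 'rV[R]_n :=
  cos a *: stdbasis R n 0 + sin a *: stdbasis R n 1.

(* Main.v *)
(* By the maximum principle and the Poisson formula, [C_opt x l] is the spherical mean
   of [|dpoisson x z l|].  For [x = rho *: e0] a change of the polar angle of [z] turns
   this into [mass] times the mean of [|<z, l>| * weight <z, e0>], where the even part
   of the weight is nondecreasing in [|<z, e0>|].  Exchanging [e0] and [l] by a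
   Householder reflection and averaging with [z |-> - z], the comparison between [l]
   and [e0] becomes the rearrangement inequality for [|<z, e0>|] and [|<z, l>|]
   against the even part of the weight; it holds for every unit vector [l].

   The spherical mean [avg] is built by iterated integration in the polar angle; its
   invariance under reflections comes from the uniqueness of the Dirichlet problem. *)
From HB Require Import structures.
Require Import Defs.
From mathcomp Require Import all_boot all_order all_algebra.
From mathcomp Require Import all_classical all_reals all_analysis.
From mathcomp Require Import ring lra.
Set Implicit Arguments.
Unset Strict Implicit.
Unset Printing Implicit Defensive.
Import Order.TTheory GRing.Theory Num.Theory.
Import numFieldNormedType.Exports.
Local Open Scope classical_set_scope.
Local Open Scope ring_scope.

(** * Derivatives and integrals on an interval *)

(** At [rho *: e0] the gradient of the Poisson kernel is, as the pole [z] runs over the sphere, a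
    positive factor times a vector tracing an ellipsoid of revolution about [e0]. The ellipsoid has
    semi-axes [axial] and [lateral]; its centre is off the origin by [center] times [axial], and the
    origin is inside since [|center| < 1]. Projecting it radially onto the unit sphere is the change
    of polar angle, after which [l] enters only through [|<z, l>|]. The resulting weight, rescaled
    by [slope], is the restriction to a line of the convex function [a^((k+4)/2) b^(-k/2)], and the
    even part of a convex function grows with the modulus. Half-integer powers are written as
    natural powers of square roots, so this convexity reduces to Bernoulli's inequality. The mean is
    handled only as a positive normalised linear functional on continuous functions. Derivatives
    therefore pass under it by quadratic remainder bounds that are uniform on the sphere
    ([unif_diff]). *)

Lemma bernoulli (R : realDomainType) (x : R) k : 0 <= x -> 1 + k%:R * (x - 1) <= x ^+ k.
Proof.
move=> x0; elim: k => [|k IH]; first by rewrite mul0r addr0 expr0.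
rewrite exprS; have := ler_wpM2l x0 IH; rewrite -natr1.
have : 0 <= k%:R * (x - 1) ^+ 2 by rewrite mulr_ge0 // sqr_ge0.
lra.
Qed.

Section derive_rules.
Context {R : realType}.
Implicit Types (f g : R -> R) (x a b c : R).

Lemma der_eq f x a b : is_derive x 1 f a -> a = b -> is_derive x 1 f b.
Proof. by move=> d <-. Qed.

Lemma der_cst c x : is_derive x 1 (fun _ : R => c) 0.
Proof. exact: is_derive_cst. Qed.

Lemma der_id x : is_derive x 1 (fun t : R => t) 1.
Proof. exact: is_derive_id. Qed.

Lemma derD f g x a b : is_derive x 1 f a -> is_derive x 1 g b ->
  is_derive x 1 (fun t => f t + g t) (a + b).
Proof. by move=> df dg; exact: is_deriveD. Qed.

Lemma derB f g x a b : is_derive x 1 f a -> is_derive x 1 g b ->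
  is_derive x 1 (fun t => f t - g t) (a - b).
Proof. by move=> df dg; exact: is_deriveB. Qed.

Lemma derN f x a : is_derive x 1 f a -> is_derive x 1 (fun t => - f t) (- a).
Proof. by move=> df; exact: is_deriveN. Qed.

Lemma derM f g x a b : is_derive x 1 f a -> is_derive x 1 g b ->
  is_derive x 1 (fun t => f t * g t) (a * g x + f x * b).
Proof.
move=> df dg; apply: der_eq (is_deriveM df dg) _.
by rewrite addrC /GRing.scale /= (mulrC (g x)).
Qed.

Lemma derV f x a : f x != 0 -> is_derive x 1 f a ->
  is_derive x 1 (fun t => (f t)^-1) (- a / f x ^+ 2).
Proof.
move=> f0 df; apply: der_eq (is_deriveV f0 df) _.
by rewrite /GRing.scale /= mulNr mulrC mulNr.
Qed.

Lemma derX f x a k : is_derive x 1 f a ->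
  is_derive x 1 (fun t => f t ^+ k) (k%:R * f x ^+ k.-1 * a).
Proof.
move=> df; elim: k => [|k IH].
  rewrite (_ : (fun _ => _) = cst 1); last first.
    by apply/funext => t; rewrite expr0.
  by rewrite !mul0r; exact: is_derive_cst.
rewrite (_ : (fun _ => _) = fun t => f t * f t ^+ k); last first.
  by apply/funext => t; rewrite exprS.
apply: der_eq (derM df IH) _; case: k {IH} => [|k] /=.
  by rewrite !expr0; lra.
by rewrite -natr1 exprS; ring.
Qed.

Lemma der_sin x : is_derive x 1 (fun t : R => sin t) (cos x).
Proof. exact: is_derive_sin. Qed.

Lemma der_cos x : is_derive x 1 (fun t : R => cos t) (- sin x).
Proof. exact: is_derive_cos. Qed.

Lemma der_sqrt f x a : 0 < f x -> is_derive x 1 f a ->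
  is_derive x 1 (fun t => Num.sqrt (f t)) (a / (2 * Num.sqrt (f x))).
Proof.
move=> f0 df; apply: der_eq (is_derive1_comp (is_derive1_sqrt f0) df) _.
by rewrite mulrC.
Qed.

Lemma is_derive_cont f x a : is_derive x 1 f a -> {for x, continuous f}.
Proof.
by move=> df; apply: differentiable_continuous; apply/derivable1_diffP.
Qed.

End derive_rules.

Section interval_integral.
Context {R : realType}.
Implicit Types (a b : R) (f g F : R -> R).
Local Notation mu := (@lebesgue_measure R).

Definition intg a b f : R := \int[mu]_(x in `[a, b]) f x.

(** Continuity is two-sided even at the end points: the integrands used are continuous past the
    segment, and one-sided limits follow by restriction. *)
Definition cont_on a b f := forall x, a <= x <= b -> {for x, continuous f}.

Lemma cont_on_within a b f : cont_on a b f -> {within `[a, b], continuous f}.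
Proof.
move=> cf; apply: continuous_in_subspaceT => x; rewrite inE /= in_itv /=.
exact: cf.
Qed.

Lemma intg_integrable a b f : cont_on a b f ->
  mu.-integrable `[a, b] (EFin \o f).
Proof.
move=> cf; apply: continuous_compact_integrable; first exact: segment_compact.
exact: cont_on_within.
Qed.

Lemma eq_intg a b f g : (forall x, a <= x <= b -> f x = g x) ->
  intg a b f = intg a b g.
Proof.
by move=> fg; apply: eq_Rintegral => x; rewrite inE /= in_itv /=; exact: fg.
Qed.

Lemma intgD a b f g : cont_on a b f -> cont_on a b g ->
  intg a b (fun x => f x + g x) = intg a b f + intg a b g.
Proof.
by move=> cf cg; apply: RintegralD => //; exact: intg_integrable.
Qed.

Lemma intgZ a b c f : cont_on a b f ->
  intg a b (fun x => c * f x) = c * intg a b f.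
Proof.
by move=> cf; apply: RintegralZl => //; exact: intg_integrable.
Qed.

Lemma le_intg a b f g : cont_on a b f -> cont_on a b g ->
  (forall x, a <= x <= b -> f x <= g x) -> intg a b f <= intg a b g.
Proof.
by move=> cf cg fg; apply: le_Rintegral => //; exact: intg_integrable.
Qed.

Lemma intg_FTC a b f F : a < b -> cont_on a b f -> cont_on a b F ->
  (forall x, a < x < b -> is_derive x 1 F (f x)) ->
  intg a b f = F b - F a.
Proof.
move=> ab cf cF dF.
rewrite /intg /Rintegral (@continuous_FTC2 _ f F) //.
- exact: cont_on_within.
- split.
  + move=> x; rewrite in_itv /= => xab.
    by have h : is_derive x 1 F (f x) by exact: dF.
  + by apply: cvg_at_right_filter; apply: cF; rewrite lexx ltW.
  + by apply: cvg_at_left_filter; apply: cF; rewrite lexx ltW.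
- move=> x; rewrite in_itv /= => xab.
  have h : is_derive x 1 F (f x) by exact: dF.
  by rewrite derive1E derive_val.
Qed.

(** Positivity of [F'] is asked only in the open interval because the substitution [- cos t] on
    [[0, pi]] has derivative zero at both ends. *)
Lemma intg_subst a b F (F' G : R -> R) : a <= b ->
  (forall x, a < x < b -> 0 < F' x) ->
  (forall x, a <= x <= b -> is_derive x 1 F (F' x)) ->
  cont_on a b F' -> cont_on (F a) (F b) G ->
  intg (F a) (F b) G = intg a b (fun x => G (F x) * F' x).
Proof.
move=> ab F'0 dF cF' cG.
have cF x : a <= x <= b -> {for x, continuous F}.
  by move=> /dF h; apply: differentiable_continuous; apply/derivable1_diffP.
have incr : {in `[a, b] &, {homo F : x y / x < y}}.
  move=> x y; rewrite !in_itv /= => /andP[ax _] /andP[_ yb] xy.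
  have sub z : x <= z <= y -> a <= z <= b.
    by move=> /andP[xz zy]; rewrite (le_trans ax) // (le_trans zy).
  have dz z : z \in `]x, y[%R -> is_derive z 1 F (F' z).
    by rewrite in_itv /= => /andP[xz zy]; apply: dF; apply: sub; rewrite !ltW.
  have cz : {within `[x, y], continuous F}.
    by apply: cont_on_within => z /sub; exact: cF.
  have [z] := MVT xy dz cz; rewrite in_itv /= => /andP[xz zy] E.
  rewrite -subr_gt0 E mulr_gt0 ?subr_gt0 // F'0 //.
  by rewrite (le_lt_trans ax) // (lt_le_trans zy).
have dE x : a <= x <= b -> derive1 F x = F' x.
  by move=> /dF h; rewrite derive1E derive_val.
(* The substitution theorem speaks of [derive1 F], which is identified with [F'] only on [[a, b]];
   its limits are transported along this local equality. *)
have nearE x : a < x < b -> {near x, F' =1 derive1 F}.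
  move=> xab; near=> y; rewrite dE //.
  have : y \in `]a, b[ by near: y; apply: near_in_itvoo; rewrite in_itv.
  by rewrite in_itv /= => /andP[/ltW -> /ltW ->].
move: ab; rewrite le_eqVlt => /predU1P[->|ab].
  by rewrite /intg !set_itv1 !Rintegral_set1.
rewrite /intg /Rintegral (@integration_by_substitution_increasing _ F G) ?ltW //.
- congr fine; apply: eq_integral => x; rewrite inE /= in_itv /= => xab.
  by congr EFin; rewrite -dE.
- move=> x; rewrite in_itv /= => /andP[ax xb].
  have h : {near x, F' =1 derive1 F} by apply: nearE; rewrite ax xb.
  rewrite /continuous_at (dE x) ?(ltW ax) ?(ltW xb) //.
  apply: cvg_trans (near_eq_cvg h) _.
  by apply: cF'; rewrite !ltW.
- apply/cvg_ex; exists (F' a).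
  have c : F' x @[x --> a^'+] --> F' a.
    by apply: cvg_at_right_filter; apply: cF'; rewrite lexx ltW.
  apply: cvg_trans c; apply: near_eq_cvg; near=> y; rewrite dE //; apply/andP; split.
    by near: y; exact: nbhs_right_ge.
  by near: y; exact: nbhs_right_le.
- apply/cvg_ex; exists (F' b).
  have c : F' x @[x --> b^'-] --> F' b.
    by apply: cvg_at_left_filter; apply: cF'; rewrite lexx ltW.
  apply: cvg_trans c; apply: near_eq_cvg; near=> y; rewrite dE //; apply/andP; split.
    by near: y; exact: nbhs_left_ge.
  by near: y; exact: nbhs_left_le.
- split.
  + move=> x; rewrite in_itv /= => /andP[/ltW ax /ltW xb].
    by have h : is_derive x 1 F (F' x) by apply: dF; rewrite ax xb.
  + by apply: cvg_at_right_filter; apply: cF; rewrite lexx ltW.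
  + by apply: cvg_at_left_filter; apply: cF; rewrite lexx ltW.
- exact: cont_on_within.
Unshelve. all: by end_near. Qed.

End interval_integral.

(** * Euclidean space *)

Section euclid.
Context {R : realType}.

Lemma cont_sum (T : topologicalType) (I : Type) (r : seq I)
    (F : I -> T -> R) (x : T) : (forall i, {for x, continuous (F i)}) ->
  {for x, continuous (fun t => \sum_(i <- r) F i t)}.
Proof.
move=> cF; elim: r => [|i r IH].
  rewrite (_ : (fun _ => _) = cst 0); first exact: cst_continuous.
  by apply/funext => t; rewrite big_nil.
rewrite (_ : (fun _ => _) = fun t => F i t + \sum_(i <- r) F i t).
  by apply: cvgD; [exact: cF|exact: IH].
by apply/funext => t; rewrite big_cons.
Qed.

Lemma rv_coord_le n (v : 'rV[R]_n) i : `|v 0 i| <= `|v|.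
Proof.
rewrite [leRHS]/Num.Def.normr /= mx_normrE; apply/bigmax_geP; right => /=.
by exists (0, i).
Qed.

Lemma rv_norm_lt n (v : 'rV[R]_n) e : 0 < e -> (forall i, `|v 0 i| < e) ->
  `|v| < e.
Proof.
move=> e0 h; rewrite [ltLHS]/Num.Def.normr /= mx_normrE; apply/bigmax_ltP; split => //.
by move=> [i j] _ /=; rewrite (ord1 i).
Qed.

Lemma dotRC n (u v : 'rV[R]_n) : dotR u v = dotR v u.
Proof. by apply: eq_bigr => i _; rewrite mulrC. Qed.

Lemma dotRDl n (u v w : 'rV[R]_n) : dotR (u + v) w = dotR u w + dotR v w.
Proof.
by rewrite /dotR -big_split; apply: eq_bigr => i _; rewrite mxE mulrDl.
Qed.

Lemma dotRZl n c (u v : 'rV[R]_n) : dotR (c *: u) v = c * dotR u v.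
Proof.
by rewrite /dotR mulr_sumr; apply: eq_bigr => i _; rewrite mxE mulrA.
Qed.

Lemma dotRNl n (u v : 'rV[R]_n) : dotR (- u) v = - dotR u v.
Proof. by rewrite -scaleN1r dotRZl mulN1r. Qed.

Lemma dotRDr n (u v w : 'rV[R]_n) : dotR w (u + v) = dotR w u + dotR w v.
Proof. by rewrite dotRC dotRDl !(dotRC w). Qed.

Lemma dotRZr n c (u v : 'rV[R]_n) : dotR u (c *: v) = c * dotR u v.
Proof. by rewrite dotRC dotRZl dotRC. Qed.

Lemma dotRNr n (u v : 'rV[R]_n) : dotR u (- v) = - dotR u v.
Proof. by rewrite dotRC dotRNl dotRC. Qed.

Lemma dotR0l n (v : 'rV[R]_n) : dotR 0 v = 0.
Proof. by rewrite -(scale0r 0) dotRZl mul0r. Qed.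

Definition dotRE := (dotRDl, dotRDr, dotRNl, dotRNr, dotRZl, dotRZr).

Lemma dotR_ge0 n (v : 'rV[R]_n) : 0 <= dotR v v.
Proof. by apply: sumr_ge0 => i _; rewrite -expr2 sqr_ge0. Qed.

Lemma dotR_coord n (v : 'rV[R]_n) i : v 0 i ^+ 2 <= dotR v v.
Proof.
rewrite /dotR (bigD1 i) //= -expr2 lerDl.
by apply: sumr_ge0 => j _; rewrite -expr2 sqr_ge0.
Qed.

Lemma norm_dotR n (v : 'rV[R]_n) : `|v| ^+ 2 <= dotR v v.
Proof.
suff h : `|v| <= Num.sqrt (dotR v v).
  by rewrite -[leRHS]sqr_sqrtr ?dotR_ge0 // lerXn2r ?nnegrE ?sqrtr_ge0.
apply/ler_addgt0Pr => e e0; apply/ltW/rv_norm_lt => [|i].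
  by rewrite ltr_wpDl // sqrtr_ge0.
apply: (@le_lt_trans _ _ (Num.sqrt (dotR v v))); last by rewrite ltrDl.
by rewrite -sqrtr_sqr ler_wsqrtr // dotR_coord.
Qed.

Lemma dotR_eq0 n (v : 'rV[R]_n) : dotR v v = 0 -> v = 0.
Proof.
move=> v0; apply/rowP => i; rewrite mxE; apply/eqP.
by rewrite -sqrf_eq0 -(@le_anti _ _ (v 0 i ^+ 2) 0) // sqr_ge0 -v0 dotR_coord.
Qed.

Lemma dotR_CS n (u v : 'rV[R]_n) : dotR u v ^+ 2 <= dotR u u * dotR v v.
Proof.
have [/dotR_eq0 ->|v0] := eqVneq (dotR v v) 0.
  by rewrite dotRC !dotR0l expr0n mulr0.
have vp : 0 < dotR v v by rewrite lt_def v0 dotR_ge0.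
have := dotR_ge0 (dotR v v *: u - dotR u v *: v).
rewrite !dotRE (dotRC v u) => h.
rewrite -subr_ge0 -(pmulr_rge0 _ vp).
by apply: le_trans h _; rewrite le_eqVlt; apply/orP; left; apply/eqP; ring.
Qed.

(** The distance is at least [1 - |y| >= 1 - sqrt s >= (1 - s) / 2]. This keeps the argument of the
    square root in the kernels away from zero, uniformly on smaller balls. *)
Lemma dotR_sphere n (y z : 'rV[R]_n) s : dotR y y <= s -> s < 1 ->
  dotR z z = 1 -> (1 - s) ^+ 2 / 4 <= dotR (y - z) (y - z).
Proof.
move=> ys s1 z1; rewrite !dotRE z1 (dotRC z y).
have s0 : 0 <= s by apply: le_trans ys; exact: dotR_ge0.
have := dotR_CS y z; rewrite z1 mulr1; set t := dotR y z.
set r := dotR y y in ys *; move=> tr.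
have := sqr_ge0 (t * 2 - (1 + s)).
have : 0 <= (1 - s) ^+ 2 by exact: sqr_ge0.
have r0 : 0 <= r by exact: dotR_ge0.
nra.
Qed.

Lemma dotR_continuous n (y : 'rV[R]_n) : continuous (dotR y).
Proof.
move=> z; apply: cont_sum => i.
have h : {for z, continuous (fun t : 'rV[R]_n => t ord0 i)}.
  exact: coord_continuous.
exact: (cvgM (cvg_cst _) h).
Qed.

Lemma dotRR_continuous n : continuous (fun z : 'rV[R]_n => dotR z z).
Proof.
move=> z; apply: cont_sum => i.
have h : {for z, continuous (fun t : 'rV[R]_n => t ord0 i)}.
  exact: coord_continuous.
exact: (cvgM h h).
Qed.

Definition cball n : set 'rV[R]_n := [set z | dotR z z <= 1].

Lemma cball_compact n : compact (@cball n).
Proof.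
apply: bounded_closed_compact.
  exists 1; split => // M M1 z z1 /=; apply: ltW; apply: le_lt_trans M1.
  rewrite -(@ler_pXn2r _ 2) ?nnegrE // expr1n.
  by apply: le_trans (norm_dotR z) _.
have -> : @cball n = (fun z => dotR z z) @^-1` [set x | x <= 1] by [].
apply: preimage_closed; last exact: closed_le.
by move=> z _; exact: dotRR_continuous.
Qed.

(** Only one of the two points has to lie in [A]: [f] is continuous in the ambient space at each
    point of [A], so the modulus extends to a neighbourhood. *)
Lemma compact_unif n (A : set 'rV[R]_n) (f : 'rV[R]_n -> R) : compact A ->
  (forall z, A z -> {for z, continuous f}) ->
  forall e, 0 < e -> exists2 d, 0 < d &
    forall z z', A z -> `|z - z'| < d -> `|f z - f z'| < e.
Proof.
move=> /compact_near_coveringP cA cf e e0.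
pose P (d : R) z := forall z', `|z - z'| < d -> `|f z - f z'| < e.
have : \forall d \near 0^'+, A `<=` P d.
  apply: cA => x Ax.
  have : \forall w \near x, `|f x - f w| < e / 2.
    by apply: (@cvgr_dist_lt _ _ _ (nbhs x)); [exact: cf|rewrite divr_gt0].
  move=> /nbhs_ballP[r /= r0 xr].
  exists (ball x (r / 2), [set d | d < r / 2]) => /=.
    split; first by apply: nbhsx_ballx; rewrite divr_gt0.
    by apply: nbhs_right_lt; rewrite divr_gt0.
  move=> [w d] /= [xw dr] z' wz'.
  have w1 : `|f x - f w| < e / 2.
    by apply: xr; apply: le_ball xw; lra.
  have w2 : `|f x - f z'| < e / 2.
    apply: xr; rewrite -ball_normE /=; move: xw; rewrite -ball_normE /= => xw.
    rewrite -(subrK w x) -addrA (le_lt_trans (ler_normD _ _)) //.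
    by rewrite (splitr r) ltrD // (lt_trans wz').
  rewrite -(subrK (f x) (f w)) -addrA (le_lt_trans (ler_normD _ _)) //.
  by rewrite distrC (splitr e) ltrD.
move=> h.
near (0 : R)^'+ => d.
exists d; first by near: d; exact: nbhs_right_gt.
by move=> z z' Az; apply: (near h d).
Unshelve. all: by end_near. Qed.

End euclid.

(** * The spherical mean *)

Section sphere_mean.
Context {R : realType}.

Definition sph n : set 'rV[R]_n := [set z | dotR z z = 1].

Lemma sph_compact n : compact (@sph n).
Proof.
apply: (subclosed_compact _ (@cball_compact R n)); last first.
  by move=> z /= z1; rewrite /cball /= z1.
have -> : @sph n = (fun z => dotR z z) @^-1` [set 1] by [].
apply: preimage_closed; last exact: closed_eq.
by move=> z _; exact: dotRR_continuous.
Qed.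

Definition csph n (f : 'rV[R]_n -> R) := forall z, sph z -> {for z, continuous f}.

Lemma csph_cst n c : csph (fun _ : 'rV[R]_n => c).
Proof. by move=> z _; exact: cst_continuous. Qed.

Lemma csphD n (f g : 'rV[R]_n -> R) : csph f -> csph g ->
  csph (fun z => f z + g z).
Proof. by move=> cf cg z z1; exact: (cvgD (cf z z1) (cg z z1)). Qed.

Lemma csphM n (f g : 'rV[R]_n -> R) : csph f -> csph g ->
  csph (fun z => f z * g z).
Proof. by move=> cf cg z z1; exact: (cvgM (cf z z1) (cg z z1)). Qed.

Lemma csphN n (f : 'rV[R]_n -> R) : csph f -> csph (fun z => - f z).
Proof. by move=> cf z z1; exact: (cvgN (cf z z1)). Qed.

Lemma csphB n (f g : 'rV[R]_n -> R) : csph f -> csph g ->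
  csph (fun z => f z - g z).
Proof. by move=> cf cg; apply: csphD => //; exact: csphN. Qed.

Lemma csphX n (f : 'rV[R]_n -> R) k : csph f -> csph (fun z => f z ^+ k).
Proof.
move=> cf; elim: k => [|k IH].
  rewrite (_ : (fun _ => _) = cst 1); first exact: csph_cst.
  by apply/funext => z; rewrite expr0.
rewrite (_ : (fun _ => _) = fun z => f z * f z ^+ k); first exact: csphM.
by apply/funext => z; rewrite exprS.
Qed.

Lemma csph_norm n (f : 'rV[R]_n -> R) : csph f -> csph (fun z => `|f z|).
Proof. by move=> cf z z1; exact: (cvg_norm (cf z z1)). Qed.

Lemma csphV n (f : 'rV[R]_n -> R) : csph f -> (forall z, sph z -> f z != 0) ->
  csph (fun z => (f z)^-1).
Proof. by move=> cf f0 z z1; exact: (cvgV (f0 z z1) (cf z z1)). Qed.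

Lemma csph_sqrt n (f : 'rV[R]_n -> R) : csph f ->
  csph (fun z => Num.sqrt (f z)).
Proof.
by move=> cf z z1; apply: continuous_comp; [exact: cf|exact: sqrt_continuous].
Qed.

Lemma csph_dot n (y : 'rV[R]_n) : csph (dotR y).
Proof. by move=> z _; exact: dotR_continuous. Qed.

Lemma csph_sum n (I : Type) (r : seq I) (F : I -> 'rV[R]_n -> R) :
  (forall i, csph (F i)) -> csph (fun z => \sum_(i <- r) F i z).
Proof. by move=> cF z z1; apply: cont_sum => i; exact: cF. Qed.

Definition consrv n (x : R) (y : 'rV[R]_n) : 'rV[R]_n.+1 :=
  \row_i (if unlift ord0 i is Some j then y 0 j else x).

Lemma consrv0 n x (y : 'rV[R]_n) : consrv x y 0 ord0 = x.
Proof. by rewrite mxE unlift_none. Qed.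

Lemma consrvS n x (y : 'rV[R]_n) j : consrv x y 0 (lift ord0 j) = y 0 j.
Proof. by rewrite mxE liftK. Qed.

Lemma consrv_eta n (y : 'rV[R]_n.+1) :
  y = consrv (y 0 ord0) (\row_j y 0 (lift ord0 j)).
Proof.
by apply/rowP => i; case: (unliftP ord0 i) => [j|] ->; rewrite ?consrvS ?consrv0 ?mxE.
Qed.

Lemma dotR_consrv n a b (u v : 'rV[R]_n) :
  dotR (consrv a u) (consrv b v) = a * b + dotR u v.
Proof.
rewrite /dotR big_ord_recl !consrv0; congr (_ + _).
by apply: eq_bigr => i _; rewrite !consrvS.
Qed.

Lemma consrvB n a b (u v : 'rV[R]_n) : consrv a u - consrv b v = consrv (a - b) (u - v).
Proof.
by apply/rowP => i; rewrite !mxE; case: unliftP => [j|] _ //; rewrite !mxE.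
Qed.

Lemma consrv_norm_lt n a (u : 'rV[R]_n) e : 0 < e -> `|a| < e -> `|u| < e ->
  `|consrv a u| < e.
Proof.
move=> e0 ae ue; apply: rv_norm_lt => // i; case: (unliftP ord0 i) => [j|] ->.
  by rewrite consrvS; apply: le_lt_trans ue; exact: rv_coord_le.
by rewrite consrv0.
Qed.

Definition polar n (t : R) (xi : 'rV[R]_n) := consrv (cos t) (sin t *: xi).

Lemma arc_sph n (c s : R) (xi : 'rV[R]_n) : c ^+ 2 + s ^+ 2 = 1 -> sph xi ->
  sph (consrv c (s *: xi)).
Proof.
by move=> cs; rewrite /sph /= => x1; rewrite dotR_consrv !dotRE x1 mulr1 -!expr2.
Qed.

Lemma polar_sph n t (xi : 'rV[R]_n) : sph xi -> sph (polar t xi).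
Proof. exact: arc_sph (cos2Dsin2 t). Qed.

(** The pair [(c, s)] is abstract because it is [(cos t, sin t)] in the polar angle and
    [(- u, height u)] after the substitution [u = - cos t]. *)
Lemma csph_arc n c s (f : 'rV[R]_n.+1 -> R) : c ^+ 2 + s ^+ 2 = 1 -> csph f ->
  csph (fun xi : 'rV[R]_n => f (consrv c (s *: xi))).
Proof.
move=> cs cf z z1; apply: continuous_comp; last by apply: cf; exact: arc_sph.
apply/(@cvgrPdist_lt _ _ _ (nbhs z)) => e e0.
apply/nbhs_ballP; exists e => //= w; rewrite -ball_normE /= => zw.
rewrite consrvB subrr -scalerBr; apply: consrv_norm_lt; rewrite ?normr0 // normrZ.
apply: le_lt_trans zw; rewrite ler_piMl //.
by rewrite -(@ler_pXn2r _ 2) ?nnegrE // real_normK ?num_real // expr1n -cs lerDr sqr_ge0.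
Qed.

Lemma csph_polar n t (f : 'rV[R]_n.+1 -> R) : csph f ->
  csph (fun xi : 'rV[R]_n => f (polar t xi)).
Proof. exact: csph_arc (cos2Dsin2 t). Qed.

Definition wsin m : R := intg 0 (pi : R) (fun t => sin t ^+ m).

(** The sphere of [R^1] is the pair of points 1 and -1. In [R^(m+2)] the latitude at polar angle [t]
    is an [m]-dimensional sphere of radius [sin t], hence the density [sin t ^+ m], normalised by
    [wsin m]. *)
Fixpoint avg n : ('rV[R]_n.+1 -> R) -> R :=
  match n with
  | 0 => fun f => (f (const_mx 1) + f (const_mx (-1))) / 2
  | m.+1 => fun f => (wsin m)^-1 * intg 0 (pi : R)
      (fun t => sin t ^+ m * avg (fun xi => f (polar t xi)))
  end.

Lemma sinX_continuous m : continuous (fun t : R => sin t ^+ m).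
Proof.
move=> t; apply: (@continuous_comp _ _ _ sin (fun x => x ^+ m)).
  exact: continuous_sin.
exact: exprn_continuous.
Qed.

Lemma wsin_gt0 m : 0 < wsin m.
Proof.
(* tangent line of [x ^+ m] at [1 / 2] *)
pose g (t : R) : R := 2^-1 ^+ m * (1 + m%:R * (2 * sin t - 1)).
pose G (t : R) : R := 2^-1 ^+ m * ((1 - m%:R) * t - m%:R * 2 * cos t).
have cg : continuous g.
  move=> t; apply: cvgM; first exact: cvg_cst.
  apply: cvgD; first exact: cvg_cst.
  apply: cvgM; first exact: cvg_cst.
  apply: cvgB; last exact: cvg_cst.
  by apply: cvgM; [exact: cvg_cst|exact: continuous_sin].
apply: (@lt_le_trans _ _ (intg 0 pi g)); last first.
  apply: le_intg => [t _|t _|t /andP[t0 tpi]].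
  - exact: cg.
  - exact: sinX_continuous.
  have s0 : 0 <= sin t by apply: sin_ge0_pi; rewrite t0.
  have B : 1 + m%:R * (2 * sin t - 1) <= (2 * sin t) ^+ m.
    by apply: bernoulli; rewrite mulr_ge0.
  apply: le_trans (ler_wpM2l _ B) _; first by rewrite exprn_ge0 // invr_ge0.
  by rewrite -exprMn mulrA mulVf // mul1r.
have piP : (0 : R) < pi by exact: pi_gt0.
have -> : intg 0 pi g = G pi - G 0.
  have dG (t : R) : is_derive t 1 G (g t).
    apply: der_eq (derM (der_cst _ _) (derB (derM (der_cst _ _)
    (der_id _)) (derM (der_cst _ _) (der_cos _)))) _.
    by rewrite /g; ring.
  apply: intg_FTC => // t _; [exact: cg|exact: is_derive_cont (dG t)].
rewrite /G cos0 cospi -mulrBr mulr_gt0 ?exprn_gt0 ?invr_gt0 //.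
(* The integral of [g] is [2^-m (pi + m (4 - pi))], so its sign follows from [pi < 4]. *)
have := @pihalf_lt2 R; case: m {g G cg} => [|m]; first by lra.
move=> pi4; have : 0 <= m%:R * (4 - pi : R) by rewrite mulr_ge0 //; lra.
by rewrite -natr1; lra.
Qed.

End sphere_mean.

Section sphere_mean_theory.
Context {R : realType}.

(** Differentiation under the mean and harmonicity of Poisson integrals use these four properties
    alone. They also form the induction hypothesis that makes the inner means of [avg]
    continuous. *)
Definition mean_functional n (L : ('rV[R]_n -> R) -> R) :=
  [/\ forall f g, csph f -> csph g -> L (fun z => f z + g z) = L f + L g,
      forall c f, csph f -> L (fun z => c * f z) = c * L f,
      forall f g, csph f -> csph g -> (forall z, sph z -> f z <= g z) ->
        L f <= L g
    & L (fun=> 1) = 1].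

Lemma mean_norm_le n (L : ('rV[R]_n -> R) -> R) f g : mean_functional L ->
  csph f -> csph g -> (forall z, sph z -> `|f z| <= g z) -> `|L f| <= L g.
Proof.
move=> [LD LZ Lle L1] cf cg fg.
have LN : L (fun z => (-1) * f z) = - L f by rewrite LZ // mulN1r.
rewrite ler_norml lerNl -LN; apply/andP; split.
  apply: Lle => //; first by apply: csphM => //; exact: csph_cst.
  by move=> z /fg; rewrite mulN1r => /ler_normlP[].
by apply: Lle => // z /fg /ler_normlP[].
Qed.

Lemma mean_B n (L : ('rV[R]_n -> R) -> R) f g : mean_functional L ->
  csph f -> csph g -> L (fun z => f z - g z) = L f - L g.
Proof.
move=> [LD LZ _ _] cf cg.
rewrite -mulN1r -LZ // -LD //; last by apply: csphM => //; exact: csph_cst.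
by congr L; apply/funext => z; rewrite mulN1r.
Qed.

Lemma mean_cst n (L : ('rV[R]_n -> R) -> R) c : mean_functional L ->
  L (fun=> c) = c.
Proof.
move=> [_ LZ _ L1]; rewrite -[RHS]mulr1 -L1 -LZ; last exact: csph_cst.
by congr L; apply/funext => z; rewrite mulr1.
Qed.

Lemma mean_dist_le n (L : ('rV[R]_n -> R) -> R) f g e : mean_functional L ->
  csph f -> csph g -> (forall z, sph z -> `|f z - g z| <= e) ->
  `|L f - L g| <= e.
Proof.
move=> mL cf cg fg; rewrite -mean_B // -[leRHS](mean_cst _ mL).
by apply: mean_norm_le => //; [exact: csphB|exact: csph_cst].
Qed.

Lemma mean_eq n (L : ('rV[R]_n -> R) -> R) f g : mean_functional L ->
  csph f -> csph g -> (forall z, sph z -> f z = g z) -> L f = L g.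
Proof.
move=> [_ _ Lle _] cf cg fg; apply/eqP; rewrite eq_le.
by rewrite !Lle // => z z1; rewrite fg.
Qed.

Lemma mean_continuous n (L : ('rV[R]_n -> R) -> R) (K : R -> 'rV[R]_n -> R) t :
  mean_functional L -> (forall s, csph (K s)) ->
  (forall e, 0 < e -> \forall s \near t, forall z, sph z -> `|K t z - K s z| < e) ->
  {for t, continuous (fun s => L (K s))}.
Proof.
move=> mL cK h; apply/cvgrPdist_le => e e0; near=> s.
apply: mean_dist_le => // z z1; apply: ltW; move: z z1; near: s; exact: h.
Unshelve. all: by end_near. Qed.

(** The mean property is a hypothesis here because the induction proving it for [avg] needs this
    continuity one dimension lower. *)
Lemma avg_arc_continuous n (f : 'rV[R]_n.+2 -> R) (c s : R -> R) (t : R) :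
  mean_functional (@avg R n) -> csph f -> (forall u, c u ^+ 2 + s u ^+ 2 = 1) ->
  {for t, continuous c} -> {for t, continuous s} ->
  {for t, continuous (fun u => avg (fun xi => f (consrv (c u) (s u *: xi))))}.
Proof.
move=> mL cf cs cc cts.
apply: (mean_continuous (K := fun u xi => f (consrv (c u) (s u *: xi))) mL) => [u|e e0].
  exact: csph_arc.
have [d d0 fd] := compact_unif (@sph_compact R n.+2) cf e0.
have hc : \forall u \near t, `|c t - c u| < d.
  by apply: (@cvgr_dist_lt _ _ _ (nbhs t)).
have hs : \forall u \near t, `|s t - s u| < d.
  by apply: (@cvgr_dist_lt _ _ _ (nbhs t)).
near=> u => z z1; apply: fd; first exact: arc_sph.
rewrite consrvB -scalerBl; apply: consrv_norm_lt => //.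
  by near: u; exact: hc.
have z1' : `|z| <= 1.
  by rewrite -(@ler_pXn2r _ 2) ?nnegrE // expr1n -z1 norm_dotR.
rewrite normrZ; apply: (@le_lt_trans _ _ (`|s t - s u|)).
  by rewrite ler_piMr.
by near: u; exact: hs.
Unshelve. all: by end_near. Qed.

Lemma avg_polar_continuous n (f : 'rV[R]_n.+2 -> R) k :
  mean_functional (@avg R n) -> csph f ->
  continuous (fun t => sin t ^+ k * avg (fun xi => f (polar t xi))).
Proof.
move=> mL cf t; apply: cvgM; first exact: sinX_continuous.
by apply: avg_arc_continuous => // [u||]; [exact: cos2Dsin2|exact: continuous_cos|
  exact: continuous_sin].
Qed.

Lemma const_sph1 : sph (const_mx 1 : 'rV[R]_1) /\ sph (const_mx (-1) : 'rV[R]_1).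
Proof. by rewrite /sph /= /dotR !big_ord1 !mxE mulrNN mulr1. Qed.

Lemma avg_mean n : mean_functional (@avg R n).
Proof.
elim: n => [|n IH].
  have [s1 sN1] := const_sph1.
  split=> [f g _ _|c f _|f g _ _ fg|] /=.
  - by field.
  - by field.
  - by rewrite ler_pM2r ?invr_gt0 // lerD // fg.
  - by rewrite -[1 + 1]/(2%:R) divff.
have w0 := wsin_gt0 n (R := R).
have cI (f : 'rV[R]_n.+2 -> R) k : csph f ->
    cont_on 0 pi (fun t => sin t ^+ k * avg (fun xi => f (polar t xi))).
  by move=> cf t _; exact: avg_polar_continuous.
have [LD LZ Lle L1] := IH.
split=> [f g cf cg|c f cf|f g cf cg fg|] /=.
- rewrite -mulrDr -intgD; [|exact: cI|exact: cI].
  congr (_ * _); apply: eq_intg => t _; rewrite -mulrDr LD //; exact: csph_polar.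
- rewrite mulrCA -(intgZ c); last exact: cI.
  congr (_ * _); apply: eq_intg => t _; rewrite mulrCA LZ //; exact: csph_polar.
- rewrite ler_pM2l ?invr_gt0 //; apply: le_intg; [exact: cI|exact: cI|].
  move=> t /andP[t0 tpi]; apply: ler_wpM2l.
    by apply: exprn_ge0; apply: sin_ge0_pi; rewrite t0.
  apply: Lle => [||z z1]; [exact: csph_polar|exact: csph_polar|].
  by apply: fg; exact: polar_sph.
- rewrite [X in _ * X](_ : _ = wsin n) ?mulVf ?gt_eqF //.
  by apply: eq_intg => t _; rewrite L1 mulr1.
Qed.

End sphere_mean_theory.

(** * Differentiation under the mean *)

Section uniform_diff.
Context {R : realType} {V : normedModType R} {X : Type}.
Variables (D : set V) (S : set X).
Implicit Types (k : V -> X -> R) (dk : V -> X -> V -> R).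

(** Differentiability in [v] with a quadratic remainder whose constant is the same for all
    parameters [x]; it survives a mean over [x] and replaces dominated convergence. The bounds on
    [k], on [dk] and on increments are included so that the class is closed under products. *)
Definition unif_diff k dk :=
  (forall v x c h h', dk v x (c *: h + h') = c * dk v x h + dk v x h') /\
  exists2 C : R, 0 <= C & forall v w x, D v -> D w -> S x ->
    [/\ `|k v x| <= C, forall h, `|dk v x h| <= C * `|h|,
        `|k w x - k v x| <= C * `|w - v|
      & `|k w x - k v x - dk v x (w - v)| <= C * `|w - v| ^+ 2].

Lemma unif_diff_eq k k' dk dk' : unif_diff k dk ->
  (forall v x, k v x = k' v x) -> (forall v x h, dk v x h = dk' v x h) ->
  unif_diff k' dk'.
Proof.
move=> ud kk' dd'; suff -> : k' = k.
  suff -> : dk' = dk by [].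
  by apply/funext => v; apply/funext => x; apply/funext => h; rewrite dd'.
by apply/funext => v; apply/funext => x; rewrite kk'.
Qed.

Lemma unif_diff_cst (g : X -> R) M : (forall x, S x -> `|g x| <= M) ->
  unif_diff (fun _ x => g x) (fun _ _ _ => 0).
Proof.
move=> gM; split; first by move=> *; rewrite mulr0 addr0.
exists `|M| => // v w x _ _ Sx; split.
- by rewrite (le_trans (gM x Sx)) // ler_norm.
- by move=> h; rewrite normr0 mulr_ge0.
- by rewrite subrr normr0 mulr_ge0.
- by rewrite subrr subr0 normr0 mulr_ge0 // exprn_ge0.
Qed.

Lemma unif_diff_lin (phi : V -> R) B M :
  (forall c h h', phi (c *: h + h') = c * phi h + phi h') ->
  (forall v, D v -> `|v| <= B) -> (forall h, `|phi h| <= M * `|h|) ->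
  unif_diff (fun v _ => phi v) (fun _ _ h => phi h).
Proof.
move=> lphi DB phiM; split => //.
have phiB v w : phi (w - v) = phi w - phi v.
  by rewrite addrC -scaleN1r lphi mulN1r addrC.
exists (`|M| + `|M| * `|B|) => [|v w x Dv Dw Sx].
  by rewrite addr_ge0 // mulr_ge0.
have phiM' h : `|phi h| <= `|M| * `|h|.
  by apply: le_trans (phiM h) _; rewrite ler_wpM2r // ler_norm.
have phiM2 h : `|phi h| <= (`|M| + `|M| * `|B|) * `|h|.
  by apply: le_trans (phiM' h) _; rewrite ler_wpM2r // lerDl mulr_ge0.
split => //.
- apply: le_trans (phiM' v) _; apply: (@le_trans _ _ (`|M| * `|B|)).
    by rewrite ler_wpM2l // (le_trans (DB v Dv)) // ler_norm.
  by rewrite lerDr.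
- by rewrite -phiB.
- by rewrite phiB subrr normr0 mulr_ge0 ?exprn_ge0 // addr_ge0 // mulr_ge0.
Qed.

Lemma unif_diffD k1 dk1 k2 dk2 : unif_diff k1 dk1 -> unif_diff k2 dk2 ->
  unif_diff (fun v x => k1 v x + k2 v x) (fun v x h => dk1 v x h + dk2 v x h).
Proof.
move=> [l1 [C1 C10 H1]] [l2 [C2 C20 H2]]; split.
  by move=> v x c h h'; rewrite l1 l2; ring.
exists (C1 + C2) => [|v w x Dv Dw Sx]; first exact: addr_ge0.
have [a1 b1 c1 d1] := H1 v w x Dv Dw Sx.
have [a2 b2 c2 d2] := H2 v w x Dv Dw Sx.
split.
- exact: le_trans (ler_normD _ _) (lerD a1 a2).
- by move=> h; rewrite mulrDl; exact: le_trans (ler_normD _ _) (lerD (b1 h) (b2 h)).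
- rewrite mulrDl opprD addrACA.
  exact: le_trans (ler_normD _ _) (lerD c1 c2).
- rewrite mulrDl (_ : _ - _ - _ = (k1 w x - k1 v x - dk1 v x (w - v)) +
    (k2 w x - k2 v x - dk2 v x (w - v))); last by ring.
  exact: le_trans (ler_normD _ _) (lerD d1 d2).
Qed.

Lemma unif_diffM k1 dk1 k2 dk2 : unif_diff k1 dk1 -> unif_diff k2 dk2 ->
  unif_diff (fun v x => k1 v x * k2 v x)
    (fun v x h => dk1 v x h * k2 v x + k1 v x * dk2 v x h).
Proof.
move=> [l1 [C1 C10 H1]] [l2 [C2 C20 H2]]; split.
  by move=> v x c h h'; rewrite l1 l2; ring.
(* The remainder of a product splits into two first-order remainders and the product of the
   increments, each bounded by [C1 * C2]. *)
exists (C1 * C2 + C1 * C2 + C1 * C2) => [|v w x Dv Dw Sx].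
  by rewrite !addr_ge0 // mulr_ge0.
have [a1 b1 c1 d1] := H1 v w x Dv Dw Sx.
have [a2 b2 c2 d2] := H2 v w x Dv Dw Sx.
have C12 : 0 <= C1 * C2 by exact: mulr_ge0.
have [a1' _ _ _] := H1 w v x Dw Dv Sx.
have M (a b c d : R) : `|a| <= c -> `|b| <= d -> `|a * b| <= c * d.
  by move=> ac bd; rewrite normrM ler_pM.
split.
- by apply: le_trans (M _ _ _ _ a1 a2) _; rewrite -addrA lerDl addr_ge0.
- move=> h; apply: le_trans (ler_normD _ _) _.
  apply: le_trans (lerD (M _ _ _ _ (b1 h) a2) (M _ _ _ _ a1 (b2 h))) _.
  have : 0 <= C1 * C2 * `|h| by rewrite mulr_ge0.
  by lra.
- rewrite (_ : _ - _ = (k1 w x - k1 v x) * k2 v x + k1 w x * (k2 w x - k2 v x));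
    last by ring.
  apply: le_trans (ler_normD _ _) _.
  apply: le_trans (lerD (M _ _ _ _ c1 a2) (M _ _ _ _ a1' c2)) _.
  have : 0 <= C1 * C2 * `|w - v| by rewrite mulr_ge0.
  by lra.
- rewrite (_ : _ - _ - _ = (k1 w x - k1 v x - dk1 v x (w - v)) * k2 v x +
    k1 v x * (k2 w x - k2 v x - dk2 v x (w - v)) +
    (k1 w x - k1 v x) * (k2 w x - k2 v x)); last by ring.
  apply: le_trans (ler_normD _ _) _.
  apply: le_trans (lerD (le_trans (ler_normD _ _)
    (lerD (M _ _ _ _ d1 a2) (M _ _ _ _ a1 d2))) (M _ _ _ _ c1 c2)) _.
  by rewrite le_eqVlt; apply/orP; left; apply/eqP; ring.
Qed.

Lemma unif_diffX k dk m : unif_diff k dk ->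
  unif_diff (fun v x => k v x ^+ m)
    (fun v x h => m%:R * k v x ^+ m.-1 * dk v x h).
Proof.
move=> ud; elim: m => [|m IH].
  apply: unif_diff_eq (@unif_diff_cst (fun=> 1) 1 _) _ _ => //.
    by move=> x _; rewrite normr1.
  by move=> v x h; rewrite !mul0r.
apply: unif_diff_eq (unif_diffM ud IH) _ _ => [v x|v x h].
  by rewrite exprS.
case: m {IH} => [|m] /=; first by rewrite !expr0; ring.
by rewrite -(natr1 m.+1) !exprS; ring.
Qed.

Lemma unif_diffZ k dk c : unif_diff k dk ->
  unif_diff (fun v x => c * k v x) (fun v x h => c * dk v x h).
Proof.
move=> ud; apply: unif_diff_eq (unif_diffM (@unif_diff_cst (fun=> c) `|c| _) ud) _ _ => //.
by move=> v x h; rewrite mul0r add0r.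
Qed.

Lemma unif_diffB k1 dk1 k2 dk2 : unif_diff k1 dk1 -> unif_diff k2 dk2 ->
  unif_diff (fun v x => k1 v x - k2 v x) (fun v x h => dk1 v x h - dk2 v x h).
Proof.
move=> ud1 ud2; apply: unif_diff_eq (unif_diffD ud1 (unif_diffZ (-1) ud2)) _ _.
  by move=> v x; rewrite mulN1r.
by move=> v x h; rewrite mulN1r.
Qed.

(** With [a] and [b] the inverse roots at [v] and [w], the values of [k] are [a^-2] and [b^-2]. The
    increment and the remainder become rational in [a] and [b], and are bounded without a path from
    [v] to [w]. *)
Lemma unif_diff_invsqrt k dk (c : R) : 0 < c ->
  (forall v x, D v -> S x -> c <= k v x) -> unif_diff k dk ->
  unif_diff (fun v x => (Num.sqrt (k v x))^-1)
    (fun v x h => - (dk v x h / 2) * (Num.sqrt (k v x))^-1 ^+ 3).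
Proof.
move=> c0 ck [l [C C0 H]]; split.
  by move=> v x c' h h'; rewrite l; move: (_ ^+ 3) => s; field.
pose M := (Num.sqrt c)^-1.
have M0 : 0 <= M by rewrite invr_ge0 sqrtr_ge0.
have M30 : 0 <= M ^+ 3 * C by rewrite mulr_ge0 ?exprn_ge0.
have M50 : 0 <= M ^+ 5 * C ^+ 2 by rewrite mulr_ge0 ?exprn_ge0.
(* The three terms serve the value, the linear part and the squared increment of [k]. *)
exists (M + M ^+ 3 * C + M ^+ 5 * C ^+ 2) => [|v w x Dv Dw Sx].
  by rewrite !addr_ge0.
have [_ b1 c1 d1] := H v w x Dv Dw Sx.
have ka : 0 < k v x by apply: lt_le_trans (ck _ _ _ _).
have kb : 0 < k w x by apply: lt_le_trans (ck _ _ _ _).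
have aM : (Num.sqrt (k v x))^-1 <= M.
  by rewrite lef_pV2 ?posrE ?sqrtr_gt0 // ler_wsqrtr // ck.
have bM : (Num.sqrt (k w x))^-1 <= M.
  by rewrite lef_pV2 ?posrE ?sqrtr_gt0 // ler_wsqrtr // ck.
have a0 : 0 < (Num.sqrt (k v x))^-1 by rewrite invr_gt0 sqrtr_gt0.
have b0 : 0 < (Num.sqrt (k w x))^-1 by rewrite invr_gt0 sqrtr_gt0.
have kaE : k v x = (Num.sqrt (k v x))^-1 ^- 2.
  by rewrite exprVn invrK sqr_sqrtr // ltW.
have kbE : k w x = (Num.sqrt (k w x))^-1 ^- 2.
  by rewrite exprVn invrK sqr_sqrtr // ltW.
move: (Num.sqrt (k v x))^-1 (Num.sqrt (k w x))^-1 aM bM a0 b0 kaE kbE.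
move=> a b aM bM a0 b0 kaE kbE.
have ab0 : 0 < a + b by exact: addr_gt0.
have [aw bw] : 0 <= a /\ 0 <= b by rewrite !ltW.
have abn : a + b != 0 by rewrite gt_eqF.
have an : a != 0 by rewrite gt_eqF.
have bn : b != 0 by rewrite gt_eqF.
(* [b - a] and the second-order remainder as multiples of [k w x - k v x] *)
have e1 : b - a = - (a ^+ 2 * (b ^+ 2 / (a + b))) * (k w x - k v x).
  by rewrite kaE kbE; field; rewrite an bn abn.
have fb : b / (a + b) <= 1 by rewrite ler_pdivrMr // mul1r lerDr ltW.
have f0 : 0 <= b / (a + b) by rewrite divr_ge0 // ltW.
have f1 : a ^+ 2 * (b ^+ 2 / (a + b)) <= M ^+ 3.
  rewrite (_ : _ * _ = a * a * b * (b / (a + b))); last by rewrite !mulrA; ring.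
  rewrite (_ : M ^+ 3 = M * M * M * 1); last by ring.
  by rewrite ler_pM // ?mulr_ge0 // ler_pM // ?mulr_ge0 // ler_pM.
have f10 : 0 <= a ^+ 2 * (b ^+ 2 / (a + b)).
  by rewrite mulr_ge0 // ?divr_ge0 ?exprn_ge0 // ltW.
have e2 : b - a - - (dk v x (w - v) / 2) * a ^+ 3 =
    - (a ^+ 3 / 2) * (k w x - k v x - dk v x (w - v)) +
    a ^+ 4 * b * (b / (a + b)) * ((2 * b + a) / (2 * (a + b))) *
      (k w x - k v x) ^+ 2.
  by rewrite kaE kbE; field; rewrite an bn abn.
have a3 : a ^+ 3 <= M ^+ 3 by rewrite lerXn2r ?nnegrE // ltW.
have a30 : 0 <= a ^+ 3 by rewrite exprn_ge0 // ltW.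
have C2 := mulr_ge0 C0 (normr_ge0 (w - v)).
have C3 := mulr_ge0 C0 (exprn_ge0 2 (normr_ge0 (w - v))).
split.
- by rewrite ger0_norm // (le_trans aM) // -addrA lerDl addr_ge0.
- move=> h; rewrite normrM normrN (ger0_norm a30) normrM.
  rewrite (@ger0_norm _ (2^-1)) ?invr_ge0 //.
  apply: (@le_trans _ _ (M ^+ 3 * C * `|h|)); last first.
    by rewrite ler_wpM2r // addrAC lerDr addr_ge0.
  have h1 := b1 h; have h2 : 0 <= `|dk v x h| by [].
  rewrite mulrC -mulrA ler_pM ?mulr_ge0 //.
  apply: le_trans h1; lra.
- rewrite e1 normrM normrN (ger0_norm f10).
  apply: (@le_trans _ _ (M ^+ 3 * (C * `|w - v|))); first by rewrite ler_pM.
  by rewrite mulrA ler_wpM2r // addrAC lerDr addr_ge0.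
- rewrite e2; apply: le_trans (ler_normD _ _) _.
  apply: (@le_trans _ _ (M ^+ 3 * (C * `|w - v| ^+ 2) +
      M ^+ 5 * (C * `|w - v|) ^+ 2)); last first.
    rewrite exprMn (mulrA (M ^+ 3)) (mulrA (M ^+ 5)) -mulrDl.
    by rewrite ler_wpM2r ?exprn_ge0 // lerD2r lerDr.
  apply: lerD.
    rewrite normrM normrN (@ger0_norm _ (a ^+ 3 / 2)) ?divr_ge0 // ler_pM ?divr_ge0 //.
    by apply: le_trans a3; lra.
  rewrite normrM [X in _ * X]ger0_norm ?sqr_ge0 //.
  have g1 : (2 * b + a) / (2 * (a + b)) <= 1.
    by rewrite ler_pdivrMr ?mulr_gt0 // mul1r; lra.
  have g0 : 0 <= (2 * b + a) / (2 * (a + b)).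
    by rewrite divr_ge0 // ?mulr_ge0 ?ltW //; lra.
  rewrite ger0_norm; last by rewrite mulr_ge0 // mulr_ge0 // mulr_ge0 // exprn_ge0.
  apply: ler_pM.
  + by rewrite mulr_ge0 // mulr_ge0 // mulr_ge0 // exprn_ge0.
  + by rewrite sqr_ge0.
  + rewrite (_ : M ^+ 5 = M ^+ 4 * M * 1 * 1); last by ring.
    have a4 : a ^+ 4 <= M ^+ 4 by rewrite lerXn2r ?nnegrE // ltW.
    have a40 : 0 <= a ^+ 4 by rewrite exprn_ge0 // ltW.
    have h1 : a ^+ 4 * b <= M ^+ 4 * M by apply: ler_pM.
    have h10 : 0 <= a ^+ 4 * b by exact: mulr_ge0.
    have h2 : a ^+ 4 * b * (b / (a + b)) <= M ^+ 4 * M * 1 by apply: ler_pM.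
    by apply: ler_pM => //; exact: mulr_ge0.
  + by rewrite -real_normK ?num_real // lerXn2r ?nnegrE.
Qed.

End uniform_diff.

Section diff_under_mean.
Context {R : realType}.

Lemma quad_diff (V : normedModType R) (G phi : V -> R) (v : V) (C r : R) :
  0 < r -> 0 <= C ->
  (forall c h h', phi (c *: h + h') = c * phi h + phi h') ->
  (forall h, `|phi h| <= C * `|h|) ->
  (forall w, `|w - v| < r -> `|G w - G v - phi (w - v)| <= C * `|w - v| ^+ 2) ->
  differentiable G v /\ forall h, 'd G v h = phi h.
Proof.
move=> r0 C0 lphi bphi HG.
(* The linear structure of [phi] is packed on the spot so that uniqueness of the differential
   applies to it. *)
pose lin := GRing.isLinear.Build R V R *%R phi lphi.
pose L : {linear V -> R^o} := HB.pack phi lin.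
have cL : continuous L.
  apply/linear_bounded_continuous; exists C; split; first exact: num_real.
  move=> M CM; apply/nbhs_ballP; exists 1 => //= h; rewrite -ball_normE /=.
  rewrite sub0r normrN => h1; apply: le_trans (bphi h) _.
  have M0 : 0 <= M by apply: le_trans C0 (ltW CM).
  apply: (@le_trans _ _ (M * `|h|)); first by rewrite ler_wpM2r // ltW.
  by rewrite ler_piMr // ltW.
have HL : G \o shift v = cst (G v) + L +o_ (0 : V) id.
  apply/eqaddoP => _/posnumP[e]; apply/nbhs_ballP.
  exists (Num.min r (e%:num / (C + 1))) => /=.
    by rewrite lt_min r0 divr_gt0 // ltr_wpDl.
  move=> h; rewrite -ball_normE /= sub0r normrN lt_min => /andP[hr he].
  rewrite opprD addrA.
  have := HG (h + v); rewrite addrK => /(_ hr) => Hh.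
  apply: le_trans Hh _; rewrite expr2 mulrA ler_wpM2r //.
  apply: (@le_trans _ _ ((C + 1) * `|h|)); first by rewrite ler_wpM2r // lerDl.
  by rewrite mulrC -ler_pdivlMr ?ltr_wpDl // ltW.
have dE := diff_unique cL HL.
have dG : differentiable G v by apply/diff_locallyP; rewrite dE; split.
by split => // h; rewrite dE.
Qed.

(** [F] is tied to the mean on [D] only. This allows [F] to be a directional derivative, or a
    dilated harmonic function, whose integral formula is known just inside the ball. *)
Lemma mean_diff (V : normedModType R) n (L : ('rV[R]_n -> R) -> R) (D : set V)
    (k : V -> 'rV[R]_n -> R) dk (f : 'rV[R]_n -> R) (M : R) (F : V -> R) v :
  mean_functional L -> unif_diff D (@sph R n) k dk ->
  (forall w, D w -> csph (k w)) -> (forall w h, D w -> csph (fun z => dk w z h)) ->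
  csph f -> (forall z, sph z -> `|f z| <= M) -> nbhs v D ->
  (forall w, D w -> F w = L (fun z => k w z * f z)) ->
  differentiable F v /\ forall h, 'D_h F v = L (fun z => dk v z h * f z).
Proof.
move=> mL [lk [C C0 H]] ck cdk cf fM Dv FE.
have Dv' : D v by exact: nbhs_singleton.
have [LD LZ Lle _] := mL.
have M0 : 0 <= `|M| by [].
have fM' z : sph z -> `|f z| <= `|M|.
  by move=> /fM h; apply: le_trans h _; exact: ler_norm.
pose phi h := L (fun z => dk v z h * f z).
have cdf h : csph (fun z => dk v z h * f z) by apply: csphM => //; exact: cdk.
move: Dv => /nbhs_ballP[r /= r0 rD].
have [dF dFE] : differentiable F v /\ forall h, 'd F v h = phi h.
  apply: (@quad_diff _ _ phi _ (C * `|M|) r) => //.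
  - exact: mulr_ge0.
  - move=> c h h'; rewrite /phi -LZ // -LD //; last first.
      by apply: csphM => //; exact: csph_cst.
    by congr L; apply/funext => z; rewrite lk; ring.
  - move=> h; rewrite -[leRHS](mean_cst _ mL); apply: mean_norm_le => //.
      exact: csph_cst.
    move=> z z1; rewrite normrM mulrAC ler_pM // ?fM' //.
    by have [_ b _ _] := H v v z Dv' Dv' z1.
  - move=> w wv; have Dw : D w by apply: rD; rewrite -ball_normE /= distrC.
    have cw : csph (fun z => k w z * f z) by apply: csphM => //; exact: ck.
    have cv : csph (fun z => k v z * f z) by apply: csphM => //; exact: ck.
    rewrite !FE // /phi -mean_B // -mean_B //; last exact: csphB.
    rewrite -[leRHS](mean_cst _ mL); apply: mean_norm_le => //.
    + by apply: csphB => //; exact: csphB.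
    + exact: csph_cst.
    + move=> z z1; rewrite -!mulrBl normrM mulrAC ler_pM // ?fM' //.
      by have [_ _ _] := H v w z Dv' Dw z1.
by split => // h; rewrite deriveE // dFE.
Qed.

Lemma mean_unif_continuous (V : normedModType R) n (L : ('rV[R]_n -> R) -> R)
    (D : set V) (k : V -> 'rV[R]_n -> R) dk (f : 'rV[R]_n -> R) (M : R)
    (F : V -> R) v :
  mean_functional L -> unif_diff D (@sph R n) k dk ->
  (forall w, D w -> csph (k w)) -> csph f ->
  (forall z, sph z -> `|f z| <= M) -> nbhs v D ->
  (forall w, D w -> F w = L (fun z => k w z * f z)) -> {for v, continuous F}.
Proof.
move=> mL [_ [C C0 H]] ck cf fM Dv FE; have Dv' : D v by exact: nbhs_singleton.
have CM0 : 0 <= C * `|M| by exact: mulr_ge0.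
have cF w : D w -> csph (fun z => k w z * f z) by move=> /ck cw; exact: csphM.
have lip w : D w -> `|F v - F w| <= C * `|M| * `|v - w|.
  move=> Dw; rewrite !FE //; apply: (mean_dist_le mL); [exact: cF|exact: cF|].
  move=> z z1; rewrite -mulrBl normrM mulrAC ler_pM //.
    by have [_ _ ] := H w v z Dw Dv' z1.
  by apply: le_trans (fM z z1) _; exact: ler_norm.
apply/(@cvgrPdist_lt _ _ _ (nbhs v)) => e e0.
near=> w; apply: le_lt_trans (lip w _) _; first by near: w.
have : `|v - w| < e / (C * `|M| + 1).
  near: w; apply: (@cvgr_dist_lt _ _ _ (nbhs v) _ id) => //.
  by rewrite divr_gt0 // ltr_wpDl.
rewrite ltr_pdivlMr ?ltr_wpDl // => h; apply: le_lt_trans h.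
by rewrite mulrC ler_wpM2l // lerDl.
Unshelve. all: by end_near. Qed.

Lemma mean_is_derive (V : normedModType R) n (L : ('rV[R]_n -> R) -> R) (D : set V)
    (k : V -> 'rV[R]_n -> R) dk (f : 'rV[R]_n -> R) (M : R) v h :
  mean_functional L -> unif_diff D (@sph R n) k dk ->
  (forall w, D w -> csph (k w)) -> (forall w h, D w -> csph (fun z => dk w z h)) ->
  csph f -> (forall z, sph z -> `|f z| <= M) -> nbhs v D ->
  is_derive v h (fun w => L (fun z => k w z * f z)) (L (fun z => dk v z h * f z)).
Proof.
move=> mL ud ck cdk cf fM Dv; have [dF FE] := mean_diff mL ud ck cdk cf fM Dv (fun _ _ => erefl).
by apply: DeriveDef; [exact: diff_derivable|exact: FE].
Qed.

Lemma mean_is_derive1 n (L : ('rV[R]_n -> R) -> R) (D : set R)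
    (k d : R -> 'rV[R]_n -> R) (t : R) :
  mean_functional L -> unif_diff D (@sph R n) k (fun s z e => d s z * e) ->
  (forall s, D s -> csph (k s)) -> (forall s, D s -> csph (d s)) -> nbhs t D ->
  is_derive t 1 (fun s => L (k s)) (L (d t)).
Proof.
move=> mL ud ck cd Dt.
have -> : (fun s => L (k s)) = (fun s => L (fun z => k s z * 1)).
  by apply/funext => s; congr L; apply/funext => z; rewrite mulr1.
have cd1 s (e : R) : D s -> csph (fun z => d s z * e).
  by move=> Ds; apply: csphM; [exact: cd|exact: csph_cst].
have n1 (z : 'rV[R]_n) : sph z -> `|1 : R| <= 1 by move=> _; rewrite normr1.
apply: der_eq (@mean_is_derive R^o n L D k (fun s z e => d s z * e) (fun=> 1) 1
  t 1 mL ud ck cd1 (@csph_cst R n 1) n1 Dt) _.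
by congr L; apply/funext => z; rewrite !mulr1.
Qed.

End diff_under_mean.

(** * The Poisson kernel *)

Section zonal.
Context {R : realType}.

(** An order-free mean value theorem; the bound on [d - v] lets it be iterated between [v] and
    [d]. *)
Lemma MVT_sym (f g : R -> R) : (forall x : R, is_derive x 1 f (g x)) ->
  forall v w, exists2 d, f w - f v = g d * (w - v) & `|d - v| <= `|w - v|.
Proof.
move=> df v w.
have H a b : a <= b -> exists2 c, c \in `[a, b]%R & f b - f a = g c * (b - a).
  move=> ab; apply: MVT_segment => //.
  by apply: continuous_subspaceT => x; exact: is_derive_cont (df x).
have [vw|/ltW wv] := leP v w.
  have [d] := H _ _ vw; rewrite in_itv /= => /andP[vd dw] E; exists d => //.
  by rewrite !ger0_norm ?subr_ge0 // lerD2r.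
have [d] := H _ _ wv; rewrite in_itv /= => /andP[wd dv] E; exists d.
  by rewrite -opprB E -mulrN opprB.
by rewrite !ler0_norm ?subr_le0 // lerN2 lerD2r.
Qed.

(** Two mean value theorems: the remainder is [(g d - g v) * (w - v)] for some [d] between [v] and
    [w], and [g d - g v] is again an increment. *)
Lemma unif_diff_trig X (S : set X) (f g g' : R -> R) :
  (forall x : R, is_derive x 1 f (g x)) -> (forall x : R, is_derive x 1 g (g' x)) ->
  (forall x, `|f x| <= 1) -> (forall x, `|g x| <= 1) -> (forall x, `|g' x| <= 1) ->
  unif_diff setT S (fun t _ => f t) (fun t _ h => g t * h).
Proof.
move=> df dg f1 g1 g'1; split; first by move=> *; rewrite /GRing.scale /=; ring.
exists 1 => // v w x _ _ _; have [d E dv] := MVT_sym df v w; split => //.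
- by move=> h; rewrite normrM ler_wpM2r.
- by rewrite E normrM ler_wpM2r.
rewrite mul1r E -mulrBl normrM expr2 ler_wpM2r //.
have [d' E' _] := MVT_sym dg v d.
by rewrite E' normrM -[leRHS]mul1r ler_pM.
Qed.

Lemma unif_diff_cos X (S : set X) :
  unif_diff setT S (fun (t : R) _ => cos t) (fun t _ h => - sin t * h).
Proof.
apply: (@unif_diff_trig X S _ (fun t => - sin t) (fun t => - cos t)) => x.
- by rewrite ler_norml cos_geN1 cos_le1.
- by rewrite normrN ler_norml sin_geN1 sin_le1.
- by rewrite normrN ler_norml cos_geN1 cos_le1.
Qed.

Lemma unif_diff_sin X (S : set X) :
  unif_diff setT S (fun (t : R) _ => sin t) (fun t _ h => cos t * h).
Proof.
apply: (@unif_diff_trig X S _ (fun t => cos t) (fun t => - sin t)) => x.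
- by rewrite ler_norml sin_geN1 sin_le1.
- by rewrite ler_norml cos_geN1 cos_le1.
- by rewrite normrN ler_norml sin_geN1 sin_le1.
Qed.

(** Merges the powers in the derivative of [h ^+ m] for an inverse square root [h], whose derivative
    carries [h ^+ 3]. At [m = 0] the truncated predecessor is harmless because of the factor
    [m%:R]. *)
Lemma mulX_pred m (h : R) : m%:R * h ^+ m.-1 * h ^+ 3 = m%:R * h ^+ m.+2.
Proof. by case: m => [|m]; rewrite ?mul0r //= !exprS; ring. Qed.

Lemma dot_polar n (y : 'rV[R]_n.+1) t xi : dotR y (polar t xi) =
  y 0 ord0 * cos t + sin t * dotR (\row_j y 0 (lift ord0 j)) xi.
Proof.
by rewrite [in LHS](consrv_eta y) dotR_consrv dotRE.
Qed.

Lemma dot_split n (y : 'rV[R]_n.+1) : dotR y y = y 0 ord0 ^+ 2 +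
  dotR (\row_j y 0 (lift ord0 j)) (\row_j y 0 (lift ord0 j)).
Proof. by rewrite {1 2}(consrv_eta y) dotR_consrv. Qed.

Lemma csph_invsqrt n (f : 'rV[R]_n -> R) : csph f ->
  (forall z, sph z -> 0 < f z) -> csph (fun z => (Num.sqrt (f z))^-1).
Proof.
move=> cf f0; apply: csphV; first exact: csph_sqrt.
by move=> z z1; rewrite gt_eqF // sqrtr_gt0 f0.
Qed.

(** On the sphere this is the inverse distance to [y] when [A = 1 + |y|^2]. The free [A] keeps the
    form stable under slicing: at polar angle [t], [A] becomes [A - 2 y_0 cos t] and [y] becomes
    [sin t] times its remaining coordinates. *)
Definition isq A n (y z : 'rV[R]_n) := (Num.sqrt (A - 2 * dotR y z))^-1.

Lemma csph_isq A n (y : 'rV[R]_n) :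
  (forall z, sph z -> 0 < A - 2 * dotR y z) -> csph (isq A y).
Proof.
move=> h; apply: csph_invsqrt => //; apply: csphB; first exact: csph_cst.
by apply: csphM; [exact: csph_cst|exact: csph_dot].
Qed.

Lemma dot_sph_le n (y z : 'rV[R]_n) : sph z -> `|dotR y z| <= Num.sqrt (dotR y y).
Proof.
move=> z1; rewrite -sqrtr_sqr ler_wsqrtr //.
by apply: le_trans (dotR_CS y z) _; rewrite z1 mulr1.
Qed.

Lemma avg_dot0 n (v : 'rV[R]_n.+1) : n = 0%N -> avg (dotR v) = 0.
Proof. by case: n v => // v _; rewrite /= /dotR !big_ord1 !mxE; ring. Qed.

(* Divergence theorem on the sphere for the vector field
   [isq A y ^+ m *: grad tau], where [tau z = dotR y z]. *)
Lemma avg_zonal n (y : 'rV[R]_n.+1) (A c : R) m : 0 < c ->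
  (forall z, sph z -> c <= A - 2 * dotR y z) ->
  avg (fun z => m%:R * (dotR y y - dotR y z ^+ 2) * isq A y z ^+ m.+2
     - n%:R * dotR y z * isq A y z ^+ m) = 0.
Proof.
elim: n y A c => [|n IH] y A c c0 cA.
  have [s1 sN1] := const_sph1 (R := R).
  rewrite /= /dotR !big_ord1 !mxE; ring.
set y' : 'rV[R]_n.+1 := \row_j y 0 (lift ord0 j).
pose tau t xi : R := dotR y (polar t xi).
pose dtau t xi : R := - sin t * y 0 ord0 + cos t * dotR y' xi.
pose h t xi : R := isq A y (polar t xi).
have tauE t xi : tau t xi = y 0 ord0 * cos t + sin t * dotR y' xi.
  exact: dot_polar.
have A0 t (xi : 'rV_n.+1) : sph xi -> c <= A - 2 * tau t xi.
  by move=> x1; apply: cA; exact: polar_sph.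
have A00 z : sph z -> 0 < A - 2 * dotR y z.
  by move=> z1; apply: lt_le_trans (cA z z1).
have mL := avg_mean n (R := R).
have udot : unif_diff (setT : set R) (@sph R n.+1) (fun _ xi => dotR y' xi)
    (fun _ _ _ => 0).
  by apply: unif_diff_cst => xi; exact: dot_sph_le.
have utau : unif_diff setT (@sph R n.+1) tau (fun t xi h => dtau t xi * h).
  apply: unif_diff_eq (unif_diffD (unif_diffZ (y 0 ord0) (unif_diff_cos _))
    (unif_diffM (unif_diff_sin _) udot)) _ _ => [t xi|t xi e].
    by rewrite tauE.
  by rewrite /dtau; ring.
have udtau : unif_diff setT (@sph R n.+1) dtau (fun t xi h => - tau t xi * h).
  apply: unif_diff_eq (unif_diffD (unif_diffZ (- y 0 ord0) (unif_diff_sin _))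
    (unif_diffM (unif_diff_cos _) udot)) _ _ => [t xi|t xi e].
    by rewrite /dtau; ring.
  by rewrite tauE; ring.
have uA : unif_diff setT (@sph R n.+1) (fun t xi => A - 2 * tau t xi)
    (fun t xi h => - 2 * dtau t xi * h).
  have uc : unif_diff (setT : set R) (@sph R n.+1) (fun _ _ => A) (fun _ _ _ => 0).
    exact: (@unif_diff_cst _ _ _ _ _ (fun=> A) `|A|).
  apply: unif_diff_eq (unif_diffB uc (unif_diffZ 2 utau)) _ _ => // t xi e.
  by rewrite sub0r !mulrA !mulNr.
have uh : unif_diff setT (@sph R n.+1) h (fun t xi e => dtau t xi * h t xi ^+ 3 * e).
  apply: unif_diff_eq (unif_diff_invsqrt c0 _ uA) _ _ => [t xi _|t xi|t xi e].
  - exact: A0.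
  - by [].
  - by rewrite -/(isq A y (polar t xi)) -/(h t xi); field.
have uhm := unif_diffX m uh.
have uK := unif_diffM udtau uhm.
pose K t xi := dtau t xi * h t xi ^+ m.
pose dK t xi := - tau t xi * h t xi ^+ m + m%:R * dtau t xi ^+ 2 * h t xi ^+ m.+2.
have {}uK : unif_diff setT (@sph R n.+1) K (fun t xi e => dK t xi * e).
  apply: unif_diff_eq uK _ _ => // t xi e.
  have E := mulX_pred m (h t xi).
  transitivity ((- tau t xi * h t xi ^+ m +
      dtau t xi ^+ 2 * (m%:R * h t xi ^+ m.-1 * h t xi ^+ 3)) * e); first by ring.
  by rewrite E /dK; ring.
have hE t xi : sph xi -> h t xi = isq (A - 2 * (y 0 ord0 * cos t)) (sin t *: y') xi.
  by move=> x1; rewrite /h /isq -/(tau t xi) tauE dotRE; congr (Num.sqrt _)^-1; ring.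
have cdot : csph (dotR y' : 'rV[R]_n.+1 -> R) by exact: csph_dot.
have ctau t : csph (tau t).
  by apply: csph_polar; exact: csph_dot.
have cdtau t : csph (dtau t).
  apply: csphD; first exact: csph_cst.
  by apply: csphM => //; exact: csph_cst.
have ch t k : csph (fun xi => h t xi ^+ k).
  by apply: csphX; apply: csph_polar; exact: csph_isq.
have cK t : csph (K t) by exact: csphM.
have cdK t : csph (dK t).
  apply: csphD; first by apply: csphM => //; exact: csphN.
  by apply: csphM => //; apply: csphM; [exact: csph_cst|exact: csphX].
have dg (t : R) : is_derive t 1 (fun s => avg (K s)) (avg (dK t)).
  by apply: mean_is_derive1 mL uK _ _ _ => //; exact: filterT.
(* Flux of the field through the latitude at polar angle [t]. The polar part of the divergence is
   [F']; the part tangent to the latitude has mean zero by induction. *)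
pose F t := sin t ^+ n * avg (K t).
have dF (t : R) : is_derive t 1 F (n%:R * sin t ^+ n.-1 * cos t * avg (K t)
    + sin t ^+ n * avg (dK t)).
  by apply: derM => //; exact: derX (der_sin t).
pose J z := m%:R * (dotR y y - dotR y z ^+ 2) * isq A y z ^+ m.+2
     - n.+1%:R * dotR y z * isq A y z ^+ m.
have cJ : csph J.
  have ci k : csph (fun z => isq A y z ^+ k) by apply: csphX; exact: csph_isq.
  apply: csphB; apply: csphM => //; apply: csphM; try exact: csph_cst.
    by apply: csphB; [exact: csph_cst|apply: csphX; exact: csph_dot].
  exact: csph_dot.
pose T t := sin t ^+ n * avg (fun xi => J (polar t xi)).
have cT : continuous T by exact: avg_polar_continuous.
rewrite -/J /= -/T.
have -> : intg 0 pi T = F pi - F 0.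
  apply: intg_FTC; first exact: pi_gt0.
  - by move=> t _; exact: cT.
  - by move=> t _; exact: is_derive_cont (dF t).
  move=> t t0pi; have s0 : 0 < sin t by exact: sin_gt0_pi.
  apply: der_eq (dF t) _.
  have [LD LZ _ _] := mL.
  have cJt : csph (fun xi : 'rV_n.+1 => J (polar t xi)) by exact: csph_polar.
  (* The integrand of the induction hypothesis on the latitude. Below, [W] is what remains of the
     divergence after removal of [F'], and [sin t ^+ 2 * W = sin t ^+ n * I] pointwise. *)
  pose I xi := m%:R * (dotR (sin t *: y') (sin t *: y') - dotR (sin t *: y') xi ^+ 2) *
      isq (A - 2 * (y 0 ord0 * cos t)) (sin t *: y') xi ^+ m.+2
     - n%:R * dotR (sin t *: y') xi * isq (A - 2 * (y 0 ord0 * cos t)) (sin t *: y') xi ^+ m.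
  have Ac xi : sph xi -> c <= A - 2 * (y 0 ord0 * cos t) - 2 * dotR (sin t *: y') xi.
    move=> x1; apply: le_trans (A0 t xi x1) _.
    by rewrite tauE dotRZl mulrDr opprD addrA.
  have IHt : avg I = 0 := IH _ _ _ c0 Ac.
  have cI : csph I.
    have ci k : csph (fun z => isq (A - 2 * (y 0 ord0 * cos t)) (sin t *: y') z ^+ k).
      by apply: csphX; apply: csph_isq => z /Ac; exact: lt_le_trans.
    apply: csphB; apply: csphM => //; apply: csphM; try exact: csph_cst.
      by apply: csphB; [exact: csph_cst|apply: csphX; exact: csph_dot].
    exact: csph_dot.
  pose W xi := sin t ^+ n * J (polar t xi) + (- sin t ^+ n * dK t xi +
     - (n%:R * sin t ^+ n.-1 * cos t) * K t xi).
  have cZ a (f : 'rV[R]_n.+1 -> R) : csph f -> csph (fun z => a * f z).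
    by move=> cf; apply: csphM => //; exact: csph_cst.
  have cW : csph W by apply: csphD; [exact: cZ|apply: csphD; exact: cZ].
  have WE : avg W = T t - (n%:R * sin t ^+ n.-1 * cos t * avg (K t) +
      sin t ^+ n * avg (dK t)).
    rewrite /W LD; [|exact: cZ|by apply: csphD; exact: cZ].
    rewrite LD; [|exact: cZ|exact: cZ].
    by rewrite !LZ // /T; ring.
  have : sin t ^+ 2 * avg W = sin t ^+ n * avg I.
    rewrite -!LZ //; apply: (mean_eq mL) => [||xi x1]; [exact: cZ|exact: cZ|].
    rewrite /W /I /J -(hE _ _ x1) -/(h t xi) -/(tau t xi) !dotRE /K /dK.
    have -> : dotR y y = y 0 ord0 ^+ 2 + dotR y' y' by exact: dot_split.
    rewrite -natr1 tauE /dtau.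
    have cs : cos t ^+ 2 + sin t ^+ 2 - 1 = 0 by rewrite cos2Dsin2 subrr.
    have P : n%:R * sin t ^+ n.-1 * sin t - n%:R * sin t ^+ n = 0.
      by case: (n) => [|k] /=; [rewrite !mul0r subrr|rewrite exprSr; ring].
    move: (h t xi ^+ m) (h t xi ^+ m.+2) cs P => H H2.
    move: (cos t) (sin t) (sin t ^+ n) (sin t ^+ n.-1) => a b S S' cs P.
    move: (dotR y' y') (dotR y' xi) (y 0 ord0) => Y x y0.
    apply/eqP; rewrite -subr_eq0; apply/eqP.
    (* Ideal membership with explicit cofactors: the difference is a combination of
       [cos^2 + sin^2 - 1] and of the relation [P] between [sin ^+ n.-1] and [sin ^+ n]. *)
    transitivity ((a ^+ 2 + b ^+ 2 - 1) *
        (- (b ^+ 2 * S * m%:R * H2 * (y0 ^+ 2 + x ^+ 2)) - S * n%:R * b * H * x) +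
      (n%:R * S' * b - n%:R * S) * - (b * a * (- b * y0 + a * x) * H)).
      by ring.
    by rewrite cs P !mul0r addr0.
  rewrite IHt mulr0 => /eqP; rewrite mulf_eq0 expf_eq0 /= (gt_eqF s0) /= WE.
  by rewrite subr_eq0 => /eqP ->.
suff -> : F pi - F 0 = 0 by rewrite mulr0.
(* For [n > 0] the flux vanishes at the poles through [sin t ^+ n]. For [n = 0] the latitude is a
   pair of antipodal points, and at the poles [K t] is linear in [xi], hence of mean zero. *)
have [n0|n0] := posnP n; last first.
  by rewrite /F sin0 sinpi !expr0n gtn_eqF //= !mul0r subrr.
suff K0 t : sin t = 0 -> avg (K t) = 0.
  by rewrite /F !K0 ?sin0 ?sinpi // !mulr0 subrr.
move=> st.
pose b := cos t * (Num.sqrt (A - 2 * (y 0 ord0 * cos t)))^-1 ^+ m.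
have -> : K t = fun xi => b * dotR y' xi.
  apply/funext => xi; rewrite /K /dtau /h /isq -/(tau t xi) tauE st /b.
  by rewrite mul0r addr0 oppr0 mul0r add0r; ring.
by have [_ LZ _ _] := mL; rewrite LZ // avg_dot0 ?mulr0.
Qed.

End zonal.

(** * Total mass of the Poisson kernel *)

Section poisson_mean.
Context {R : realType}.

Definition invdist n (y z : 'rV[R]_n) : R := (Num.sqrt (dotR (y - z) (y - z)))^-1.

Definition poisson n (y z : 'rV[R]_n) : R := (1 - dotR y y) * invdist y z ^+ n.

Lemma dist_sph n (y z : 'rV[R]_n) : sph z ->
  dotR (y - z) (y - z) = 1 + dotR y y - 2 * dotR y z.
Proof. by move=> z1; rewrite !dotRE z1 (dotRC z y); ring. Qed.

Lemma dist_gt0 n (y z : 'rV[R]_n) : unit_ballE y -> sph z ->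
  0 < dotR (y - z) (y - z).
Proof.
move=> y1 z1; apply: lt_le_trans (dotR_sphere (lexx _) y1 z1).
by rewrite divr_gt0 // exprn_gt0 // subr_gt0.
Qed.

Lemma invdist_gt0 n (y z : 'rV[R]_n) : unit_ballE y -> sph z -> 0 < invdist y z.
Proof. by move=> y1 z1; rewrite invr_gt0 sqrtr_gt0 dist_gt0. Qed.

Lemma invdist_sqr n (y z : 'rV[R]_n) : unit_ballE y -> sph z ->
  invdist y z ^+ 2 * dotR (y - z) (y - z) = 1.
Proof.
move=> y1 z1; rewrite /invdist exprVn sqr_sqrtr ?dotR_ge0 // mulVf //.
by rewrite gt_eqF // dist_gt0.
Qed.

Lemma csph_invdist n (y : 'rV[R]_n) : unit_ballE y -> csph (invdist y).
Proof.
move=> y1; apply: csph_invsqrt => [z _|z z1]; last exact: dist_gt0.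
rewrite (_ : (fun z => _) = (fun z => dotR z z) \o (fun z => y - z)) //.
apply: continuous_comp; last exact: dotRR_continuous.
by apply: (@continuousB R _ _ (fun=> y) id) => //; exact: cst_continuous.
Qed.

Lemma isq_invdist n (y z : 'rV[R]_n) : sph z -> isq (1 + dotR y y) y z = invdist y z.
Proof. by move=> z1; rewrite /isq /invdist dist_sph. Qed.

Lemma eq0_derive_const (f : R -> R) (a b : R) : a < b -> cont_on a b f ->
  (forall x, a < x < b -> is_derive x 1 f 0) -> f b = f a.
Proof.
move=> ab cf df.
have d0 x : x \in `]a, b[%R -> is_derive x 1 f 0 by rewrite in_itv /=; exact: df.
have [c _] := MVT_segment (ltW ab) d0 (cont_on_within cf).
by rewrite mul0r => /eqP; rewrite subr_eq0 => /eqP.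
Qed.

(* With [m t] the mean of [invdist (t *: y) ^+ k] and [kk t = t * m' t], the zonal
   identity reads [t * kk' t + k%:R * kk t = 0]. *)
Lemma avg_newton k (y : 'rV[R]_k.+2) : (0 < k)%N -> unit_ballE y ->
  avg (fun z => invdist y z ^+ k) = 1 /\
  avg (fun z => (dotR y y - dotR y z) * invdist y z ^+ k.+2) = 0.
Proof.
move=> k0 y1; have mL := avg_mean k.+1 (R := R); have [LD LZ _ L1] := mL.
pose r := dotR y y; have r0 : 0 <= r by exact: dotR_ge0.
have r1 : r < 1 by [].
(* An open set containing [[0, 1]] on which [|t y|^2 <= 2 r / (1 + r) = s < 1]; derivatives in [t]
   are thus available at both end points. *)
pose D : set R := [set t | t ^+ 2 * (1 + r) < 2].
pose s := 2 * r / (1 + r).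
have s1 : s < 1 by rewrite ltr_pdivrMr; lra.
have Ds t : D t -> dotR (t *: y) (t *: y) <= s.
  rewrite /D /= => tD; rewrite !dotRE -/r mulrA -expr2 ler_pdivlMr; last by lra.
  rewrite mulrAC mulrC (mulrC 2) ler_wpM2l //; exact: ltW.
have Db t : D t -> unit_ballE (t *: y) by move=> /Ds /le_lt_trans; exact.
have oD : open D.
  rewrite (_ : D = (fun t => t ^+ 2 * (1 + r)) @^-1` [set x | x < 2]) //.
  apply: open_comp; last exact: open_lt.
  by move=> t _; exact: (cvgM (@exprn_continuous _ 2 t) (cvg_cst _)).
have D01 (t : R) : 0 <= t <= 1 -> D t.
  move=> /andP[t0 t1]; rewrite /D /=.
  have : t ^+ 2 <= 1 by rewrite expr_le1.
  have : 0 <= t ^+ 2 by rewrite exprn_ge0.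
  by nra.
have nD (t : R) : 0 <= t <= 1 -> nbhs t D.
  by move=> /D01 Dt; exact: open_nbhs_nbhs.
pose p (t : R) z : R := invdist (t *: y) z.
pose tau z : R := dotR y z.
have q_ge (t : R) (z : 'rV[R]_k.+2) : D t -> sph z ->
    (1 - s) ^+ 2 / 4 <= 1 + t ^+ 2 * r - 2 * t * tau z.
  move=> Dt z1; apply: le_trans (dotR_sphere (Ds t Dt) s1 z1) _.
  by rewrite dist_sph // !dotRE; rewrite -/r -/(tau z) !mulrA.
have uid : unif_diff D (@sph R k.+2) (fun t _ => t) (fun _ _ h => h).
  apply: (@unif_diff_lin R R^o _ D _ id 2 1) => //= [t Dt|h]; last by rewrite mul1r.
  rewrite -(@ler_pXn2r _ 2) ?nnegrE // real_normK ?num_real //.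
  by move: Dt; rewrite /D /=; have := sqr_ge0 t; nra.
have uc (c : R) : unif_diff D (@sph R k.+2) (fun _ _ => c) (fun _ _ _ => 0).
  exact: (@unif_diff_cst _ R^o _ _ _ (fun=> c) `|c|).
have utau : unif_diff D (@sph R k.+2) (fun _ => tau) (fun _ _ _ => 0).
  by apply: (@unif_diff_cst _ R^o) => z; exact: dot_sph_le.
have uq : unif_diff D (@sph R k.+2) (fun t z => 1 + t ^+ 2 * r - 2 * t * tau z)
    (fun t z h => 2 * (t * r - tau z) * h).
  apply: unif_diff_eq (unif_diffB (unif_diffD (uc 1) (unif_diffM (unif_diffX 2 uid)
    (uc r))) (unif_diffM (unif_diffM (uc 2) uid) utau)) _ _ => // t z h /=.
  by rewrite expr1; ring.
have c0 : 0 < (1 - s) ^+ 2 / 4 by rewrite divr_gt0 // exprn_gt0 // subr_gt0.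
(* Equals [p t z] on the sphere, but has an explicit quadratic in [t] under the root for every [z],
   the form to which the rules of [unif_diff] apply. *)
pose p' (t : R) z : R := (Num.sqrt (1 + t ^+ 2 * r - 2 * t * tau z))^-1.
have pE t z : sph z -> p' t z = p t z.
  by move=> z1; rewrite /p' /p /invdist dist_sph // !dotRE !mulrA -expr2.
have up : unif_diff D (@sph R k.+2) p' (fun t z h => - (t * r - tau z) * p' t z ^+ 3 * h).
  apply: unif_diff_eq (unif_diff_invsqrt c0 q_ge uq) _ _ => // t z h.
  by rewrite -/(p' t z); field.
have uN := unif_diffX k up.
have cp t j : D t -> csph (fun z => p' t z ^+ j).
  move=> Dt; apply: csphX; apply: csph_invsqrt => [|z z1].
    apply: csphB; first exact: csph_cst.
    by apply: csphM; [exact: csph_cst|exact: csph_dot].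
  exact: lt_le_trans (q_ge t z Dt z1).
have ctau : csph tau by exact: csph_dot.
have crt (t : R) : csph (fun z => t * r - tau z).
  by apply: csphB => //; exact: csph_cst.
pose m t := avg (fun z => p' t z ^+ k).
pose dN t z := - (k%:R * (t * r - tau z) * p' t z ^+ k.+2).
have cdN t : D t -> csph (dN t).
  move=> Dt; apply: csphN; apply: csphM; last exact: cp.
  by apply: csphM; [exact: csph_cst|exact: crt].
have {}uN : unif_diff D (@sph R k.+2) (fun t z => p' t z ^+ k) (fun t z h => dN t z * h).
  apply: unif_diff_eq uN _ _ => // t z h; rewrite /dN.
  have := mulX_pred k (p' t z) => E.
  transitivity (- ((k%:R * p' t z ^+ k.-1 * p' t z ^+ 3) * (t * r - tau z)) * h).
    by ring.
  by rewrite E; ring.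
have dm (t : R) : 0 <= t <= 1 -> is_derive t 1 m (avg (dN t)).
  by move=> t01; apply: mean_is_derive1 mL uN _ _ (nD t t01) => // u Du; exact: cp.
have udN : unif_diff D (@sph R k.+2) (fun t z => t * dN t z)
  (fun t z h => - k%:R * ((2 * t * r - tau z) * p' t z ^+ k.+2
     - k.+2%:R * (t ^+ 2 * r - t * tau z) * (t * r - tau z) * p' t z ^+ k.+4) * h).
  apply: unif_diff_eq (unif_diffM uid (unif_diffM (unif_diffM (uc (- k%:R))
    (unif_diffB (unif_diffM uid (uc r)) utau)) (unif_diffX k.+2 up))) _ _ => [t z|t z h].
    by rewrite /dN; ring.
  by rewrite /= !exprS; ring.
pose kk t := avg (fun z => t * dN t z).
pose dk t := avg (fun z => - k%:R * ((2 * t * r - tau z) * p' t z ^+ k.+2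
     - k.+2%:R * (t ^+ 2 * r - t * tau z) * (t * r - tau z) * p' t z ^+ k.+4)).
have cdk t : D t -> csph (fun z => - k%:R * ((2 * t * r - tau z) * p' t z ^+ k.+2
     - k.+2%:R * (t ^+ 2 * r - t * tau z) * (t * r - tau z) * p' t z ^+ k.+4)).
  move=> Dt.
  apply: csphM; first exact: csph_cst.
  apply: csphB; apply: csphM; try exact: cp.
    by apply: csphB => //; exact: csph_cst.
  apply: csphM; last exact: crt.
  apply: csphM; first exact: csph_cst.
  by apply: csphB; [exact: csph_cst|apply: csphM => //; exact: csph_cst].
have dkk (t : R) : 0 <= t <= 1 -> is_derive t 1 kk (dk t).
  move=> t01; apply: mean_is_derive1 mL udN _ _ (nD t t01) => u Du.
    by apply: csphM; [exact: csph_cst|exact: cdN].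
  exact: cdk.
have zero (t : R) : 0 <= t <= 1 -> k%:R * kk t + t * dk t = 0.
  move=> t01; have Dt := D01 t t01.
  have cpp j : csph (fun z => p t z ^+ j).
    by apply: csphX; apply: csph_invdist; exact: Db.
  have cC : csph (fun z : 'rV[R]_k.+2 => k.+2%:R * (dotR (t *: y) (t *: y) - dotR (t *: y) z ^+ 2) *
      p t z ^+ k.+4 - k.+1%:R * dotR (t *: y) z * p t z ^+ k.+2).
    apply: csphB; apply: csphM => //; apply: csphM; try exact: csph_cst.
      by apply: csphB; [exact: csph_cst|apply: csphX; exact: csph_dot].
    exact: csph_dot.
  have z0 : avg (fun z => k.+2%:R * (dotR (t *: y) (t *: y) - dotR (t *: y) z ^+ 2) *
      p t z ^+ k.+4 - k.+1%:R * dotR (t *: y) z * p t z ^+ k.+2) = 0.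
    rewrite -(@avg_zonal R k.+1 (t *: y) (1 + dotR (t *: y) (t *: y)) _ k.+2 c0); last first.
      move=> z z1; apply: le_trans (q_ge t z Dt z1) _.
      by rewrite !dotRE -/r -/(tau z) !mulrA -expr2.
    apply: (mean_eq mL) => [||z z1]; first exact: cC.
    - apply: csphB; apply: csphM; try (by apply: csphX; apply: csph_isq => z z1;
        rewrite -dist_sph //; apply: dist_gt0 => //; exact: Db);
        apply: csphM; try exact: csph_cst.
        by apply: csphB; [exact: csph_cst|apply: csphX; exact: csph_dot].
      exact: csph_dot.
    - by rewrite isq_invdist.
  rewrite -[RHS](mulr0 (- k%:R)) -z0 /kk /dk.
  have cB : csph (fun z => t * dN t z).
    by apply: csphM; [exact: csph_cst|exact: cdN].
  have cZ a (f : 'rV[R]_k.+2 -> R) : csph f -> csph (fun z => a * f z).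
    by move=> cf; apply: csphM => //; exact: csph_cst.
  have cA := cdk t Dt; rewrite -!LZ // -LD; [|exact: cZ|exact: cZ].
  apply: (mean_eq mL) => [||z z1]; [by apply: csphD; exact: cZ|exact: cZ|].
  have E : p t z ^+ k.+2 = p t z ^+ k.+4 * (1 + t ^+ 2 * r - 2 * t * tau z).
    have e : p t z ^+ 2 * (1 + t ^+ 2 * r - 2 * t * tau z) = 1.
      rewrite -[RHS](invdist_sqr (Db t Dt) z1) -/(p t z) dist_sph // !dotRE.
      rewrite -/r -/(tau z); ring.
    transitivity (p t z ^+ k.+2 * (p t z ^+ 2 * (1 + t ^+ 2 * r - 2 * t * tau z))).
      by rewrite e mulr1.
    by rewrite !exprS; ring.
  rewrite (pE t z z1) /dN (pE t z z1) E !dotRE -/r -/(tau z) -!natr1.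
  by ring.
(* Integrating factor: [G' = t^(k-1) (k kk + t kk') = 0], and [G 0 = 0] because [k > 0]. So [kk]
   vanishes on []0, 1]] and [m] is constant. *)
pose G t := t ^+ k * kk t.
have dG (t : R) : 0 <= t <= 1 -> is_derive t 1 G 0.
  move=> t01; apply: der_eq (derM (derX _ (der_id t)) (dkk t t01)) _.
  rewrite -[in t ^+ k](prednK k0) exprSr /=.
  transitivity (t ^+ k.-1 * (k%:R * kk t + t * dk t)); first by ring.
  by rewrite zero // mulr0.
have G0 (t : R) : 0 < t <= 1 -> kk t = 0.
  move=> /andP[t0 t1].
  have : G t = G 0.
    apply: eq0_derive_const => // x /andP[x0 xt].
      by apply: is_derive_cont (dG x _); rewrite x0 (le_trans xt).
    by apply: dG; rewrite (ltW x0) (le_trans (ltW xt)).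
  rewrite /G expr0n gtn_eqF // mul0r => /eqP; rewrite mulf_eq0 expf_eq0.
  by rewrite (gt_eqF t0) andbF => /eqP.
have m10 : m 1 = m 0.
  apply: eq0_derive_const => // x /andP[x0 x1].
    by apply: is_derive_cont (dm x _); rewrite x0.
  apply: der_eq (dm x _) _; first by rewrite !ltW.
  have := G0 x; rewrite x0 (ltW x1) => /(_ isT).
  rewrite /kk LZ; last by apply: cdN; apply: D01; rewrite !ltW.
  by move=> /eqP; rewrite mulf_eq0 gt_eqF //= => /eqP.
have D1 : D 1 by apply: D01; rewrite ler01 lexx.
have pE1 z : sph z -> p' 1 z = invdist y z.
  by move=> z1; rewrite pE // /p scale1r.
split.
  transitivity (m 1).
    apply: (mean_eq mL) => [||z z1]; [by apply: csphX; exact: csph_invdist|exact: cp|].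
    by rewrite pE1.
  rewrite m10 -L1; congr avg; apply/funext => z.
  by rewrite /p' expr0n /= mul0r addr0 mulr0 mul0r subr0 sqrtr1 invr1 expr1n.
have := G0 1; rewrite ltr01 lexx => /(_ isT).
have cF : csph (fun z => (r - tau z) * invdist y z ^+ k.+2).
  apply: csphM; last by apply: csphX; exact: csph_invdist.
  by apply: csphB => //; exact: csph_cst.
have -> : kk 1 = - k%:R * avg (fun z => (r - tau z) * invdist y z ^+ k.+2).
  rewrite -LZ //; apply: (mean_eq mL) => [||z z1].
  - by apply: csphM; [exact: csph_cst|exact: cdN].
  - by apply: csphM => //; exact: csph_cst.
  - by rewrite /dN pE1 // !mul1r; ring.
move=> /eqP; rewrite mulf_eq0 oppr_eq0 pnatr_eq0 (gtn_eqF k0) /=.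
by move=> /eqP.
Qed.

(** Since [1 - |y|^2 = |y - z|^2 - 2 (|y|^2 - <y, z>)], the kernel is the Newtonian kernel minus
    twice the radial term, whose means are 1 and 0. *)
Lemma avg_poisson k (y : 'rV[R]_k.+2) : (0 < k)%N -> unit_ballE y ->
  avg (poisson y) = 1.
Proof.
move=> k0 y1; have [N1 Z1] := avg_newton k0 y1.
have mL := avg_mean k.+1 (R := R); have [LD LZ _ L1] := mL.
have cp j : csph (fun z => invdist y z ^+ j) by apply: csphX; exact: csph_invdist.
have cZ : csph (fun z => (dotR y y - dotR y z) * invdist y z ^+ k.+2).
  by apply: csphM => //; apply: csphB; [exact: csph_cst|exact: csph_dot].
have c2Z : csph (fun z => -2 * ((dotR y y - dotR y z) * invdist y z ^+ k.+2)).
  by apply: csphM => //; exact: csph_cst.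
transitivity (avg (fun z => invdist y z ^+ k +
    -2 * ((dotR y y - dotR y z) * invdist y z ^+ k.+2))); last first.
  by rewrite LD // LZ // N1 Z1 mulr0 addr0.
apply: (mean_eq mL) => [||z z1].
- by apply: csphM => //; exact: csph_cst.
- exact: csphD.
have E : invdist y z ^+ k = invdist y z ^+ k.+2 * (1 + dotR y y - 2 * dotR y z).
  have e : invdist y z ^+ 2 * (1 + dotR y y - 2 * dotR y z) = 1.
    by rewrite -dist_sph // invdist_sqr.
  transitivity (invdist y z ^+ k * (invdist y z ^+ 2 * (1 + dotR y y - 2 * dotR y z))).
    by rewrite e mulr1.
  by rewrite !exprS; ring.
by rewrite /poisson E; ring.
Qed.

End poisson_mean.

(** * Derivatives of the Poisson kernel *)

Section poisson_diff.
Context {R : realType}.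

Section kernel.
Variables (n : nat) (s : R).
Hypothesis s1 : s < 1.

(** The kernels blow up at the unit sphere, so uniform bounds are taken on concentric smaller balls;
    [s] bounds the squared radius. *)
Definition subball : set 'rV[R]_n := [set y | dotR y y < s].

Notation udiff := (unif_diff subball (@sph R n)).

Lemma subball_unit y : subball y -> unit_ballE y.
Proof. by move=> ys; exact: lt_trans s1. Qed.

Lemma subball_open : open subball.
Proof.
rewrite (_ : subball = (fun y => dotR y y) @^-1` [set x | x < s]) //.
by apply: open_comp; [move=> y _; exact: dotRR_continuous|exact: open_lt].
Qed.

Lemma unif_diff_const c : udiff (fun _ _ => c) (fun _ _ _ => 0).
Proof. exact: (@unif_diff_cst _ _ _ _ _ (fun=> c) `|c|). Qed.

Lemma dotR_bound (e h : 'rV[R]_n) : `|dotR e h| <= (n%:R * `|e|) * `|h|.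
Proof.
rewrite /dotR; apply: le_trans (ler_norm_sum _ _ _) _.
rewrite -[X in X%:R]card_ord -mulrA mulr_natl -sumr_const; apply: ler_sum => i _.
by rewrite normrM ler_pM // rv_coord_le.
Qed.

Lemma subball_bound y : subball y -> `|y| <= 1.
Proof.
move=> ys; rewrite -(@ler_pXn2r _ 2) ?nnegrE // expr1n.
by apply: le_trans (norm_dotR y) _; apply/ltW/subball_unit.
Qed.

Lemma unif_diff_dot (e : 'rV[R]_n) :
  udiff (fun v _ => dotR v e) (fun _ _ h => dotR h e).
Proof.
apply: (@unif_diff_lin R _ _ subball _ (fun v => dotR v e) 1 (n%:R * `|e|)) => [|v|h]; last 2 first.
- exact: subball_bound.
- by rewrite dotRC; exact: dotR_bound.
by move=> c h h'; rewrite !dotRE.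
Qed.

Lemma unif_diff_sum m (k : 'I_m -> 'rV[R]_n -> 'rV[R]_n -> R) dk :
  (forall i, udiff (k i) (dk i)) ->
  udiff (fun v x => \sum_i k i v x) (fun v x h => \sum_i dk i v x h).
Proof.
elim: m k dk => [|m IH] k dk ud.
  by apply: unif_diff_eq (unif_diff_const 0) _ _ => *; rewrite big_ord0.
apply: unif_diff_eq (unif_diffD (ud ord0) (IH _ _ (fun i => ud (lift ord0 i)))) _ _.
  by move=> v x; rewrite big_ord_recl.
by move=> v x h; rewrite big_ord_recl.
Qed.

Lemma dot_stdbasis (v : 'rV[R]_n) (i : 'I_n) : dotR v (stdbasis R n i) = v 0 i.
Proof.
rewrite /dotR (bigD1 i) //= mxE eqxx mulr1 big1 ?addr0 // => j ji.
by rewrite mxE (inj_eq val_inj) (negbTE ji) mulr0.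
Qed.

Lemma unif_diff_sqnorm :
  udiff (fun v _ => dotR v v) (fun v _ h => 2 * dotR v h).
Proof.
apply: unif_diff_eq (unif_diff_sum (fun i => unif_diffX 2
  (unif_diff_dot (stdbasis R n i)))) _ _ => [v z|v z h].
  by apply: eq_bigr => i _; rewrite dot_stdbasis expr2.
rewrite /dotR mulr_sumr; apply: eq_bigr => i _.
by rewrite -![\sum_(_ < _) _]/(dotR _ _) !dot_stdbasis expr1 mulrA.
Qed.

Lemma unif_diff_coef (e : 'rV[R]_n) : udiff (fun _ z => dotR z e) (fun _ _ _ => 0).
Proof. by apply: unif_diff_cst => z; rewrite dotRC; exact: dot_sph_le. Qed.

Lemma unif_diff_diff (e : 'rV[R]_n) :
  udiff (fun v z => dotR (v - z) e) (fun _ _ h => dotR h e).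
Proof.
apply: unif_diff_eq (unif_diffB (unif_diff_dot e) (unif_diff_coef e)) _ _.
  by move=> v z; rewrite !dotRE.
by move=> v z h; rewrite subr0.
Qed.

Lemma unif_diff_dist :
  udiff (fun v z => dotR (v - z) (v - z)) (fun v z h => 2 * dotR (v - z) h).
Proof.
apply: unif_diff_eq (unif_diff_sum (fun i => unif_diffX 2
  (unif_diff_diff (stdbasis R n i)))) _ _ => [v z|v z h].
  by apply: eq_bigr => i _; rewrite dot_stdbasis expr2.
rewrite [in RHS]/dotR mulr_sumr; apply: eq_bigr => i _.
by rewrite !dot_stdbasis expr1 mulrA.
Qed.

Lemma unif_diff_invdist m : udiff (fun v z => invdist v z ^+ m)
  (fun v z h => - (m%:R * dotR (v - z) h * invdist v z ^+ m.+2)).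
Proof.
have c0 : 0 < (1 - s) ^+ 2 / 4 by rewrite divr_gt0 // exprn_gt0 // subr_gt0.
have q_ge (v z : 'rV[R]_n) : subball v -> sph z ->
    (1 - s) ^+ 2 / 4 <= dotR (v - z) (v - z).
  by move=> vs z1; apply: dotR_sphere => //; exact: ltW.
apply: unif_diff_eq (unif_diffX m (unif_diff_invsqrt c0 q_ge unif_diff_dist)) _ _ => //.
move=> v z h; rewrite -/(invdist v z).
transitivity (- (m%:R * invdist v z ^+ m.-1 * invdist v z ^+ 3 * dotR (v - z) h)).
  by field.
by rewrite mulX_pred; ring.
Qed.

Definition dpoisson (v z h : 'rV[R]_n) : R :=
  - 2 * dotR v h * invdist v z ^+ n
  - n%:R * (1 - dotR v v) * dotR (v - z) h * invdist v z ^+ n.+2.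

Lemma unif_diff_poisson : udiff (@poisson R n) dpoisson.
Proof.
apply: unif_diff_eq (unif_diffM (unif_diffB (unif_diff_const 1) unif_diff_sqnorm)
  (unif_diff_invdist n)) _ _ => // v z h.
by rewrite /dpoisson; ring.
Qed.

Definition ddpoisson (e v z h : 'rV[R]_n) : R :=
  - 2 * dotR h e * invdist v z ^+ n
  + 2 * n%:R * dotR v e * dotR (v - z) h * invdist v z ^+ n.+2
  + 2 * n%:R * dotR v h * dotR (v - z) e * invdist v z ^+ n.+2
  - n%:R * (1 - dotR v v) * dotR h e * invdist v z ^+ n.+2
  + n%:R * n.+2%:R * (1 - dotR v v) * dotR (v - z) e * dotR (v - z) h *
      invdist v z ^+ n.+4.

Lemma unif_diff_dpoisson e :
  udiff (fun v z => dpoisson v z e) (fun v z h => ddpoisson e v z h).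
Proof.
apply: unif_diff_eq (unif_diffB
  (unif_diffM (unif_diffM (unif_diff_const (- 2)) (unif_diff_dot e)) (unif_diff_invdist n))
  (unif_diffM (unif_diffM (unif_diffM (unif_diff_const n%:R)
    (unif_diffB (unif_diff_const 1) unif_diff_sqnorm))
    (unif_diff_diff e)) (unif_diff_invdist n.+2))) _ _ => // v z h.
by rewrite /ddpoisson; ring.
Qed.

(** The third-order differential stays unnamed: its existence already gives continuity of the second
    derivatives of a Poisson integral. *)
Lemma unif_diff_ddpoisson e h :
  exists d, udiff (fun v z => ddpoisson e v z h) d.
Proof.
have c := unif_diff_const; have i := unif_diff_invdist.
have D := unif_diffB (c 1) unif_diff_sqnorm.
by eexists; apply: (unif_diffD (unif_diffB (unif_diffD (unif_diffD
  (unif_diffM (unif_diffM (c _) (c _)) (i _))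
  (unif_diffM (unif_diffM (unif_diffM (unif_diffM (c _) (c _)) (unif_diff_dot _))
    (unif_diff_diff _)) (i _)))
  (unif_diffM (unif_diffM (unif_diffM (unif_diffM (c _) (c _)) (unif_diff_dot _))
    (unif_diff_diff _)) (i _)))
  (unif_diffM (unif_diffM (unif_diffM (c _) D) (c _)) (i _)))
  (unif_diffM (unif_diffM (unif_diffM (unif_diffM (unif_diffM (c _) (c _)) D)
    (unif_diff_diff _)) (unif_diff_diff _)) (i _))).
Qed.

End kernel.

(** After taking traces, [p ^+ 2 * |v - z|^2 = 1] brings every term to the power [p ^+ n.+2], and a
    polynomial identity in the scalar products is left. *)
Lemma poisson_laplace n (v z : 'rV[R]_n) : unit_ballE v -> sph z ->
  \sum_(i < n) ddpoisson (stdbasis R n i) v z (stdbasis R n i) = 0.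
Proof.
move=> v1 z1.
have S1 : \sum_(i < n) dotR (stdbasis R n i) (stdbasis R n i) = n%:R.
  rewrite -[RHS]mulr1 -[X in X%:R]card_ord mulr_natl -sumr_const.
  by apply: eq_bigr => i _; rewrite dot_stdbasis mxE eqxx.
have S2 : \sum_(i < n) dotR v (stdbasis R n i) * dotR (v - z) (stdbasis R n i) =
    dotR v (v - z).
  by apply: eq_bigr => i _; rewrite !dot_stdbasis.
have S3 : \sum_(i < n) dotR (v - z) (stdbasis R n i) * dotR (v - z) (stdbasis R n i) =
    dotR (v - z) (v - z).
  by apply: eq_bigr => i _; rewrite !dot_stdbasis.
set p := invdist v z.
transitivity ((- 2 * p ^+ n - n%:R * (1 - dotR v v) * p ^+ n.+2) * n%:R
    + 4 * n%:R * p ^+ n.+2 * dotR v (v - z)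
    + n%:R * n.+2%:R * (1 - dotR v v) * p ^+ n.+4 * dotR (v - z) (v - z)).
  rewrite -[X in _ * X + _ + _]S1 -S2 -S3 !mulr_sumr -!big_split /=.
  by apply: eq_bigr => i _; rewrite /ddpoisson -/p; ring.
have e := invdist_sqr v1 z1; rewrite -/p in e.
have E4 : p ^+ n.+4 * dotR (v - z) (v - z) = p ^+ n.+2.
  by rewrite -[RHS]mulr1 -[X in _ = _ * X]e !exprS; ring.
have E2 : p ^+ n = p ^+ n.+2 * dotR (v - z) (v - z).
  by rewrite -[LHS]mulr1 -[X in _ * X = _]e !exprS; ring.
rewrite -[n%:R * n.+2%:R * _ * _ * _]mulrA E4 E2 dist_sph // dotRDr dotRNr.
by rewrite -!natr1; ring.
Qed.

End poisson_diff.

(** * Harmonicity of Poisson integrals *)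

Section poisson_integral.
Context {R : realType}.

Lemma csph_bounded n (f : 'rV[R]_n -> R) : csph f ->
  exists M : R, forall z, sph z -> `|f z| <= M.
Proof.
move=> cf; have [[z0 z01]|N] := pselect (exists z, @sph R n z); last first.
  by exists 0 => z z1; case: N; exists z.
have cw : {within @sph R n, continuous (fun z => `|f z|)}.
  apply: continuous_in_subspaceT => z; rewrite inE => z1.
  exact: csph_norm.
have [|c _ cM] := compact_EVT_max _ (@sph_compact R n) cw; first by exists z0.
by exists `|f c| => z z1; apply: cM; rewrite inE.
Qed.

Lemma unif_diff_reindex (V : normedModType R) (X Y : Type) (D : set V) (S : set X)
    (T : set Y) (phi : Y -> X) k dk : (forall x, T x -> S (phi x)) ->
  unif_diff D S k dk ->
  unif_diff D T (fun v x => k v (phi x)) (fun v x => dk v (phi x)).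
Proof.
move=> phiS [l [C C0 H]]; split; first by move=> *; rewrite l.
by exists C => // v w x Dv Dw /phiS Tx; exact: H.
Qed.

Variables (n : nat) (L : ('rV[R]_n -> R) -> R) (f : 'rV[R]_n -> R)
  (phi : 'rV[R]_n -> 'rV[R]_n).
Hypotheses (mL : mean_functional L) (cf : csph f)
  (phi_sph : forall z, sph z -> sph (phi z))
  (phi_cont : forall g : 'rV[R]_n -> R, csph g -> csph (g \o phi)).

(** The map [phi] moves only the pole of the kernel. With [phi = id] this is the Poisson integral;
    with [phi] an isometry it gives the Poisson integral composed with the isometry, without
    differentiating a composition. *)
Definition pint y := L (fun z => poisson y (phi z) * f z).

Lemma csph_poisson y : unit_ballE y -> csph (@poisson R n y).
Proof.
by move=> y1; apply: csphM; [exact: csph_cst|apply: csphX; exact: csph_invdist].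
Qed.

Lemma csph_diff (y e : 'rV[R]_n) : csph (fun z => dotR (y - z) e).
Proof.
rewrite (_ : (fun _ => _) = fun z => dotR y e - dotR e z); last first.
  by apply/funext => z; rewrite !dotRE (dotRC z).
by apply: csphB; [exact: csph_cst|exact: csph_dot].
Qed.

Lemma csph_dpoisson (y h : 'rV[R]_n) : unit_ballE y -> csph (fun z => dpoisson y z h).
Proof.
move=> y1; have ci m : csph (fun z => invdist y z ^+ m).
  by apply: csphX; exact: csph_invdist.
have c := @csph_cst R n; have d := csph_diff.
exact: (csphB (csphM (c _) (ci _)) (csphM (csphM (c _) (d _ _)) (ci _))).
Qed.

Lemma csph_ddpoisson (e y h : 'rV[R]_n) : unit_ballE y -> csph (fun z => ddpoisson e y z h).
Proof.
move=> y1; have ci m : csph (fun z => invdist y z ^+ m).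
  by apply: csphX; exact: csph_invdist.
have c := @csph_cst R n; have d := csph_diff.
have t1 a m := csphM (c a) (ci m); have t2 a e' m := csphM (csphM (c a) (d y e')) (ci m).
exact: (csphD (csphB (csphD (csphD (t1 _ _) (t2 _ _ _)) (t2 _ _ _)) (t1 _ _))
  (csphM (csphM (csphM (c _) (d _ _)) (d _ _)) (ci _))).
Qed.

Lemma ball_between (y : 'rV[R]_n) : unit_ballE y ->
  exists2 s, s < 1 & nbhs y (@subball R n s).
Proof.
move=> y1; have y1' : dotR y y < 1 by [].
exists ((1 + dotR y y) / 2); first by rewrite ltr_pdivrMr //; lra.
apply: open_nbhs_nbhs; split; first exact: subball_open.
by rewrite /subball /= ltr_pdivlMr //; lra.
Qed.

Lemma pint_diff_eq (F : 'rV[R]_n -> R) y : unit_ballE y ->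
  (forall w, unit_ballE w -> F w = pint w) ->
  differentiable F y /\
  forall h, 'D_h F y = L (fun z => dpoisson y (phi z) h * f z).
Proof.
move=> y1 FE; have [M fM] := csph_bounded cf; have [s s1 ys] := ball_between y1.
have sb w : subball s w -> unit_ballE w := @subball_unit R n s s1 w.
have ud := unif_diff_reindex phi_sph (unif_diff_poisson n s1).
apply: (mean_diff mL ud _ _ cf fM ys).
- by move=> w /sb w1; apply: phi_cont; exact: csph_poisson.
- by move=> w h /sb w1; exact: (phi_cont (csph_dpoisson w1)).
- by move=> w /sb w1; exact: FE.
Qed.

Lemma pint_diff y : unit_ballE y ->
  differentiable pint y /\
  forall h, 'D_h pint y = L (fun z => dpoisson y (phi z) h * f z).
Proof. by move=> y1; exact: pint_diff_eq. Qed.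

Lemma pint_diff2 y e : unit_ballE y ->
  differentiable ('D_e pint) y /\
  forall h, 'D_h ('D_e pint) y = L (fun z => ddpoisson e y (phi z) h * f z).
Proof.
move=> y1; have [M fM] := csph_bounded cf; have [s s1 ys] := ball_between y1.
have sb w : subball s w -> unit_ballE w := @subball_unit R n s s1 w.
apply: (mean_diff mL (unif_diff_reindex phi_sph (unif_diff_dpoisson s1 e)) _ _ cf fM ys).
- by move=> w /sb w1; exact: (phi_cont (csph_dpoisson w1)).
- by move=> w h /sb w1; exact: (phi_cont (csph_ddpoisson w1)).
- by move=> w /sb w1; have [_ ->] := pint_diff w1.
Qed.

Lemma pint_diff3 y e h : unit_ballE y ->
  {for y, continuous ('D_h ('D_e pint))}.
Proof.
move=> y1; have [M fM] := csph_bounded cf; have [s s1 ys] := ball_between y1.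
have sb w : subball s w -> unit_ballE w := @subball_unit R n s s1 w.
have [d ud] := unif_diff_ddpoisson s1 e h.
apply: (mean_unif_continuous mL (unif_diff_reindex phi_sph ud) _ cf fM ys).
- by move=> w /sb w1; exact: (phi_cont (csph_ddpoisson w1)).
- by move=> w /sb w1; have [_ ->] := pint_diff2 e w1.
Qed.

Lemma pint_harmonic : harmonic_on (@unit_ballE R n) pint.
Proof.
split=> [x x1|i x x1|i j x x1|x x1].
- by have [] := pint_diff x1.
- by have [] := pint_diff2 (stdbasis R n i) x1.
- exact: pint_diff3.
under eq_bigr do rewrite (pint_diff2 _ x1).2.
have [LD LZ _ _] := mL.
have cdd i : csph (fun z => ddpoisson (stdbasis R n i) x (phi z) (stdbasis R n i) * f z).
  by apply: csphM => //; exact: (phi_cont (csph_ddpoisson x1)).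
have sumL (r : seq 'I_n) (k : 'I_n -> 'rV[R]_n -> R) : (forall i, csph (k i)) ->
    \sum_(i <- r) L (k i) = L (fun z => \sum_(i <- r) k i z).
  move=> ck; elim: r => [|i r IH].
    rewrite big_nil -[LHS](mean_cst 0 mL); congr L; apply/funext => z.
    by rewrite big_nil.
  rewrite big_cons IH -LD //; last exact: csph_sum.
  by congr L; apply/funext => z; rewrite big_cons.
rewrite sumL // -[RHS](mean_cst 0 mL); apply: (mean_eq mL).
- exact: csph_sum.
- exact: csph_cst.
- by move=> z z1; rewrite -mulr_suml poisson_laplace ?mul0r //; exact: phi_sph.
Qed.

End poisson_integral.

(** * The Dirichlet problem *)

Section maximum_principle.
Context {R : realType}.

Lemma is_derive_line n (w : 'rV[R]_n -> R) (y e : 'rV[R]_n) (t a : R) :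
  is_derive (y + t *: e) e w a -> is_derive t 1 (fun s => w (y + s *: e)) a.
Proof.
move=> [dw <-].
have E : (fun h : R => h^-1 *: (((fun s => w (y + s *: e)) \o shift t) (h *: 1) -
      w (y + t *: e))) =
    (fun h => h^-1 *: ((w \o shift (y + t *: e)) (h *: e) - w (y + t *: e))).
  apply/funext => h /=; congr (_ *: (w _ - _)).
  by rewrite [h%:A]mulr1 scalerDl addrCA.
by apply: DeriveDef; rewrite /derivable /derive E.
Qed.

(** Otherwise [g], which vanishes at the maximum, would be positive just to the right of 0, and [f]
    would increase there. *)
Lemma second_derivative_max (f g : R -> R) (r c : R) : 0 < r ->
  (forall t : R, `|t| < r -> is_derive t 1 f (g t)) ->
  is_derive (0 : R) 1 g c -> (forall t, `|t| < r -> f t <= f 0) -> c <= 0.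
Proof.
move=> r0 df dg fmax; rewrite leNgt; apply/negP => c0.
have inr t : t \in `]-r, r[%R -> `|t| < r by rewrite in_itv /= ltr_norml.
have g0 : g 0 = 0.
  have z : (0 : R) \in `]-r, r[%R by rewrite in_itv /= r0 oppr_lt0 r0.
  have d0 : is_derive (0 : R) 1 f 0.
    apply: (@derive1_at_max _ f (-r) r) => //; first by rewrite ge0_cp ?ltW.
      by move=> t /inr /df h.
    by move=> t /inr; exact: fmax.
  have dfz := df 0; rewrite normr0 in dfz; have := dfz r0 => d1.
  by rewrite -(@derive_val _ _ _ _ _ _ _ d1) (@derive_val _ _ _ _ _ _ _ d0).
have [t t0 gt0] : exists2 t, 0 < t & forall s, 0 < s < t -> 0 < g s.
  have cg : h^-1 *: ((g \o shift 0) (h *: 1) - g 0) @[h --> 0^'] --> c.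
    by case: dg => dg <-.
  have H : nbhs (0 : R) [set h : R | h != 0 ->
      0 < h^-1 *: ((g \o shift 0) (h *: 1) - g 0)] := cvgr_gt c cg 0 c0.
  have [t /= t0 Ht] := (nbhs_norm0P.1 (H _)).
  exists t => // s /andP[s0 st].
  have := Ht s; rewrite /= gtr0_norm // => /(_ st).
  rewrite gt_eqF // => /(_ isT); rewrite g0 subr0 addr0 [s%:A]mulr1.
  by rewrite [_ *: _]mulrC pmulr_lgt0 // invr_gt0.
pose u := Num.min r t / 2.
have m0 : 0 < Num.min r t by rewrite lt_min r0.
have u0 : 0 < u by rewrite divr_gt0.
have um : u < Num.min r t by rewrite ltr_pdivrMr // ltr_pMr // ltr1n.
have [ur ut] : u < r /\ u < t by move: um; rewrite lt_min => /andP[].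
have dfu x : x \in `]0, u[%R -> is_derive x 1 f (g x).
  rewrite in_itv /= => /andP[x0 xu]; apply: df.
  by rewrite gtr0_norm // (lt_trans xu).
have cfu : {within `[0, u], continuous f}.
  apply: cont_on_within => x /andP[x0 xu]; apply: is_derive_cont (df x _).
  by rewrite ger0_norm // (le_lt_trans xu).
have [x] := MVT u0 dfu cfu; rewrite in_itv /= => /andP[x0 xu] E.
have : f u <= f 0 by apply: fmax; rewrite gtr0_norm.
rewrite leNgt -subr_gt0 E subr0 mulr_gt0 // gt0 //.
by rewrite x0 (lt_trans xu).
Qed.

(* Harmonicity in a form stable under dilations of the variable. *)
Definition weakly_harmonic n (w : 'rV[R]_n -> R) :=
  (forall y, unit_ballE y -> {for y, continuous w}) /\
  exists g h : 'I_n -> 'rV[R]_n -> R, forall y, unit_ballE y ->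
    (forall i : 'I_n, is_derive y (stdbasis R n i) w (g i y) /\
               is_derive y (stdbasis R n i) (g i) (h i y)) /\
    \sum_i h i y = 0.

Lemma harmonic_weakly n (u : 'rV[R]_n -> R) :
  harmonic_on (@unit_ballE R n) u -> weakly_harmonic u.
Proof.
move=> [du ddu _ lu]; split.
  by move=> y /du; exact: differentiable_continuous.
exists (fun i : 'I_n => 'D_(stdbasis R n i) u).
exists (fun i : 'I_n => 'D_(stdbasis R n i) ('D_(stdbasis R n i) u)) => y y1.
split; last exact: lu.
move=> i; split; apply: derivableP; apply: diff_derivable; [exact: du|exact: ddu].
Qed.

Lemma weakly_harmonicB n (u v : 'rV[R]_n -> R) : weakly_harmonic u ->
  weakly_harmonic v -> weakly_harmonic (fun y => u y - v y).
Proof.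
move=> [cu [g1 [h1 H1]]] [cv [g2 [h2 H2]]]; split.
  by move=> y y1; exact: (cvgB (cu y y1) (cv y y1)).
exists (fun i y => g1 i y - g2 i y), (fun i y => h1 i y - h2 i y) => y y1.
have [d1 s1] := H1 y y1; have [d2 s2] := H2 y y1; split.
  move=> i; have [a1 b1] := d1 i; have [a2 b2] := d2 i.
  by split; apply: is_deriveB.
by rewrite sumrB s1 s2 subrr.
Qed.

Lemma is_derive_scale n (v : 'rV[R]_n -> R) (r : R) (y e : 'rV[R]_n) :
  differentiable v (r *: y) ->
  is_derive y e (fun z => v (r *: z)) (r * 'D_e v (r *: y)).
Proof.
move=> dv.
have E : (fun h : R => h^-1 *: (((fun z => v (r *: z)) \o shift y) (h *: e) -
      v (r *: y))) =
    (fun h => h^-1 *: ((v \o shift (r *: y)) (h *: (r *: e)) - v (r *: y))).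
  apply/funext => h /=; congr (_ *: (v _ - _)).
  by rewrite scalerDr !scalerA (mulrC r).
have d : derivable v (r *: y) (r *: e) by exact: diff_derivable.
apply: DeriveDef; first by rewrite /derivable E.
rewrite /derive E -/(derive v (r *: y) (r *: e)) deriveE //.
by rewrite linearZ -(deriveE _ dv).
Qed.

Lemma weakly_harmonic_scale n (u : 'rV[R]_n -> R) r : 0 < r < 1 ->
  harmonic_on (@unit_ballE R n) u -> weakly_harmonic (fun y => u (r *: y)).
Proof.
move=> /andP[r0 r1] [du ddu _ lu].
have rB (y : 'rV[R]_n) : unit_ballE y -> unit_ballE (r *: y).
  rewrite /unit_ballE /= !dotRE; have := dotR_ge0 y; nra.
split.
  move=> y /rB y1.
  have c1 : {for y, continuous (fun z : 'rV[R]_n => r *: z)} by exact: scaler_continuous.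
  have c2 : {for r *: y, continuous u} by apply: differentiable_continuous; exact: du.
  exact: (continuous_comp c1 c2).
exists (fun (i : 'I_n) y => r * 'D_(stdbasis R n i) u (r *: y)).
exists (fun (i : 'I_n) y =>
  r * (r * 'D_(stdbasis R n i) ('D_(stdbasis R n i) u) (r *: y))) => y /rB y1.
split; last by rewrite -!mulr_sumr lu // !mulr0.
move=> i; split; first by apply: is_derive_scale; exact: du.
by apply: is_deriveZ; apply: is_derive_scale; exact: ddu.
Qed.

Lemma stdbasis_norm n (i : 'I_n) : dotR (stdbasis R n i) (stdbasis R n i) = 1.
Proof. by rewrite dot_stdbasis mxE eqxx. Qed.

(** If [a = w y0 > 0], adding a small multiple of [|y|^2] gives a function with an interior maximum
    on a compact ball. There every pure second derivative is at most 0, yet they sum to a positive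
    number. *)
Lemma maximum_principle n (w : 'rV[R]_n.+1 -> R) : weakly_harmonic w ->
  (forall e, 0 < e -> exists2 s, s < 1 & forall y, s < dotR y y < 1 -> w y <= e) ->
  forall y, unit_ballE y -> w y <= 0.
Proof.
move=> [cw [g [h H]]] bw y0 y01; rewrite leNgt; apply/negP => a0.
set a := w y0 in a0.
have [s s1 ws] := bw (a / 2) (divr_gt0 a0 (ltr0Sn R 1)).
(* The ball [K] contains [y0], and its boundary lies in the layer where [w <= a / 2]. *)
pose s' := (1 + Num.max s (dotR y0 y0)) / 2.
have m1 : Num.max s (dotR y0 y0) < 1 by rewrite gt_max s1.
have s'1 : s' < 1 by rewrite /s'; lra.
have /andP[ss' ys'] : (s < s') && (dotR y0 y0 < s').
  by rewrite -gt_max /s'; lra.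
pose K : set 'rV[R]_n.+1 := [set y | dotR y y <= s'].
have KB y : K y -> unit_ballE y by move=> Ky; exact: le_lt_trans s'1.
(* On the boundary of [K], [W < a / 2 + a / 4 < a], so the maximum is not reached there. The added
   term contributes [a / 2] to each second derivative. *)
pose W y := w y + a / 4 * dotR y y.
have Kc : compact K.
  apply: (subclosed_compact _ (@cball_compact R n.+1)).
    rewrite (_ : K = (fun y => dotR y y) @^-1` [set x | x <= s']) //.
    by apply: preimage_closed; [move=> y _; exact: dotRR_continuous|exact: closed_le].
  by move=> y /KB /ltW.
have cW : {within K, continuous W}.
  apply: continuous_in_subspaceT => y; rewrite inE => /KB y1.
  exact: (cvgD (cw y y1) (cvgM (cvg_cst _) (@dotRR_continuous R n.+1 y))).
have [|x xK xmax] := compact_EVT_max _ Kc cW; first by exists y0; exact: ltW.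
rewrite inE in xK.
have x1 := KB _ xK.
have Wx : a <= W x.
  apply: le_trans (xmax y0 _); last by rewrite inE; exact: ltW.
  by rewrite /W lerDl mulr_ge0 ?dotR_ge0 // divr_ge0 // ltW.
have xs' : dotR x x < s'.
  rewrite lt_neqAle xK andbT; apply/eqP => xE.
  have : w x <= a / 2 by apply: ws; rewrite xE ss'.
  by move: Wx; rewrite /W xE; nra.
have [d sh] := H x x1.
have hi i : h i x + a / 2 <= 0.
  set e := stdbasis R n.+1 i.
  have e1 : `|e| <= 1.
    by rewrite -(@ler_pXn2r _ 2) ?nnegrE // expr1n -(stdbasis_norm i) norm_dotR.
  have : nbhs x (@subball R n.+1 s').
    by apply: open_nbhs_nbhs; split; [exact: subball_open|].
  move=> /nbhs_ballP[r /= r0 xr].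
  have rK t : `|t| < r -> K (x + t *: e).
    move=> tr; apply: ltW; apply: xr; rewrite -ball_normE /= opprD addNKr normrN.
    by rewrite normrZ; apply: le_lt_trans tr; rewrite ler_piMr.
  pose phi t := w (x + t *: e) + a / 4 * (dotR x x + 2 * x 0 i * t + t ^+ 2).
  have phiE t : phi t = W (x + t *: e).
    rewrite /W /phi !dotRE stdbasis_norm (dotRC e x) dot_stdbasis; congr (_ + _ * _).
    by ring.
  pose dphi t := g i (x + t *: e) + a / 4 * (2 * x 0 i + 2 * t).
  have h1 (t : R) : `|t| < r -> is_derive t 1 phi (dphi t).
    move=> tr; have [+ _] := H _ (KB _ (rK t tr)) => /(_ i)[+ _] => /is_derive_line dw.
    apply: der_eq (derD dw (derM (der_cst _ _) (derD (derD (der_cst _ _)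
      (derM (der_cst _ _) (der_id _))) (derX 2 (der_id _))))) _.
    by rewrite /dphi /= expr1; ring.
  have h2 : is_derive (0 : R) 1 dphi (h i x + a / 2).
    have d2 : is_derive (x + 0 *: e) e (g i) (h i x).
      by rewrite scale0r addr0; have [] := d i.
    apply: der_eq (derD (is_derive_line d2) (derM (der_cst _ _) (derD (der_cst _ _)
      (derM (der_cst _ _) (der_id _))))) _.
    by field.
  apply: second_derivative_max r0 h1 h2 _ => t tr.
  by rewrite !phiE scale0r addr0; apply: xmax; rewrite inE; exact: rK.
have : \sum_(i < n.+1) (h i x + a / 2) <= 0 by apply: sumr_le0 => i _; exact: hi.
rewrite big_split /= sh add0r sumr_const card_ord leNgt => /negP; apply.
by rewrite pmulrn_lgt0 // divr_gt0.
Qed.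

End maximum_principle.

Section dirichlet.
Context {R : realType}.

Definition boundary0 n (w : 'rV[R]_n -> R) := forall e, 0 < e ->
  exists2 s, s < 1 & forall y, s < dotR y y < 1 -> `|w y| <= e.

Lemma dirichlet0 n (w : 'rV[R]_n.+1 -> R) : weakly_harmonic w -> boundary0 w ->
  forall y, unit_ballE y -> w y = 0.
Proof.
move=> hw bw y y1; apply/eqP; rewrite eq_le -(oppr_le0 (w y)); apply/andP; split.
  apply: (maximum_principle hw _ y1) => e /bw[s s1 H]; exists s => // x /H.
  by apply: le_trans; exact: ler_norm.
have h0 : weakly_harmonic (fun _ : 'rV[R]_n.+1 => 0 : R).
  split; first by move=> x _; exact: cst_continuous.
  exists (fun _ _ => 0), (fun _ _ => 0) => x _; split; last by rewrite big1.
  by move=> i; split; exact: is_derive_cst.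
have hN := weakly_harmonicB h0 hw.
rewrite -[leLHS]add0r; apply: (maximum_principle hN _ y1) => e /bw[s s1 H].
exists s => // x /H; rewrite sub0r; apply: le_trans; rewrite -normrN.
exact: ler_norm.
Qed.

(** Boundary data come with an extension to the closed ball, so boundary convergence compares the
    solution with [f y] itself rather than with a radial projection. *)
Definition ccball n (f : 'rV[R]_n -> R) :=
  forall z, dotR z z <= 1 -> {for z, continuous f}.

Lemma ccball_csph n (f : 'rV[R]_n -> R) : ccball f -> csph f.
Proof. by move=> cf z z1; apply: cf; rewrite z1. Qed.

(** Uniform continuity handles close points and boundedness the others. The quadratic form is chosen
    because [|x - z|^2] cancels two powers of the singularity of the Poisson kernel. *)
Lemma quadratic_modulus n (f : 'rV[R]_n -> R) e : ccball f -> 0 < e ->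
  exists2 C, 0 <= C & forall x z, dotR x x <= 1 -> dotR z z <= 1 ->
    `|f z - f x| <= e + C * dotR (x - z) (x - z).
Proof.
move=> cf e0; have cK := @cball_compact R n.
have [d d0 fd] := compact_unif cK cf e0.
have cw : {within @cball R n, continuous (fun z => `|f z|)}.
  apply: continuous_in_subspaceT => z; rewrite inE => z1.
  exact: (cvg_norm (cf z z1)).
have [|c _ cM] := compact_EVT_max _ cK cw.
  by exists 0; rewrite /cball /= dotR0l.
have M0 : 0 <= `|f c| by [].
exists (2 * `|f c| / d ^+ 2) => [|x z x1 z1].
  by rewrite divr_ge0 ?mulr_ge0 ?exprn_ge0 // ltW.
have q0 := dotR_ge0 (x - z).
have [xz|xz] := ltP `|z - x| d.
  apply: (@le_trans _ _ e); first by apply/ltW/fd.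
  by rewrite lerDl mulr_ge0 ?divr_ge0 ?mulr_ge0 ?exprn_ge0 // ltW.
have fxz : `|f z - f x| <= 2 * `|f c|.
  apply: le_trans (ler_normB _ _) _; rewrite mulr_natl mulr2n.
  by rewrite lerD // cM // inE.
have dq : d ^+ 2 <= dotR (x - z) (x - z).
  apply: le_trans (norm_dotR _); rewrite distrC lerXn2r ?nnegrE //; exact: ltW.
apply: le_trans fxz _; apply: ler_wpDl; first exact: ltW.
rewrite mulrAC ler_pdivlMr ?exprn_gt0 // ler_wpM2l // mulr_ge0 //.
Qed.

Section sphere.
Variable k : nat.
Hypothesis k0 : (0 < k)%N.
Notation Lam := (@avg R k.+1).
Let mL : mean_functional Lam := avg_mean k.+1.

(** The quadratic part of the modulus, integrated against the kernel, becomes [C (1 - |y|^2)] times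
    the mean of the Newtonian kernel, which is 1. No localisation near a boundary point is
    involved. *)
Lemma pint_boundary (f : 'rV[R]_k.+2 -> R) : ccball f ->
  boundary0 (fun y => pint Lam f id y - f y).
Proof.
move=> cf e e0; have e2 : 0 < e / 2 by rewrite divr_gt0.
have [C C0 HC] := quadratic_modulus cf e2.
(* Makes [C (1 - |y|^2) <= e / 2]; the [+ 1] guards against [C = 0]. *)
exists (1 - e / 2 / (C + 1)).
  by rewrite gtrBl divr_gt0 // ltr_wpDl.
move=> y /andP[sy y1].
have cP : csph (poisson y) by exact: csph_poisson.
have cp : csph (fun z => invdist y z ^+ k) by apply: csphX; exact: csph_invdist.
have cfs := ccball_csph cf.
have [LD LZ Lle L1] := mL.
have -> : pint Lam f id y - f y = Lam (fun z => poisson y z * (f z - f y)).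
  rewrite -[f y in LHS](mulr1) -(avg_poisson k0 y1) -LZ // -mean_B //.
  - by congr Lam; apply/funext => z; ring.
  - exact: csphM.
  - by apply: csphM => //; exact: csph_cst.
have P0 z : sph z -> 0 <= poisson y z.
  move=> z1; rewrite mulr_ge0 // ?subr_ge0 ?ltW //.
  by rewrite exprn_gt0 // invdist_gt0.
apply: (@le_trans _ _ (Lam (fun z => e / 2 * poisson y z +
    C * (1 - dotR y y) * invdist y z ^+ k))).
  apply: (mean_norm_le mL) => [||z z1].
  - by apply: csphM => //; apply: csphB => //; exact: csph_cst.
  - by apply: csphD; apply: csphM => //; exact: csph_cst.
  - have E : poisson y z * dotR (y - z) (y - z) = (1 - dotR y y) * invdist y z ^+ k.
      rewrite /poisson -[RHS]mulr1 -(invdist_sqr y1 z1) !exprS; ring.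
    rewrite normrM (ger0_norm (P0 z z1)).
    apply: le_trans (ler_wpM2l (P0 z z1) (HC y z (ltW y1) _)) _; first by rewrite z1.
    by rewrite mulrDr (mulrCA _ C) E (mulrC (poisson y z)) (mulrA C).
rewrite LD; [|by apply: csphM => //; exact: csph_cst|by apply: csphM => //; exact: csph_cst].
rewrite (LZ (e / 2)) // (LZ (C * _)) // (avg_poisson k0 y1) (avg_newton k0 y1).1 !mulr1.
have : C * (1 - dotR y y) <= e / 2.
  have : 1 - dotR y y <= e / 2 / (C + 1) by lra.
  rewrite ler_pdivlMr ?ltr_wpDl // => h; apply: le_trans h.
  rewrite mulrC ler_wpM2l ?lerDl // subr_ge0; exact: ltW.
by lra.
Qed.

(** The dilation by [r < 1] makes [u] continuous up to the boundary, so uniqueness of the Dirichlet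
    problem applies. *)
Lemma poisson_formula (u : 'rV[R]_k.+2 -> R) r : 0 < r < 1 ->
  harmonic_on (@unit_ballE R k.+2) u ->
  forall y, unit_ballE y -> u (r *: y) = pint Lam (fun z => u (r *: z)) id y.
Proof.
move=> r01 hu y y1; have [r0 r1] := andP r01.
have cf : ccball (fun z => u (r *: z)).
  move=> z z1; have rz : unit_ballE (r *: z).
    rewrite /unit_ballE /= !dotRE; have := dotR_ge0 z; nra.
  have c1 : {for z, continuous (fun z : 'rV[R]_k.+2 => r *: z)} by exact: scaler_continuous.
  have c2 : {for r *: z, continuous u}.
    by have [du _ _ _] := hu; apply: differentiable_continuous; exact: du.
  exact: (continuous_comp c1 c2).
have hp := harmonic_weakly (pint_harmonic mL (ccball_csph cf) (phi := id)
  (fun z h => h) (fun g h => h)).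
have := dirichlet0 (weakly_harmonicB hp (weakly_harmonic_scale r01 hu))
  (pint_boundary cf) y1.
by move=> /eqP; rewrite subr_eq0 => /eqP ->.
Qed.

(** The Poisson integral of [f \o Q], and the integral of [f] with pole moved by [Q], are harmonic
    with the same boundary values [f \o Q]. They agree at 0, where the kernel is 1 and they reduce
    to the two means. *)
Lemma avg_invariant (Q : 'rV[R]_k.+2 -> 'rV[R]_k.+2) (f : 'rV[R]_k.+2 -> R) :
  continuous Q -> (forall y z, dotR (Q y) (Q z) = dotR y z) ->
  (forall z, Q (Q z) = z) -> ccball f -> Lam (f \o Q) = Lam f.
Proof.
move=> cQ iQ QQ cf.
have Q_sph z : sph z -> sph (Q z) by rewrite /sph /= iQ.
have cfQ : ccball (f \o Q).
  move=> z z1; have cz := cQ z.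
  have cfz : {for Q z, continuous f} by apply: cf; rewrite iQ.
  exact: (continuous_comp cz cfz).
have cgQ (g : 'rV[R]_k.+2 -> R) : csph g -> csph (g \o Q).
  move=> cg z /Q_sph z1; have cz := cQ z; have cgz := cg _ z1.
  exact: (continuous_comp cz cgz).
have h1 := harmonic_weakly (pint_harmonic mL (ccball_csph cfQ) (phi := id)
  (fun z h => h) (fun g h => h)).
have h2 := harmonic_weakly (pint_harmonic mL (ccball_csph cf) Q_sph cgQ).
have PQ y z : sph z -> poisson y (Q z) = poisson (Q y) z.
  move=> z1; rewrite /poisson /invdist !dist_sph //; last exact: Q_sph.
  by rewrite !iQ -[in dotR y (Q z)](QQ y) iQ.
have b2 : boundary0 (fun y => pint Lam f Q y - f (Q y)).
  move=> e e0; have [s s1 H] := pint_boundary cf e0; exists s => // y y1.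
  have yB : unit_ballE y by case/andP: y1.
  have QyB : unit_ballE (Q y) by rewrite /unit_ballE /= iQ.
  rewrite [pint _ _ _ _](_ : _ = pint Lam f id (Q y)); first by apply: H; rewrite iQ.
  apply: (mean_eq mL) => [||z z1]; last by rewrite PQ.
  - by apply: csphM; [apply: cgQ; exact: csph_poisson|exact: ccball_csph].
  - by apply: csphM; [exact: csph_poisson|exact: ccball_csph].
have b : boundary0 (fun y => pint Lam (f \o Q) id y - pint Lam f Q y).
  move=> e e0; have e2 : 0 < e / 2 by rewrite divr_gt0.
  have [s s1 H] := pint_boundary cfQ e2; have [t t1 G] := b2 _ e2.
  exists (Num.max s t); first by rewrite gt_max s1.
  move=> y; rewrite gt_max => /andP[/andP[sy ty] y1].
  rewrite -(subrK (f (Q y)) (pint _ _ _ y)) -addrA.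
  apply: le_trans (ler_normD _ _) _; rewrite (splitr e) lerD //.
    by apply: H; rewrite sy.
  by rewrite distrC; apply: G; rewrite ty.
have z0 : unit_ballE (0 : 'rV[R]_k.+2) by rewrite /unit_ballE /= dotR0l.
have P0 z : sph z -> poisson 0 z = 1.
  move=> z1; rewrite /poisson /invdist dist_sph // !dotR0l subr0 addr0 mulr0 subr0.
  by rewrite sqrtr1 invr1 expr1n mulr1.
have := dirichlet0 (weakly_harmonicB h1 h2) b z0.
have -> : pint Lam (f \o Q) id 0 = Lam (f \o Q).
  apply: (mean_eq mL) => [||z z1]; last by rewrite P0 ?mul1r.
  - by apply: csphM; [exact: csph_poisson|exact: ccball_csph].
  - exact: ccball_csph.
have -> : pint Lam f Q 0 = Lam f.
  apply: (mean_eq mL) => [||z z1]; last by rewrite P0 ?mul1r //; exact: Q_sph.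
  - by apply: csphM; [apply: cgQ; exact: csph_poisson|exact: ccball_csph].
  - exact: ccball_csph.
by move=> /eqP; rewrite subr_eq0 => /eqP.
Qed.

End sphere.

End dirichlet.

(** * The optimal constant as a mean *)

Section optimal_constant.
Context {R : realType}.

Lemma dotR_grad n (u : 'rV[R]_n -> R) (x l : 'rV[R]_n) : differentiable u x ->
  dotR (grad u x) l = 'D_l u x.
Proof.
move=> du; rewrite deriveE //.
have lE : l = \sum_(i < n) l 0 i *: stdbasis R n i.
  apply/rowP => j; rewrite summxE (bigD1 j) //= !mxE eqxx mulr1 big1 ?addr0 //.
  by move=> i ij; rewrite !mxE (inj_eq val_inj) eq_sym (negbTE ij) mulr0.
rewrite [in RHS]lE linear_sum /dotR; apply: eq_bigr => i _.
by rewrite mxE linearZ deriveE // mulrC.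
Qed.

Lemma le_limit_linear (a b c d : R) : 0 < d ->
  (forall t, 0 < t < d -> a <= b + t * c) -> a <= b.
Proof.
move=> d0 H; apply/ler_addgt0Pr => e e0.
have c0 : 0 < `|c| + 1 by rewrite ltr_wpDl.
pose t := Num.min (d / 2) (e / (`|c| + 1)).
have t0 : 0 < t by rewrite lt_min !divr_gt0.
have td : t < d by rewrite gt_min ltr_pdivrMr // ltr_pMr // ltr1n.
have te : t * (`|c| + 1) <= e by rewrite -ler_pdivlMr // ge_min lexx orbT.
apply: le_trans (H t _) _; first by rewrite t0.
rewrite lerD2l; apply: le_trans te; rewrite ler_pM2l //.
by apply: le_trans (ler_norm c) _; rewrite lerDl.
Qed.

Variable k : nat.
Hypothesis k0 : (0 < k)%N.
Notation Lam := (@avg R k.+1).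
Let mL : mean_functional Lam := avg_mean k.+1.

Definition grad_norm (x l : 'rV[R]_k.+2) := Lam (fun z => `|dpoisson x z l|).

Lemma grad_norm_ge0 x l : unit_ballE x -> 0 <= grad_norm x l.
Proof.
move=> x1; rewrite -(mean_cst 0 mL); have [_ _ Lle _] := mL; apply: Lle => //.
  exact: csph_cst.
by apply: csph_norm; exact: csph_dpoisson.
Qed.

(** The Poisson formula for the dilate by [r = 1 - t] is differentiated at [x / r]. The Lipschitz
    bound on the kernel derivative and [r |x / r - x| = t |x|] give an error linear in [t], and [t]
    tends to 0. *)
Lemma gradient_bound (u : 'rV[R]_k.+2 -> R) (M : R) x l : unit_ballE x ->
  harmonic_on (@unit_ballE R k.+2) u ->
  (forall y, unit_ballE y -> `|u y| <= M) ->
  `|dotR (grad u x) l| <= M * grad_norm x l.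
Proof.
have arith (t a b c e : R) :
    (1 - t) * ((1 - t) * a) <= (1 - t) * b + c * (t * e) -> 0 <= t * b ->
    0 <= t ^+ 2 * a -> a <= b + t * (2 * a + c * e).
  by lra.
move=> x1 hu uM; have [du _ _ _] := hu; rewrite dotR_grad; last exact: du.
set D := `|_|.
have M0 : 0 <= M by apply: le_trans (uM x x1).
have [s s1 xs] := ball_between x1.
have [_ [C C0 HC]] := unif_diff_dpoisson s1 l.
have xs' := nbhs_singleton xs.
have [d d0 Hd] : exists2 d, 0 < d < 1 &
    forall t, 0 < t < d -> subball s ((1 - t)^-1 *: x).
  have X0 := dotR_ge0 x.
  (* Then [(1 - t)^2 s >= s - 2 t s > |x|^2] since [s < 1], so [x / (1 - t)] stays in the smaller
     ball. *)
  exists (Num.min (1 / 2) ((s - dotR x x) / 2)).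
    rewrite lt_min gt_min; apply/andP; split; last by apply/orP; left; lra.
    by rewrite !divr_gt0 // subr_gt0.
  move=> t; rewrite lt_min => /andP[t0 /andP[t2 ts]].
  have t1 : 0 < 1 - t by lra.
  rewrite /subball /= !dotRE mulrA -invfM -expr2 mulrC ltr_pdivrMr ?exprn_gt0 //.
  have s0 : 0 < s by exact: le_lt_trans xs'.
  by nra.
have [d0' d1] := andP d0.
apply: (@le_limit_linear _ _ (2 * D + M * C * `|x|) d) => // t /andP[t0 td].
have r01 : 0 < 1 - t < 1 by lra.
have [r0 r1] := andP r01.
set r := 1 - t in r01 r0 r1.
pose y := r^-1 *: x.
have ys : subball s y by apply: Hd; rewrite t0.
have y1 : unit_ballE y := @subball_unit R k.+2 s s1 y ys.
have ry : r *: y = x by rewrite /y scalerA divff ?gt_eqF // scale1r.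
pose f z := u (r *: z).
have rB z : dotR z z <= 1 -> unit_ballE (r *: z).
  rewrite /unit_ballE /= !dotRE; have := dotR_ge0 z; nra.
have cf : csph f.
  move=> z z1.
  have c1 : {for z, continuous (fun z : 'rV[R]_k.+2 => r *: z)} by exact: scaler_continuous.
  have c2 : {for r *: z, continuous u}.
    by apply: differentiable_continuous; apply: du; apply: rB; rewrite z1.
  exact: (continuous_comp c1 c2).
have [_ DE] := pint_diff_eq mL cf (phi := id) (fun z h => h) (fun g h => h) y1
  (poisson_formula k0 r01 hu).
have dux : differentiable u (r *: y) by rewrite ry; exact: du.
have DE1 : r * 'D_l u x = Lam (fun z => dpoisson y z l * f z).
  rewrite -DE -{1}ry.
  by rewrite (@derive_val _ _ _ _ _ _ _ (is_derive_scale l dux)).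
have cdy : csph (fun z => dpoisson y z l) by exact: csph_dpoisson.
have cdx : csph (fun z => dpoisson x z l) by exact: csph_dpoisson.
have b1 : r * D <= M * grad_norm y l.
  rewrite /D -(gtr0_norm r0) -normrM DE1 /grad_norm.
  have [_ LZ _ _] := mL; rewrite -LZ; last exact: csph_norm.
  apply: (mean_norm_le mL) => [||z z1]; first exact: csphM.
    by apply: csphM; [exact: csph_cst|exact: csph_norm].
  by rewrite normrM mulrC ler_wpM2r //; apply: uM; apply: rB; rewrite z1.
have b2 : grad_norm y l <= grad_norm x l + C * `|y - x|.
  rewrite -lerBlDl; apply: le_trans (ler_norm _) _.
  apply: (mean_dist_le mL) => [||z z1]; [exact: csph_norm|exact: csph_norm|].
  apply: le_trans (ler_dist_dist _ _) _.
  by have [] := HC x y z xs' ys z1.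
have yx : r * `|y - x| = t * `|x|.
  rewrite -(gtr0_norm r0) -normrZ scalerBr ry -[X in X - _]scale1r -scalerBl.
  by rewrite normrZ /r opprB addrCA subrr addr0 gtr0_norm.
have b3 : r * (r * D) <= r * (M * grad_norm x l) + M * C * (t * `|x|).
  rewrite -yx; have := ler_wpM2l M0 b2; have := le_trans b1.
  move=> /[apply] /(ler_wpM2l (ltW r0)) b; apply: le_trans b _.
  by rewrite le_eqVlt; apply/orP; left; apply/eqP; ring.
have F0 := mulr_ge0 M0 (grad_norm_ge0 l x1).
have D0 : 0 <= D by exact: normr_ge0.
have G0 := mulr_ge0 (ltW t0) F0.
have T0 := mulr_ge0 (exprn_ge0 2 (ltW t0)) D0.
exact: (arith _ _ _ _ _ b3 G0 T0).
Qed.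

Lemma pint_bound (f : 'rV[R]_k.+2 -> R) y : csph f ->
  (forall z, sph z -> `|f z| <= 1) -> unit_ballE y -> `|pint Lam f id y| <= 1.
Proof.
move=> cf f1 y1; have cP := csph_poisson y1.
rewrite -[leRHS](avg_poisson k0 y1).
apply: (mean_norm_le mL) => // [|z z1]; first exact: csphM.
rewrite normrM (_ : `|poisson y z| = poisson y z).
  rewrite ler_piMr ?f1 // mulr_ge0 ?subr_ge0 ?ltW //.
  by rewrite exprn_gt0 // invdist_gt0.
rewrite ger0_norm // mulr_ge0 ?subr_ge0 ?ltW //.
by rewrite exprn_gt0 // invdist_gt0.
Qed.

(** The upper bound is [gradient_bound]. For the lower one, the ideal boundary datum is the sign of
    the kernel derivative; being discontinuous, it is replaced by a regularised sign at the cost of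
    [e]. *)
Theorem C_optE x l : unit_ballE x -> C_opt x l = grad_norm x l.
Proof.
move=> x1; rewrite /C_opt; set A := [set c | _].
pose B := @unit_ballE R k.+2.
have idh (f : 'rV[R]_k.+2 -> R) (cf : csph f) :=
  pint_harmonic mL cf (phi := id) (fun z h => h) (fun g h => h).
have bd (f : 'rV[R]_k.+2 -> R) : csph f -> (forall z, sph z -> `|f z| <= 1) ->
    bounded_on B (pint Lam f id).
  by move=> cf f1; exists 1 => y; exact: pint_bound.
have c1 : csph (fun _ : 'rV[R]_k.+2 => 1 : R) by exact: csph_cst.
have n1 (z : 'rV[R]_k.+2) : sph z -> `|1 : R| <= 1 by rewrite normr1.
(* Tested on the constant 1, written as its own Poisson integral, whose supremum is 1. It bounds the
   set below for [inf] and allows multiplying the supremum bound by [c]. *)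
have A0 c : A c -> 0 <= c.
  move=> /(_ _ (idh _ c1) (bd _ c1 n1)) h.
  have <- : c * sup [set `|pint Lam (fun=> 1) id y| | y in B] = c.
    rewrite (_ : [set _ | _ in _] = [set 1]) ?sup1 ?mulr1 //.
    have E y : B y -> `|pint Lam (fun=> 1) id y| = 1.
      move=> y1; rewrite -[RHS](normr1 R) -[X in _ = `|X|](avg_poisson k0 y1).
      by congr `|Lam _|; apply/funext => z; rewrite mulr1.
    apply/seteqP; split => [_ [y y1 <-]|_ ->] /=; first exact: E.
    by exists x => //; exact: E.
  by apply: le_trans h.
have FA : A (grad_norm x l).
  move=> u hu [M uM]; rewrite mulrC.
  have hs : has_ubound [set `|u y| | y in B] by exists M => _ [y y1 <-]; exact: uM.
  apply: gradient_bound => // y y1.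
  by apply: ub_le_sup => //; exists y.
apply/eqP; rewrite eq_le; apply/andP; split.
  by apply: ge_inf => //; exists 0 => c; exact: A0.
apply: lb_le_inf; first by exists (grad_norm x l).
move=> c Ac; apply/ler_addgt0Pr => e e0.
have cG : csph (fun z => dpoisson x z l) by exact: csph_dpoisson.
have Gp z : 0 < `|dpoisson x z l| + e by rewrite ltr_wpDl.
(* With [G] the kernel derivative, [G f = G^2 / (|G| + e) >= |G| - e] while [|f| <= 1]. *)
pose f z := dpoisson x z l * (`|dpoisson x z l| + e)^-1.
have cf : csph f.
  apply: csphM => //; apply: csphV => [|z _]; last by rewrite gt_eqF.
  by apply: csphD; [exact: csph_norm|exact: csph_cst].
have f1 z : sph z -> `|f z| <= 1.
  move=> _; rewrite normrM normfV (gtr0_norm (Gp z)) ler_pdivrMr // mul1r.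
  by rewrite lerDl ltW.
have := Ac _ (idh _ cf) (bd _ cf f1).
have [dv Dv] := pint_diff mL cf (phi := id) (fun z h => h) (fun g h => h) x1.
rewrite dotR_grad // Dv => h.
have [LD LZ Lle L1] := mL.
have cGf : csph (fun z => dpoisson x z l * f z) by exact: csphM.
have b1 : grad_norm x l <= Lam (fun z => dpoisson x z l * f z) + e.
  rewrite -[X in _ <= _ + X](mean_cst e mL) -LD //; last exact: csph_cst.
  apply: Lle => [||z z1]; first exact: csph_norm.
    by apply: csphD => //; exact: csph_cst.
  rewrite /f mulrA -expr2 -real_normK ?num_real //.
  have := normr_ge0 (dpoisson x z l); move: (Gp z); set g := `|_| => gp g0.
  rewrite -(ler_pM2r gp) mulrDl mulfVK ?gt_eqF //; nra.
apply: le_trans b1 _; rewrite lerD2r; apply: le_trans (ler_norm _) _.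
apply: le_trans h _; rewrite -[leRHS]mulr1 ler_wpM2l //; first exact: A0.
apply: sup_le_ub => [|_ [y y1 <-]]; last exact: pint_bound.
by exists `|pint Lam f id x|; exists x.
Qed.

End optimal_constant.

(** * Monotonicity of the even part of the weight *)

Section weight.
Context {R : realType}.

(** Weighted arithmetic-geometric inequality. The Bernoulli bounds for [w ^+ k] and [w^-1 ^+ 4]
    leave the linear terms [4 k (w + w^-1 - 2) >= 0]. *)
Lemma bernoulli_balance (w : R) k : 0 < w ->
  k%:R + 4 <= 4 * w ^+ k + k%:R * w^-1 ^+ 4.
Proof.
move=> w0; have v0 : 0 < w^-1 by rewrite invr_gt0.
have h1 := bernoulli k (ltW w0); have h2 := bernoulli 4 (ltW v0).
have wv : w * w^-1 = 1 by rewrite divff // gt_eqF.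
have h3 : 2 <= w + w^-1.
  rewrite -(ler_pM2r w0) [leRHS]mulrDl mulVf ?gt_eqF //; have := sqr_ge0 (w - 1); nra.
have k0 : (0 : R) <= k%:R by [].
have : k%:R * (1 + 4 * (w^-1 - 1)) <= k%:R * w^-1 ^+ 4 by rewrite ler_wpM2l.
have : 0 <= k%:R * (w + w^-1 - 2) by rewrite mulr_ge0 // subr_ge0.
by lra.
Qed.

(* Tangent plane at [(1, 1)] of the convex function
   [(a, b) |-> a `^ ((k + 4) / 2) * b `^ (- k / 2)], with [a = x ^+ 2], [b = y ^+ 2]. *)
Lemma power_quotient_tangent (x y : R) k : 0 < x -> 0 < y ->
  1 + (k%:R + 4) / 2 * (x ^+ 2 - 1) - k%:R / 2 * (y ^+ 2 - 1) <=
    x ^+ (k + 4) / y ^+ k.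
Proof.
(* The quotient is the square of [P = x ^+ 2 * w ^+ k]. Then [P^2 >= 2 P - 1], and the balance
   inequality times [x ^+ 2] bounds [P] from below. *)
move=> x0 y0; pose w := Num.sqrt (x / y).
have w0 : 0 < w by rewrite sqrtr_gt0 divr_gt0.
have w2 : w ^+ 2 = x / y by rewrite sqr_sqrtr // divr_ge0 // ltW.
have -> : x ^+ (k + 4) / y ^+ k = (x ^+ 2 * w ^+ k) ^+ 2.
  by rewrite exprMn -[_ ^+ k ^+ 2]exprM mulnC exprM w2 expr_div_n exprD; ring.
have w4 : w^-1 ^+ 4 = y ^+ 2 / x ^+ 2.
  rewrite exprVn (_ : 4 = 2 * 2)%N // exprM w2 expr_div_n invf_div //.
have h := bernoulli_balance k w0; rewrite w4 in h.
have x20 : 0 < x ^+ 2 by rewrite exprn_gt0.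
have : x ^+ 2 * (k%:R + 4) <= 4 * (x ^+ 2 * w ^+ k) + k%:R * y ^+ 2.
  have := ler_wpM2l (ltW x20) h; rewrite [leRHS]mulrDr.
  rewrite (_ : x ^+ 2 * (k%:R * (y ^+ 2 / x ^+ 2)) = k%:R * y ^+ 2); last first.
    by field; rewrite gt_eqF.
  by rewrite mulrCA.
have := sqr_ge0 (x ^+ 2 * w ^+ k - 1).
move: (x ^+ 2 * w ^+ k) => P; nra.
Qed.

Definition gq (p t : R) k (s : R) :=
  Num.sqrt (1 + p * s) ^+ (k + 4) / Num.sqrt (1 + t * s) ^+ k.

(** Convexity as a supporting line: dividing both affine arguments by their values at [s0] moves the
    base point to [(1, 1)], where the tangent plane is known. *)
Lemma gq_tangent p t k s0 : 0 < 1 + p * s0 -> 0 < 1 + t * s0 ->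
  exists c, forall s, 0 < 1 + p * s -> 0 < 1 + t * s ->
    gq p t k s0 + c * (s - s0) <= gq p t k s.
Proof.
move=> p0 t0.
exists (gq p t k s0 * ((k%:R + 4) / 2 * (p / (1 + p * s0)) -
   k%:R / 2 * (t / (1 + t * s0)))) => s ps ts.
pose x := Num.sqrt (1 + p * s) / Num.sqrt (1 + p * s0).
pose y := Num.sqrt (1 + t * s) / Num.sqrt (1 + t * s0).
have g0 : 0 < gq p t k s0 by rewrite divr_gt0 // exprn_gt0 // sqrtr_gt0.
have sp : Num.sqrt (1 + p * s0) != 0 by rewrite gt_eqF // sqrtr_gt0.
have st : Num.sqrt (1 + t * s0) != 0 by rewrite gt_eqF // sqrtr_gt0.
have st' : Num.sqrt (1 + t * s) != 0 by rewrite gt_eqF // sqrtr_gt0.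
have E : gq p t k s = gq p t k s0 * (x ^+ (k + 4) / y ^+ k).
  rewrite /gq /x /y !expr_div_n; field.
  by rewrite !expf_neq0.
have x0 : 0 < x by rewrite divr_gt0 // sqrtr_gt0.
have y0 : 0 < y by rewrite divr_gt0 // sqrtr_gt0.
have := ler_wpM2l (ltW g0) (power_quotient_tangent k x0 y0).
rewrite -E; apply: le_trans; rewrite le_eqVlt; apply/orP; left; apply/eqP.
have -> : x ^+ 2 = (1 + p * s) / (1 + p * s0).
  by rewrite expr_div_n !sqr_sqrtr // ltW.
have -> : y ^+ 2 = (1 + t * s) / (1 + t * s0).
  by rewrite expr_div_n !sqr_sqrtr // ltW.
by field; rewrite !gt_eqF.
Qed.

Lemma one_plus_gt0 (p s : R) : `|p| < 1 -> `|s| <= 1 -> 0 < 1 + p * s.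
Proof.
move=> p1 s1; have : `|p * s| < 1.
  by rewrite normrM; apply: le_lt_trans p1; rewrite ler_piMr.
by rewrite ltr_norml => /andP[]; lra.
Qed.

(** The supporting line at [s], read at [s2] and [- s2], gives the chord inequality. For [s = s1]
    and [s = - s1] the chord weights are exchanged and add up to 1. *)
Lemma gq_even_part_homo p t k s1 s2 : `|p| < 1 -> `|t| < 1 ->
  0 <= s1 -> s1 <= s2 -> s2 <= 1 ->
  gq p t k s1 + gq p t k (- s1) <= gq p t k s2 + gq p t k (- s2).
Proof.
move=> p1 t1 s10 s12 s21.
have [s20|s20] := leP s2 0.
  have -> : s1 = s2 by lra.
  by [].
have s2n : `|s2| <= 1 by rewrite ger0_norm // ltW.
have s2n' : `|- s2| <= 1 by rewrite normrN.
have H s : `|s| <= s2 -> gq p t k s <=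
    (s + s2) / (2 * s2) * gq p t k s2 + (s2 - s) / (2 * s2) * gq p t k (- s2).
  move=> ss2; have s1' : `|s| <= 1 by exact: le_trans s21.
  have [c Hc] := gq_tangent k (one_plus_gt0 p1 s1') (one_plus_gt0 t1 s1').
  have a := Hc s2 (one_plus_gt0 p1 s2n) (one_plus_gt0 t1 s2n).
  have b := Hc (- s2) (one_plus_gt0 p1 s2n') (one_plus_gt0 t1 s2n').
  move: ss2; rewrite ler_norml => /andP[s2s ss2].
  have w1 : 0 <= (s + s2) / (2 * s2) by rewrite divr_ge0 //; lra.
  have w2 : 0 <= (s2 - s) / (2 * s2) by rewrite divr_ge0 //; lra.
  have := lerD (ler_wpM2l w1 a) (ler_wpM2l w2 b); apply: le_trans.
  by rewrite le_eqVlt; apply/orP; left; apply/eqP; field; rewrite gt_eqF.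
have n1 : `|s1| <= s2 by rewrite ger0_norm.
have n2 : `|- s1| <= s2 by rewrite normrN.
apply: le_trans (lerD (H _ n1) (H _ n2)) _.
by rewrite le_eqVlt; apply/orP; left; apply/eqP; field; rewrite gt_eqF.
Qed.

Definition slope (p y : R) := Num.sqrt (1 - p ^+ 2 + p ^+ 2 * y ^+ 2).

Definition weight (p t : R) k (y : R) :=
  Num.sqrt (slope p y + p * y) ^+ (k + 4) / (slope p y * Num.sqrt (slope p y + t * y) ^+ k).

Lemma slope_gt0 p y : `|p| < 1 -> 0 < slope p y.
Proof.
move=> p1; rewrite sqrtr_gt0.
have : 0 <= p ^+ 2 * y ^+ 2 by rewrite mulr_ge0 ?sqr_ge0.
have : p ^+ 2 < 1 by rewrite -(real_normK (num_real p)) expr_lt1.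
by lra.
Qed.

Lemma slope_sqr p y : `|p| < 1 -> slope p y ^+ 2 = 1 - p ^+ 2 + p ^+ 2 * y ^+ 2.
Proof. by move=> /slope_gt0 => /(_ y); rewrite sqrtr_gt0 => /ltW; exact: sqr_sqrtr. Qed.

Lemma norm_le_slope p y : `|p| < 1 -> `|y| <= 1 -> `|y| <= slope p y.
Proof.
move=> p1 y1; rewrite -(@ler_pXn2r _ 2) ?nnegrE //; last exact/ltW/slope_gt0.
rewrite slope_sqr // real_normK ?num_real //.
have : p ^+ 2 < 1 by rewrite -(real_normK (num_real p)) expr_lt1.
have : y ^+ 2 <= 1 by rewrite -(real_normK (num_real y)) expr_le1.
by nra.
Qed.

Lemma norm_div_slope p y : `|p| < 1 -> `|y| <= 1 -> `|y / slope p y| <= 1.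
Proof.
move=> p1 y1; rewrite normrM normfV (gtr0_norm (slope_gt0 y p1)).
by rewrite ler_pdivrMr ?slope_gt0 // mul1r norm_le_slope.
Qed.

Lemma slope_plus_gt0 p t y : `|p| < 1 -> `|t| < 1 -> `|y| <= 1 ->
  0 < slope p y + t * y.
Proof.
move=> p1 t1 y1; have d0 := slope_gt0 y p1.
rewrite (_ : _ + _ = slope p y * (1 + t * (y / slope p y))); last first.
  by field; rewrite gt_eqF.
by rewrite mulr_gt0 // one_plus_gt0 // norm_div_slope.
Qed.

(** Homogeneity: the exponents [(k + 4) / 2 - 1 - k / 2] of [slope] add up to 1. *)
Lemma weightE p t k y : `|p| < 1 -> `|t| < 1 -> `|y| <= 1 ->
  weight p t k y = slope p y * gq p t k (y / slope p y).
Proof.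
move=> p1 t1 y1; have d0 := slope_gt0 y p1.
have sE q : slope p y + q * y = slope p y * (1 + q * (y / slope p y)).
  by field; rewrite gt_eqF.
rewrite /weight /gq !sE !sqrtrM ?(ltW d0) // !exprMn (exprD (Num.sqrt (slope p y))).
have -> : Num.sqrt (slope p y) ^+ 4 = slope p y ^+ 2.
  by rewrite (_ : 4 = 2 * 2)%N // exprM sqr_sqrtr // ltW.
have t0 : 0 < 1 + t * (y / slope p y) by apply: one_plus_gt0 => //; exact: norm_div_slope.
have n1 : slope p y != 0 by rewrite gt_eqF.
have n2 : Num.sqrt (slope p y) != 0 by rewrite gt_eqF // sqrtr_gt0.
have n3 : Num.sqrt (1 + t * (y / slope p y)) != 0 by rewrite gt_eqF // sqrtr_gt0.
by field; rewrite !expf_neq0 // n1.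
Qed.

Lemma slopeN p y : slope p (- y) = slope p y.
Proof. by rewrite /slope sqrrN. Qed.

(** By [weightE] the even part is [slope] times the even part of [gq] at [y / slope]. Both [slope]
    and the modulus of [y / slope] are nondecreasing in [|y|]. *)
Lemma weight_even_part_homo p t k y1 y2 : `|p| < 1 -> `|t| < 1 ->
  `|y1| <= `|y2| -> `|y2| <= 1 ->
  weight p t k y1 + weight p t k (- y1) <= weight p t k y2 + weight p t k (- y2).
Proof.
move=> p1 t1 y12 y21; wlog y10 : y1 y12 / 0 <= y1.
  move=> H; have [|/ltW y1N] := leP 0 y1; first exact: H.
  by rewrite addrC -{2}(opprK y1); apply: H; rewrite ?normrN ?oppr_ge0.
wlog y20 : y2 y12 y21 / 0 <= y2.
  move=> H; have [|/ltW y2N] := leP 0 y2; first exact: H.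
  rewrite [leRHS]addrC -[in weight p t k y2](opprK y2).
  by apply: H; rewrite ?normrN ?oppr_ge0.
move: y12 y21; rewrite !ger0_norm // => y12 y21.
have n2 : `|y2| <= 1 by rewrite ger0_norm.
have n1 : `|y1| <= 1 by rewrite ger0_norm // (le_trans y12).
rewrite !weightE ?normrN // !slopeN !mulNr -!mulrDr.
have d1 := slope_gt0 y1 p1; have d2 := slope_gt0 y2 p1.
have s12 : y1 ^+ 2 <= y2 ^+ 2 by rewrite lerXn2r ?nnegrE.
have p2 : p ^+ 2 < 1 by rewrite -(real_normK (num_real p)) expr_lt1.
have p20 := sqr_ge0 p.
apply: ler_pM; first exact: ltW.
- rewrite addr_ge0 // divr_ge0 // exprn_ge0 // sqrtr_ge0.
- by rewrite ler_wsqrtr // lerD2l ler_wpM2l.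
apply: gq_even_part_homo => //.
- by rewrite divr_ge0 // ltW.
- rewrite ler_pdivrMr // mulrAC ler_pdivlMr //.
  rewrite -(@ler_pXn2r _ 2) ?nnegrE ?mulr_ge0 ?(ltW d1) ?(ltW d2) // !exprMn !slope_sqr //.
  have : 0 <= (1 - p ^+ 2) * (y2 ^+ 2 - y1 ^+ 2) by rewrite mulr_ge0 // subr_ge0 // ltW.
  by lra.
- by rewrite ler_pdivrMr // mul1r -[leLHS]ger0_norm // norm_le_slope.
Qed.

End weight.

(** * The change of polar angle *)

Section slices.
Context {R : realType}.

Definition clamp (u : R) : R := Num.max (-1) (Num.min 1 u).

Lemma clamp_id u : -1 <= u <= 1 -> clamp u = u.
Proof. by move=> /andP[u1 u2]; rewrite /clamp (min_r u2) (max_r u1). Qed.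

Lemma clamp_itv u : -1 <= clamp u <= 1.
Proof.
rewrite /clamp le_max lexx ge_max ge_min lexx /= andbT.
by lra.
Qed.

Lemma clamp_continuous : continuous clamp.
Proof.
move=> u; apply: (@continuous_max R R (fun=> -1) (fun u => Num.min 1 u)).
  exact: cst_continuous.
apply: (@continuous_min R R (fun=> 1) id); [exact: cst_continuous|exact: cvg_id].
Qed.

Definition height (u : R) : R := Num.sqrt (1 - u ^+ 2).

Lemma height_continuous : continuous height.
Proof.
move=> u.
have c : {for u, continuous (fun u : R => 1 - u ^+ 2)}.
  exact: (cvgB (cvg_cst _) (@exprn_continuous _ 2 u)).
exact: (continuous_comp c (@sqrt_continuous _ _)).
Qed.

Lemma height_arc u : -1 <= u <= 1 -> (- u) ^+ 2 + height u ^+ 2 = 1.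
Proof.
move=> /andP[u1 u2]; rewrite sqr_sqrtr; first by ring.
by nra.
Qed.

Variable j : nat.

(* The clamping only makes the integrand continuous outside [[-1, 1]]. *)
Definition slice (f : 'rV[R]_j.+3 -> R) (u : R) : R :=
  height (clamp u) ^+ j *
  avg (fun xi => f (consrv (- clamp u) (height (clamp u) *: xi))).

Lemma slice_continuous f : csph f -> continuous (slice f).
Proof.
move=> cf u.
have ch : {for u, continuous (fun u => height (clamp u))}.
  exact: (continuous_comp (@clamp_continuous u) (@height_continuous _)).
apply: cvgM.
  exact: (continuous_comp ch (@exprn_continuous _ j _)).
apply: (@avg_arc_continuous _ _ _ (fun u => - clamp u) (fun u => height (clamp u))) => //.
- exact: avg_mean.
- by move=> v; apply: height_arc; exact: clamp_itv.
- exact: (cvgN (@clamp_continuous u)).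
Qed.

(** Substitution [u = - cos t], increasing on [[0, pi]]; [du] absorbs one of the [j.+1] factors
    [sin t], which leaves the exponent [j] in [slice]. *)
Lemma avg_slice f : csph f ->
  avg f = (wsin j.+1)^-1 * intg (-1) 1 (slice f).
Proof.
move=> cf.
suff E : intg 0 pi (fun t => sin t ^+ j.+1 * avg (fun xi => f (polar t xi))) =
    intg (-1) 1 (slice f) by rewrite -E.
have pi0 : (0 : R) <= pi by exact: pi_ge0.
pose F (t : R) : R := - cos t.
have dF (t : R) : is_derive t 1 F (sin t).
  by apply: der_eq (derN (der_cos t)) _; rewrite opprK.
have F0 : F 0 = -1 by rewrite /F cos0.
have F1 : F pi = 1 by rewrite /F cospi opprK.
have -> : intg (-1) 1 (slice f) = intg (F 0) (F pi) (slice f) by rewrite F0 F1.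
rewrite (@intg_subst R 0 pi F (fun t => sin t)) //.
- apply: eq_intg => t /andP[t0 tpi].
  have s0 : 0 <= sin t by apply: sin_ge0_pi; rewrite t0.
  have c1 : -1 <= F t <= 1 by rewrite /F lerNl opprK lerNl cos_le1 cos_geN1.
  have hF : height (F t) = sin t.
    by rewrite /height /F sqrrN -sin2cos2 sqrtr_sqr ger0_norm.
  rewrite /slice (clamp_id c1) hF /F opprK exprSr mulrAC.
  by [].
- by move=> t; exact: sin_gt0_pi.
- by move=> t _; exact: continuous_sin.
- by move=> t _; exact: slice_continuous.
Qed.

Lemma slice_change (f1 f2 : 'rV[R]_j.+3 -> R) (c : R) (U U' : R -> R) : csph f1 ->
  U (-1) = -1 -> U 1 = 1 ->
  (forall v : R, -1 <= v <= 1 -> is_derive v 1 U (U' v)) ->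
  (forall v, -1 < v < 1 -> 0 < U' v) -> cont_on (-1) 1 U' -> csph f2 ->
  (forall v, -1 <= v <= 1 -> slice f1 (U v) * U' v = c * slice f2 v) ->
  avg f1 = c * avg f2.
Proof.
move=> cf1 UN U1 dU U'0 cU' cf2 E.
rewrite !avg_slice // mulrCA; congr (_ * _).
rewrite -intgZ; last by move=> v _; exact: slice_continuous.
have -> : intg (-1) 1 (slice f1) = intg (U (-1)) (U 1) (slice f1) by rewrite UN U1.
have N11 : (-1 : R) <= 1 by lra.
have cG : cont_on (U (-1)) (U 1) (slice f1) by move=> v _; exact: slice_continuous.
rewrite (intg_subst N11 U'0 dU cU' cG).
by apply: eq_intg => v; exact: E.
Qed.

End slices.

Section direction.
Context {R : realType}.
Variable j : nat.
Notation K := (j.+1%:R : R).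
Variable rho : R.
Hypotheses (rho0 : 0 <= rho) (rho1 : rho < 1).

(* With these parameters the gradient in [x = rho *: e0] of the Poisson kernel at the
   sphere point with first coordinate [- abscissa focus center v] is a positive
   multiple of the sphere point with first coordinate [- v]: see [dpoisson_slice]. *)
Definition axial := (K + 2) * (1 - rho ^+ 2) + 4 * rho ^+ 2.
Definition lateral := (K + 2) * (1 - rho ^+ 2).
Definition center := rho * (K + 4 - K * rho ^+ 2) / axial.
Definition focus := rho * K / (K + 2).

Let K1 : 1 <= K.
Proof. by rewrite ler1n. Qed.

Let rr : rho ^+ 2 < 1.
Proof. by rewrite expr_lt1. Qed.

Let rr0 : 0 <= rho ^+ 2.
Proof. exact: sqr_ge0. Qed.

Lemma axial_gt0 : 0 < axial.
Proof.
have k1 := K1; have r1 := rr; have r0 := rr0.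
have : 0 < (K + 2) * (1 - rho ^+ 2) by rewrite mulr_gt0 ?subr_gt0 //; lra.
by rewrite /axial; lra.
Qed.

Lemma lateral_gt0 : 0 < lateral.
Proof.
have k1 := K1; have r1 := rr; have r0 := rr0.
by rewrite /lateral mulr_gt0 ?subr_gt0 //; lra. Qed.

Lemma focus_norm : `|focus| < 1.
Proof.
have k1 := K1; have r1 := rr; have r0 := rr0.
rewrite /focus ger0_norm; last by rewrite divr_ge0 ?mulr_ge0 //; lra.
have : 0 <= (1 - rho) * K by rewrite mulr_ge0 // subr_ge0 ltW.
by rewrite ltr_pdivrMr; lra.
Qed.

Lemma center_norm : `|center| < 1.
Proof.
have k1 := K1; have r1 := rr; have r0 := rr0.
rewrite /center ger0_norm; last first.
  by rewrite divr_ge0 ?mulr_ge0 // ?ltW ?axial_gt0 //; nra.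
rewrite ltr_pdivrMr ?axial_gt0 // mul1r /axial -subr_gt0.
rewrite (_ : _ - _ = (1 - rho) ^+ 2 * (K + 2 + K * rho)); last by ring.
by rewrite mulr_gt0 ?exprn_gt0 ?subr_gt0 //; nra.
Qed.

Lemma centerE : axial * center = rho * (2 * (1 + rho ^+ 2) + (K + 2) * (1 - rho ^+ 2)).
Proof.
have k1 := K1; have r1 := rr; have r0 := rr0.
by rewrite /center mulrC divfK ?gt_eqF ?axial_gt0 //; ring. Qed.

(** Squared distance from [rho *: e0] to the sphere points with first coordinate [center], where the
    gradient of the kernel is orthogonal to [e0]. *)
Definition scale := 1 + rho ^+ 2 - 2 * rho * center.

Lemma scaleE : scale = (K + 2) * (1 - rho ^+ 2) ^+ 2 / axial.
Proof.
have k1 := K1; have r1 := rr; have r0 := rr0.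
have a0 : axial != 0 by rewrite gt_eqF // axial_gt0.
rewrite -[LHS](mulfK a0); congr (_ / _).
rewrite /scale mulrBl -(mulrA _ center) (mulrC center) centerE /axial; ring.
Qed.

Lemma scale_gt0 : 0 < scale.
Proof.
have k1 := K1; have r1 := rr; have r0 := rr0.
by rewrite scaleE divr_gt0 ?axial_gt0 // mulr_gt0 ?exprn_gt0 ?subr_gt0 //; lra.
Qed.

(** This relation explains the choice of [focus]: it factors the squared distance from [rho *: e0]
    to the pole as [scale (slope + focus v) / pole] in the new variable. *)
Lemma scale_focus : scale * focus = 2 * rho - (1 + rho ^+ 2) * center.
Proof.
have k1 := K1; have r1 := rr; have r0 := rr0.
have a0 : axial != 0 by rewrite gt_eqF // axial_gt0.
have k2 : K + 2 != 0 by rewrite gt_eqF //; lra.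
apply: (mulfI a0); rewrite mulrBr (mulrCA axial _ center) centerE scaleE /focus.
transitivity ((1 - rho ^+ 2) ^+ 2 * (rho * K)); first field.
  by rewrite a0 andbT gt_eqF //; have := ler0n R j; lra.
by rewrite /axial; ring.
Qed.

(** Links the semi-axes of the ellipsoid to [center] and [focus], so that one root, [slope focus v],
    serves both the radial projection and the distance. *)
Lemma axial_lateral :
  axial ^+ 2 * (1 - center ^+ 2) = lateral ^+ 2 * (1 - focus ^+ 2).
Proof.
have k1 := K1; have r1 := rr; have r0 := rr0.
have k2 : K + 2 != 0 by rewrite gt_eqF //; lra.
rewrite mulrBr mulr1 -exprMn centerE /lateral /focus.
transitivity (((K + 2) ^+ 2 - (rho * K) ^+ 2) * (1 - rho ^+ 2) ^+ 2); last by field.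
by rewrite /axial; ring.
Qed.

End direction.

Section substitution.
Context {R : realType}.
Variables (p t : R).
Hypotheses (p1 : `|p| < 1) (t1 : `|t| < 1).

Definition pole (v : R) := slope p v - t * v.
(** Solution [U] of the proportionality of [(axial (U + t), lateral height U)] to [(v, height v)],
    for [t = center] and [p = focus]. It is obtained from a quadratic equation whose reduced
    discriminant is [slope p v ^+ 2]. *)
Definition abscissa (v : R) := (v - t * slope p v) / pole v.
Definition dabscissa (v : R) :=
  (1 - t ^+ 2) * (1 - p ^+ 2) / (slope p v * pole v ^+ 2).

Lemma sqr_lt1 (a : R) : `|a| < 1 -> 0 < 1 - a ^+ 2.
Proof. by move=> a1; rewrite subr_gt0 -(real_normK (num_real a)) expr_lt1. Qed.

Lemma itv_norm (v : R) : -1 <= v <= 1 -> `|v| <= 1.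
Proof. by rewrite ler_norml. Qed.

Lemma pole_gt0 v : `|v| <= 1 -> 0 < pole v.
Proof.
move=> v1; have nt : `|- t| < 1 by rewrite normrN.
by have := slope_plus_gt0 p1 nt v1; rewrite mulNr.
Qed.

Lemma slope1 v : v ^+ 2 = 1 -> slope p v = 1.
Proof. by move=> v1; rewrite /slope v1 mulr1 subrK sqrtr1. Qed.

Lemma abscissa1 : abscissa 1 = 1.
Proof.
have P := @pole_gt0 1; rewrite normr1 in P.
rewrite /abscissa; have := P (lexx _); rewrite /pole slope1 ?expr1n // mulr1 => q.
by rewrite divff // gt_eqF.
Qed.

Lemma abscissaN1 : abscissa (-1) = -1.
Proof.
have P := @pole_gt0 (-1); rewrite normrN normr1 in P.
have := P (lexx _); rewrite /abscissa /pole slope1 ?sqrrN ?expr1n // mulr1 mulrN1 opprK => q.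
by rewrite -opprD mulNr divff // gt_eqF.
Qed.

Lemma der_slope (v : R) : is_derive v 1 (slope p) (p ^+ 2 * v / slope p v).
Proof.
have d0 := slope_gt0 v p1; have d0' := d0; rewrite sqrtr_gt0 in d0'.
have dq := derD (der_cst (1 - p ^+ 2) v) (derM (der_cst (p ^+ 2) v) (derX 2 (der_id v))).
apply: der_eq (@der_sqrt R (fun y => 1 - p ^+ 2 + p ^+ 2 * y ^+ 2) v _ d0' dq) _.
by rewrite -/(slope p v) /= expr1; field; rewrite gt_eqF.
Qed.

Lemma der_pole (v : R) : is_derive v 1 pole (p ^+ 2 * v / slope p v - t).
Proof.
by apply: der_eq (derB (der_slope v) (derM (der_cst t v) (der_id v))) _; ring.
Qed.

Lemma der_abscissa (v : R) : `|v| <= 1 -> is_derive v 1 abscissa (dabscissa v).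
Proof.
move=> v1; have q0 : pole v != 0 by rewrite gt_eqF // pole_gt0.
have d0 : slope p v != 0 by rewrite gt_eqF // slope_gt0.
apply: der_eq (derM (derB (der_id v) (derM (der_cst t v) (der_slope v)))
  (derV q0 (der_pole v))) _.
rewrite /dabscissa; move: q0; rewrite /pole => q0.
have -> : (1 - t ^+ 2) * (1 - p ^+ 2) =
   (1 - t ^+ 2) * (slope p v ^+ 2 - p ^+ 2 * v ^+ 2) by rewrite slope_sqr //; ring.
by field; rewrite q0 d0.
Qed.

Lemma dabscissa_gt0 v : `|v| <= 1 -> 0 < dabscissa v.
Proof.
move=> v1; rewrite divr_gt0 // mulr_gt0 ?sqr_lt1 ?slope_gt0 //.
by rewrite exprn_gt0 // pole_gt0.
Qed.

Lemma dabscissa_cont : cont_on (-1) 1 dabscissa.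
Proof.
move=> v /itv_norm v1.
have n0 : slope p v * pole v ^+ 2 != 0.
  by rewrite mulf_neq0 ?expf_neq0 // gt_eqF // ?slope_gt0 ?pole_gt0.
have dq := derM (der_cst ((1 - t ^+ 2) * (1 - p ^+ 2)) v)
  (@derV R (fun v => slope p v * pole v ^+ 2) v _ n0
    (derM (der_slope v) (derX 2 (der_pole v)))).
exact: (is_derive_cont dq).
Qed.

Lemma height_abscissa v : -1 <= v <= 1 ->
  height (abscissa v) = Num.sqrt ((1 - t ^+ 2) * (1 - p ^+ 2)) * height v / pole v.
Proof.
move=> vI; have v1 := itv_norm vI; have q0 := pole_gt0 v1.
have n0 : 0 <= (1 - t ^+ 2) * (1 - p ^+ 2) by rewrite mulr_ge0 // ltW // sqr_lt1.
rewrite /height -sqrtrM // -(ger0_norm (ltW q0)) -sqrtr_sqr -sqrtrV ?sqr_ge0 //.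
rewrite -sqrtrM; last first.
  rewrite mulr_ge0 // subr_ge0 -(real_normK (num_real v)) expr_le1 //.
congr Num.sqrt; rewrite /abscissa /pole; move: q0; rewrite /pole => q0.
have E := slope_sqr v p1.
have -> : (1 - t ^+ 2) * (1 - p ^+ 2) * (1 - v ^+ 2) =
   (slope p v - t * v) ^+ 2 - (v - t * slope p v) ^+ 2.
  transitivity ((1 - t ^+ 2) * (slope p v ^+ 2 - v ^+ 2)); last by ring.
  by rewrite E; ring.
by field; rewrite gt_eqF.
Qed.

Lemma abscissa_itv v : -1 <= v <= 1 -> -1 <= abscissa v <= 1.
Proof.
move=> vI; have v1 := itv_norm vI; have q0 := pole_gt0 v1.
have n0 : 0 <= (1 - t ^+ 2) * (1 - p ^+ 2) * (1 - v ^+ 2).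
  have a1 := ltW (sqr_lt1 t1); have a2 := ltW (sqr_lt1 p1).
  have a3 : 0 <= 1 - v ^+ 2.
    by rewrite subr_ge0 -(real_normK (num_real v)) expr_le1.
  by rewrite !mulr_ge0.
rewrite -ler_norml -(@ler_pXn2r _ 2) ?nnegrE // real_normK ?num_real // expr1n.
rewrite /abscissa expr_div_n ler_pdivrMr ?exprn_gt0 // mul1r -subr_ge0.
rewrite (_ : _ - _ = (1 - t ^+ 2) * (slope p v ^+ 2 - v ^+ 2)); last first.
  by rewrite /pole; ring.
by apply: le_trans n0 _; rewrite slope_sqr // le_eqVlt; apply/orP; left; apply/eqP; ring.
Qed.

End substitution.

(** Matches latitude factor, kernel power and Jacobian with [mass] times the weighted slice: [q] is
    [pole] with root [s], [d] is [slope], [e] the root of [slope - p v]. In an abstract field the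
    powers of exponent [j] can be generalised before [field]. *)
Lemma scalar_balance (F : fieldType) j (k h s q e S a d A : F) :
  q = s ^+ 2 -> s != 0 -> S != 0 -> d != 0 ->
  (k * h / q) ^+ j * ((s * e / S) ^+ j.+1.+4 * (a / q) * A) * (k ^+ 2 / (d * q ^+ 2)) =
  k ^+ j.+2 * a / S ^+ j.+1.+4 * (h ^+ j * (e ^+ (j.+1 + 4) / (d * s ^+ j.+1) * A)).
Proof.
move=> -> s0 S0 d0; rewrite (_ : j.+1 + 4 = j.+1.+4)%N ?addn4 //.
rewrite !expr_div_n !exprMn !exprS ?expr0 ?mulr1.
have := expf_neq0 j s0; have := expf_neq0 j S0.
move: (s ^+ j) (S ^+ j) (e ^+ j) (k ^+ j) (h ^+ j) => x1 x2 x3 x4 x5 n1 n2.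
by field; rewrite s0 S0 d0 n1 n2.
Qed.

Section zonal_density.
Context {R : realType}.
Variable j : nat.
Variable rho : R.
Hypotheses (rho0 : 0 <= rho) (rho1 : rho < 1).
Notation p := (focus j rho).
Notation t := (center j rho).
Notation e0 := (stdbasis R j.+3 0).
Notation x := (rho *: e0).
Let p1 : `|p| < 1 := focus_norm j rho0 rho1.
Let t1 : `|t| < 1 := center_norm j rho0 rho1.

Lemma dot_e0 (l : 'rV[R]_j.+3) : dotR e0 l = l 0 ord0.
Proof. by rewrite dotRC (dot_stdbasis l ord0). Qed.

Lemma axis_ball : unit_ballE x.
Proof.
by rewrite /unit_ballE /= !dotRE (stdbasis_norm (ord0 : 'I_j.+3)) mulr1 -expr2 expr_lt1.
Qed.

Lemma weight_continuous k y : `|y| <= 1 -> {for y, continuous (weight p t k)}.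
Proof.
move=> y1; have d0 := slope_gt0 y p1.
have ds := der_slope p1 y.
have lin q := derD ds (derM (der_cst q y) (der_id y)).
have s1 q : `|q| < 1 -> 0 < slope p y + q * y by move=> q1; exact: slope_plus_gt0.
have sq q (q1 : `|q| < 1) := @der_sqrt R (fun y => slope p y + q * y) y _ (s1 q q1) (lin q).
have n0 : slope p y * Num.sqrt (slope p y + t * y) ^+ k != 0.
  by rewrite mulf_neq0 ?expf_neq0 // gt_eqF // sqrtr_gt0 s1.
have dq := derM (derX (k + 4) (sq p p1))
  (@derV R (fun y => slope p y * Num.sqrt (slope p y + t * y) ^+ k) y _ n0
    (derM ds (derX k (sq t t1)))).
exact: (is_derive_cont dq).
Qed.

Definition zonal (a b : 'rV[R]_j.+3) (z : 'rV[R]_j.+3) :=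
  `|dotR z a| * weight p t j.+1 (dotR z b).

Lemma dot_ball_le (z b : 'rV[R]_j.+3) : dotR z z <= 1 -> dotR b b = 1 ->
  `|dotR z b| <= 1.
Proof.
move=> z1 b1; rewrite -(@ler_pXn2r _ 2) ?nnegrE // real_normK ?num_real // expr1n.
by apply: le_trans (dotR_CS z b) _; rewrite b1 mulr1.
Qed.

Lemma zonal_ccball a b : dotR b b = 1 -> ccball (zonal a b).
Proof.
move=> b1 z z1.
have cd e : {for z, continuous (fun z => dotR z e)}.
  rewrite (_ : (fun z => dotR z e) = dotR e); first exact: dotR_continuous.
  by apply/funext => w; exact: dotRC.
exact: (cvgM (cvg_norm (cd a))
  (continuous_comp (cd b) (weight_continuous (dot_ball_le z1 b1)))).
Qed.

(** The constants left by [scalar_balance]. They do not involve [l], so for the comparison of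
    directions only the sign counts. *)
Definition mass :=
  Num.sqrt ((1 - t ^+ 2) * (1 - p ^+ 2)) ^+ j.+2 *
  (axial j rho * (1 - t ^+ 2)) /
  (Num.sqrt (scale j rho) * Num.sqrt (1 - p ^+ 2)) ^+ j.+1.+4.

Lemma mass_ge0 : 0 <= mass.
Proof.
have a0 := ltW (axial_gt0 j rho0 rho1); have t0 := ltW (sqr_lt1 t1).
apply: divr_ge0; last by rewrite exprn_ge0 // mulr_ge0 ?sqrtr_ge0.
by apply: mulr_ge0; [rewrite exprn_ge0 // sqrtr_ge0 | exact: mulr_ge0].
Qed.

Lemma dpoisson_slice l v (xi : 'rV[R]_j.+2) : -1 <= v <= 1 -> sph xi ->
  `|dpoisson x (consrv (- abscissa p t v) (height (abscissa p t v) *: xi)) l| =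
  (Num.sqrt (pole p t v) * Num.sqrt (slope p v - p * v) /
    (Num.sqrt (scale j rho) * Num.sqrt (1 - p ^+ 2))) ^+ j.+1.+4 *
  (axial j rho * (1 - t ^+ 2) / pole p t v) *
  `|dotR (consrv (- v) (height v *: xi)) l|.
Proof.
move=> vI xi1; have v1 := itv_norm vI.
have q0 := pole_gt0 p1 t1 v1; have qn : pole p t v != 0 by rewrite gt_eqF.
have sc0 := scale_gt0 j rho0 rho1.
have ax0 := axial_gt0 j rho0 rho1; have la0 := lateral_gt0 j rho0 rho1.
have pm0 : 0 < slope p v - p * v.
  have np : `|- p| < 1 by rewrite normrN.
  by have := slope_plus_gt0 p1 np v1; rewrite mulNr.
have pp0 : 0 < slope p v + p * v by exact: slope_plus_gt0.
have UI := abscissa_itv p1 t1 vI.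
set U := abscissa p t v in UI *.
have hU : height U = Num.sqrt ((1 - t ^+ 2) * (1 - p ^+ 2)) * height v / pole p t v.
  exact: (height_abscissa p1 t1 vI).
set z := consrv _ _.
have z1 : sph z by apply: arc_sph => //; exact: height_arc.
have pz : dotR x z = - (rho * U) by rewrite dotRZl dot_e0 consrv0 mulrN.
have xx : dotR x x = rho ^+ 2.
  by rewrite !dotRE (stdbasis_norm (ord0 : 'I_j.+3)) mulr1 expr2.
have qE : dotR (x - z) (x - z) = scale j rho * (slope p v + p * v) / pole p t v.
  rewrite dist_sph // pz xx.
  rewrite mulrDr (mulrA _ p) scale_focus // /U /abscissa /scale.
  by move: qn; rewrite /pole => qn; field.
(* The factorisation of [1 - p ^+ 2] trades [slope + p v] in the denominator for [slope - p v] in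
   the numerator, the form found in [weight] at [- v]. *)
have iE : invdist x z = Num.sqrt (pole p t v) * Num.sqrt (slope p v - p * v) /
    (Num.sqrt (scale j rho) * Num.sqrt (1 - p ^+ 2)).
  have -> : 1 - p ^+ 2 = (slope p v + p * v) * (slope p v - p * v).
    by rewrite mulrC -subr_sqr (slope_sqr v p1); ring.
  rewrite /invdist qE sqrtrM ?mulr_ge0 ?(ltW sc0) ?(ltW pp0) //.
  rewrite (sqrtrM _ (ltW sc0)) (sqrtrM _ (ltW pp0)) sqrtrV ?(ltW q0) //.
  field; rewrite !gt_eqF ?sqrtr_gt0 //.
set i := invdist x z in iE *.
pose l' := \row_k l 0 (lift ord0 k) : 'rV[R]_j.+2.
have zl a (w : 'rV[R]_j.+2) : dotR (consrv a w) l = a * l 0 ord0 + dotR w l'.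
  by rewrite [in LHS](consrv_eta l) dotR_consrv.
have xl : dotR x l = rho * l 0 ord0 by rewrite dotRZl dot_e0.
have nE : (j.+3%:R : R) = j.+1%:R + 2 by rewrite -[j.+3]addn2 natrD.
(* The squares agree by [axial_lateral]; this gives the axial and lateral components a common
   factor, so the vector points to the new sphere point. *)
have kap : lateral j rho * Num.sqrt ((1 - t ^+ 2) * (1 - p ^+ 2)) =
    axial j rho * (1 - t ^+ 2).
  have a1 := ltW (sqr_lt1 t1); have a2 := ltW (sqr_lt1 p1).
  have b1 : 0 <= lateral j rho * Num.sqrt ((1 - t ^+ 2) * (1 - p ^+ 2)).
    by apply: mulr_ge0 (ltW la0) _; exact: sqrtr_ge0.
  have b2 := mulr_ge0 (ltW ax0) a1.
  apply/eqP; rewrite -(@eqrXn2 _ 2) //.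
  rewrite (exprMn 2 (lateral j rho)) (exprMn 2 (axial j rho)) sqr_sqrtr; last exact: mulr_ge0.
  apply/eqP.
  transitivity (lateral j rho ^+ 2 * (1 - p ^+ 2) * (1 - t ^+ 2)); first by ring.
  by rewrite -(axial_lateral j rho0 rho1); ring.
have Ut : U + t = (1 - t ^+ 2) * v / pole p t v.
  by rewrite /U /abscissa; move: qn; rewrite /pole => qn; field.
have i2 : i ^+ 2 * (1 + rho ^+ 2 + 2 * rho * U) = 1.
  rewrite -[RHS](invdist_sqr axis_ball z1) -/i dist_sph // pz xx; ring.
have E : dpoisson x z l = i ^+ j.+1.+4 * (axial j rho * (1 - t ^+ 2) / pole p t v) *
    dotR (consrv (- v) (height v *: xi)) l.
  (* Brings the two terms of [dpoisson] to the common power [n + 2 = j + 5]. *)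
  have e3 : i ^+ j.+3 = i ^+ j.+1.+4 * (1 + rho ^+ 2 + 2 * rho * U).
    transitivity (i ^+ j.+3 * (i ^+ 2 * (1 + rho ^+ 2 + 2 * rho * U))).
      by rewrite i2 mulr1.
    by rewrite !exprS; ring.
  rewrite /dpoisson -/i xx xl dotRDl dotRNl xl !zl !dotRZl nE e3 hU.
  transitivity (i ^+ j.+1.+4 * (- l 0 ord0 * (axial j rho * (U + t)) +
     lateral j rho * Num.sqrt ((1 - t ^+ 2) * (1 - p ^+ 2)) *
       (height v / pole p t v * dotR xi l'))).
    rewrite [axial j rho * (U + t)]mulrDr (centerE j rho0 rho1) /axial /lateral.
    by field.
  by rewrite kap Ut; field.
rewrite E iE normrM ger0_norm // mulr_ge0 ?exprn_ge0 // divr_ge0 ?mulr_ge0 ?sqrtr_ge0 //.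
- exact: ltW.
- exact/ltW/sqr_lt1.
- exact: ltW.
Qed.

Lemma grad_norm_zonal l : grad_norm x l = mass * avg (zonal l e0).
Proof.
have e01 : dotR e0 e0 = 1 := stdbasis_norm (ord0 : 'I_j.+3).
have cf1 : csph (fun z => `|dpoisson x z l|).
  by apply: csph_norm; apply: csph_dpoisson; exact: axis_ball.
have cf2 : csph (zonal l e0) by apply: ccball_csph; exact: zonal_ccball.
have dU (v : R) : -1 <= v <= 1 -> is_derive v (1 : R) (abscissa p t) (dabscissa p t v).
  by move=> /itv_norm v1; exact: (der_abscissa p1 t1 v1).
have U'0 (v : R) : -1 < v < 1 -> 0 < dabscissa p t v.
  by move=> /andP[/ltW a /ltW b]; apply: (dabscissa_gt0 p1 t1); apply: itv_norm; rewrite a.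
apply: (@slice_change R j _ _ mass _ _ cf1 (abscissaN1 p1 t1) (abscissa1 p1 t1)
  dU U'0 (dabscissa_cont p1 t1) cf2).
move=> v vI; have v1 := itv_norm vI.
have q0 := pole_gt0 p1 t1 v1.
have UI := abscissa_itv p1 t1 vI.
rewrite /slice (clamp_id UI) (clamp_id vI).
have mL := avg_mean j.+1 (R := R); have [_ LZ _ _] := mL.
have cl : csph (fun xi : 'rV[R]_j.+2 => `|dotR (consrv (- v) (height v *: xi)) l|).
  apply: (@csph_arc R _ _ _ (fun z => `|dotR z l|)); first exact: height_arc.
  apply: csph_norm; rewrite (_ : (fun z => dotR z l) = dotR l); first exact: csph_dot.
  by apply/funext => w; exact: dotRC.
have cZ c : csph (fun xi : 'rV[R]_j.+2 => c * `|dotR (consrv (- v) (height v *: xi)) l|).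
  by apply: csphM => //; exact: csph_cst.
rewrite (mean_eq mL _ _ (fun xi xi1 => dpoisson_slice l vI xi1)); first last.
- exact: cZ.
- apply: (@csph_arc R _ _ _ (fun z => `|dpoisson x z l|)) => //.
  by apply: height_arc; exact: abscissa_itv.
rewrite LZ // height_abscissa //.
have -> : avg (fun xi : 'rV[R]_j.+2 => zonal l e0 (consrv (- v) (height v *: xi))) =
    weight p t j.+1 (- v) *
    avg (fun xi : 'rV[R]_j.+2 => `|dotR (consrv (- v) (height v *: xi)) l|).
  rewrite -LZ //; congr avg; apply/funext => xi.
  by rewrite /zonal (dotRC _ e0) dot_e0 consrv0 mulrC.
(* The slice has first coordinate [- v], so the weight is read at [- v], where [slope + t y] is
   [pole]. *)
rewrite /weight slopeN !mulrN.
rewrite -[slope p v - t * v]/(pole p t v) /mass /dabscissa.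
have n0 : 0 <= (1 - t ^+ 2) * (1 - p ^+ 2).
  by rewrite mulr_ge0 // ltW // sqr_lt1.
rewrite -{2}(sqr_sqrtr n0); apply: scalar_balance.
- by rewrite sqr_sqrtr // ltW.
- by rewrite gt_eqF // sqrtr_gt0.
- rewrite gt_eqF // mulr_gt0 ?sqrtr_gt0 ?scale_gt0 //; exact: sqr_lt1.
- by rewrite gt_eqF // slope_gt0.
Qed.

End zonal_density.

(** * Exchange of directions *)

Section reflection.
Context {R : realType} {n : nat}.
Implicit Types m y z : 'rV[R]_n.

(* The identity when [m = 0], since then the quotient is [0 / 0 = 0]. *)
Definition reflection m z := z - (2 * dotR z m / dotR m m) *: m.

Lemma dotR_reflection m y z :
  dotR (reflection m y) z = dotR y z - 2 * dotR y m / dotR m m * dotR m z.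
Proof. by rewrite /reflection dotRDl dotRNl dotRZl. Qed.

Lemma dotR_reflection_eq m z : dotR (reflection m z) m = - dotR z m.
Proof.
rewrite dotR_reflection; have [/dotR_eq0 ->|m0] := eqVneq (dotR m m) 0.
  by rewrite dotRC !dotR0l mulr0 subr0 oppr0.
by field.
Qed.

Lemma reflectionK m : involutive (reflection m).
Proof.
move=> z; rewrite [LHS]/reflection dotR_reflection_eq mulrN mulNr scaleNr opprK.
by rewrite /reflection subrK.
Qed.

Lemma reflection_isometry m y z :
  dotR (reflection m y) (reflection m z) = dotR y z.
Proof.
rewrite dotR_reflection (dotRC m (reflection m z)) dotR_reflection_eq.
rewrite (dotRC y (reflection m z)) dotR_reflection (dotRC z y) (dotRC m y).
have [/dotR_eq0 ->|m0] := eqVneq (dotR m m) 0; first by rewrite !dotR0l invr0; ring.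
by field.
Qed.

Lemma reflection_swap a b z : dotR a a = dotR b b ->
  dotR (reflection (a - b) z) a = dotR z b.
Proof.
move=> ab; rewrite dotR_reflection; have [E|m0] := eqVneq (dotR (a - b) (a - b)) 0.
  (* Degenerate case [a = b]: the reflection is the identity. *)
  rewrite E invr0 mulr0 mul0r subr0; congr dotR.
  by move/dotR_eq0 : E => /eqP; rewrite subr_eq0 => /eqP.
have E : 2 * dotR (a - b) a = dotR (a - b) (a - b).
  by rewrite !(dotRDl, dotRDr, dotRNl, dotRNr) (dotRC b a) -ab; ring.
rewrite mulrAC -(mulrA 2) (mulrC (dotR z _)) mulrA E mulrAC divff // mul1r.
by rewrite dotRDr dotRNr opprB addrC subrK.
Qed.

Lemma reflection_continuous m : continuous (reflection m).
Proof.
move=> z; have cd : {for z, continuous (fun z => dotR z m)}.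
  rewrite (_ : (fun z => dotR z m) = dotR m); first exact: dotR_continuous.
  by apply/funext => w; exact: dotRC.
have c1 : {for z, continuous (fun z => 2 * dotR z m / dotR m m)}.
  exact: (cvgM (cvgM (cvg_cst _) cd) (cvg_cst _)).
have c2 : {for z, continuous (fun z => (2 * dotR z m / dotR m m) *: m)}.
  exact: (cvgZr_tmp c1).
have ci : {for z, continuous (id : 'rV[R]_n -> 'rV[R]_n)} by exact: cvg_id.
exact: (cvgB ci c2).
Qed.

End reflection.

Lemma rearrangement (R : realDomainType) (a b c d : R) :
  a <= b -> c <= d -> b * c + a * d <= a * c + b * d.
Proof.
move=> ab cd; have : 0 <= (b - a) * (d - c) by rewrite mulr_ge0 // subr_ge0.
lra.
Qed.

Section comparison.
Context {R : realType}.
Variable j : nat.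
Variable rho : R.
Hypotheses (rho0 : 0 <= rho) (rho1 : rho < 1).
Notation p := (focus j rho).
Notation t := (center j rho).
Notation e0 := (stdbasis R j.+3 0).
Variable l : 'rV[R]_j.+3.
Hypothesis l1 : dotR l l = 1.

Let e1 : dotR e0 e0 = 1 := stdbasis_norm (ord0 : 'I_j.+3).

Lemma avg_zonal_le : avg (zonal rho l e0) <= avg (zonal rho e0 e0).
Proof.
have half (A B : R) : 2 * A + 2 * A <= 2 * B + 2 * B -> A <= B by lra.
have cz (a b : 'rV[R]_j.+3) : dotR b b = 1 -> ccball (zonal rho a b) by exact: zonal_ccball.
have [LD _ Lle _] := avg_mean j.+2 (R := R).
have inv := @avg_invariant R j.+1 isT.
have avgN (f : 'rV[R]_j.+3 -> R) : ccball f -> avg (f \o -%R) = avg f.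
  apply: (inv -%R f) => [|y z|]; first exact: opp_continuous.
    by rewrite dotRNl dotRNr opprK.
  exact: opprK.
have avgQ m (f : 'rV[R]_j.+3 -> R) : ccball f -> avg (f \o reflection m) = avg f.
  apply: (inv (reflection m) f); first exact: reflection_continuous.
    exact: reflection_isometry.
  exact: reflectionK.
pose Q := reflection (e0 - l).
have Qe z : dotR (Q z) e0 = dotR z l by apply: reflection_swap; rewrite e1 l1.
have Ql z : dotR (Q z) l = dotR z e0 by rewrite -Qe /Q reflectionK.
pose even (a b z : 'rV[R]_j.+3) := zonal rho a b z + zonal rho a b (- z).
have ce (a b : 'rV[R]_j.+3) : dotR b b = 1 -> csph (zonal rho a b) by move=> /cz/ccball_csph.
have ceN (a b : 'rV[R]_j.+3) : dotR b b = 1 -> csph (fun z => zonal rho a b (- z)).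
  move=> b1 z z1; have c1 : {for z, continuous (-%R : 'rV[R]_j.+3 -> _)}.
    exact: opp_continuous.
  apply: (continuous_comp c1 (ce a b b1 (- z) _)).
  by rewrite /sph /= dotRNl dotRNr opprK.
have cev a b : dotR b b = 1 -> csph (even a b).
  by move=> b1; apply: csphD; [exact: ce|exact: ceN].
have avg_even a b : dotR b b = 1 -> avg (even a b) = 2 * avg (zonal rho a b).
  move=> b1; rewrite /even (LD _ _ (ce a b b1) (ceN a b b1)).
  rewrite (avgN _ (cz a b b1)).
  by rewrite mulr_natl mulr2n.
have sw (a b a' b' : 'rV[R]_j.+3) : dotR b b = 1 -> (forall z, dotR (Q z) a = dotR z a') ->
    (forall z, dotR (Q z) b = dotR z b') ->
    avg (zonal rho a' b') = avg (zonal rho a b).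
  move=> b1 Qa Qb; rewrite -(avgQ (e0 - l) _ (cz a b b1)).
  by congr avg; apply/funext => z; rewrite /= /zonal -/Q Qa Qb.
(* [S1] equates the two mixed means and [S2] the two diagonal ones, so the symmetrised inequality
   contains each mean of the goal twice. *)
have S1 := sw _ _ _ _ e1 Ql Qe.
have S2 := sw _ _ _ _ e1 Qe Qe.
have main : avg (fun z => even l e0 z + even e0 l z) <=
    avg (fun z => even e0 e0 z + even l l z).
  apply: Lle; [by apply: csphD; exact: cev|by apply: csphD; exact: cev|].
  move=> z z1.
  have pt a b : even a b z = `|dotR z a| * (weight p t j.+1 (dotR z b) +
      weight p t j.+1 (- dotR z b)).
    by rewrite /even /zonal !dotRNl normrN mulrDr.
  rewrite !pt.
  have ball (b : 'rV[R]_j.+3) : dotR b b = 1 -> `|dotR z b| <= 1.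
    by apply: dot_ball_le; rewrite z1.
  have p1 := focus_norm j rho0 rho1; have t1 := center_norm j rho0 rho1.
  have /orP[h|h] := le_total `|dotR z e0| `|dotR z l|.
    apply: (rearrangement h).
    exact: (weight_even_part_homo _ p1 t1 h (ball _ l1)).
  rewrite [leLHS]addrC [leRHS]addrC; apply: (rearrangement h).
  exact: (weight_even_part_homo _ p1 t1 h (ball _ e1)).
move: main; rewrite (LD _ _ (cev _ _ e1) (cev _ _ l1)) (LD _ _ (cev _ _ e1) (cev _ _ l1)).
rewrite (avg_even _ _ e1) (avg_even _ _ l1) (avg_even _ _ e1) (avg_even _ _ l1) S1 S2.
exact: half.
Qed.

Lemma grad_norm_le : grad_norm (rho *: e0) l <= grad_norm (rho *: e0) e0.
Proof.
rewrite (grad_norm_zonal rho0 rho1 l) (grad_norm_zonal rho0 rho1 e0).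
by apply: ler_wpM2l; [exact: mass_ge0|exact: avg_zonal_le].
Qed.

Lemma C_opt_le : C_opt (rho *: e0) l <= C_opt (rho *: e0) e0.
Proof.
have xb := axis_ball j rho0 rho1.
rewrite (@C_optE _ j.+1 isT _ _ xb) (@C_optE _ j.+1 isT _ _ xb).
exact: grad_norm_le.
Qed.

End comparison.

Lemma ell_unit (R : realType) n (a : R) : dotR (ell n.+2 a) (ell n.+2 a) = 1.
Proof.
have s0 := stdbasis_norm (R := R) (ord0 : 'I_n.+2).
have s1 := stdbasis_norm (R := R) (lift ord0 ord0 : 'I_n.+2).
have s01 : dotR (stdbasis R n.+2 0) (stdbasis R n.+2 1) = 0.
  by rewrite (dot_stdbasis _ (lift ord0 ord0 : 'I_n.+2)) mxE.
rewrite /ell !(dotRDl, dotRDr, dotRZl, dotRZr) s0 s1 (dotRC _ (stdbasis _ _ 0)) s01.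
by rewrite !mulr0 addr0 add0r !mulr1 -!expr2 cos2Dsin2.
Qed.

Theorem theorem1p2 (R : realType) (n : nat) (rho : R) :
  (3 <= n)%N -> 0 <= rho -> rho < 1 ->
  forall alpha : R, 0 <= alpha -> alpha <= pi / 2 ->
    C_opt (rho *: stdbasis R n 0) (ell n alpha)
    <= C_opt (rho *: stdbasis R n 0) (ell n 0).
Proof.
case: n => [|[|[|j]]] // _ rho0 rho1 alpha _ _.
rewrite {2}/ell cos0 sin0 scale1r scale0r addr0.
by apply: C_opt_le => //; exact: ell_unit.
Qed.
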